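(* There are equivalences of $2$-categories $$\mathsf{Tng}(\mathsf{Fib})\simeq\mathsf{TngFib},\qquad \mathsf{Tng}_{\mathrm{co}}(\mathsf{Fib})\simeq\mathsf{TngFib}_{\mathrm{co}},\qquad \mathsf{Tng}_{\cong}(\mathsf{Fib})\simeq\mathsf{TngFib}_{\cong},\qquad \mathsf{Tng}_{=}(\mathsf{Fib})\simeq\mathsf{TngFib}_{=}.$$
   Context: **Fibrations.** Let $\Pi\colon\mathbb{X}'\to\mathbb{X}$ be a functor. An object $E$ of $\mathbb{X}'$ is over $A$ if $\Pi E=A$; a morphism $\varphi$ is over (a lift of) $f$ if $\Pi\varphi=f$; it is vertical if it is over an identity. A morphism $\varphi\colon\tilde E\to E'$ over $f\colon\tilde A\to A'$ is cartesian if for every $\psi\colon E\to E'$ over $g\colon A\to A'$ and every $h\colon A\to\tilde A$ with $f\circ h=g$ there is a unique lift $\xi\colon E\to\tilde E$ of $h$ with $\varphi\circ\xi=\psi$. A cloven fibration is a functor $\Pi$ with a chosen cartesian lift $\varphi^{(f)}_{E'}\colon f^*E'\to E'$ of $f$ for each $f\colon A\to A'$ in $\mathbb{X}$ and each $E'$ over $A'$. A $1$-morphism of cloven fibrations $(F,F')\colon\Pi_1\to\Pi_2$ is a pair of functors $F\colon\mathbb{X}_1\to\mathbb{X}_2$, $F'\colon\mathbb{X}_1'\to\mathbb{X}_2'$ with $\Pi_2F'=F\Pi_1$ such that for all $f$, $E'$ the unique vertical $\kappa^{(f)}\colon F'(f^*E')\to(Ff)^*(F'E')$ with $\varphi^{(Ff)}\circ\kappa^{(f)}=F'\varphi^{(f)}$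 is an isomorphism. A $2$-morphism $(\theta,\theta')\colon(F,F')\Rightarrow(G,G')$ is a pair of natural transformations $\theta\colon F\Rightarrow G$, $\theta'\colon F'\Rightarrow G'$ with $\Pi_2\theta'=\theta\Pi_1$. $\mathsf{Fib}$ is the resulting $2$-category of cloven fibrations (over varying bases). **Tangent objects.** Let $\mathbb{K}$ be a strict $2$-category and $\mathrm{End}(\mathbb{X})=\mathbb{K}(\mathbb{X},\mathbb{X})$. A limit in $\mathbb{K}(\mathbb{X},\mathbb{Y})$ is pointwise if it is preserved by $\mathbb{K}(f,\mathbb{Y})$ for every $1$-morphism $f\colon\mathbb{X}_0\to\mathbb{X}$. An additive bundle with projection $q\colon E\to B$ in a category consists of $q$, whose $n$-fold pullbacks $E_n$ along itself exist, with $z_q\colon B\to E$ and $s_q\colon E_2\to E$ making $q$ a commutative monoid in the slice over $B$; a morphism $(f,g)\colon(B,E,q,z_q,s_q)\to(B',E',q',z_{q}',s_{q}')$ consists of $f\colon B\to B'$, $g\colon E\to E'$ with $q'g=fq$, $gz_q=z'_qf$, $gs_q=s'_q(g\times_f g)$. A tangent object $(\mathbb{X},\mathbb{T})$ in $\mathbb{K}$ is an object $\mathbb{X}$ with a $1$-morphism $\mathrm{T}\colon\mathbb{X}\to\mathbb{X}$ and $2$-morphisms $p\colon\mathrm{T}\Rightarrow\mathrm{id}$, $z\colon\mathrm{id}\Rightarrow\mathrm{T}$, $s\colon\mathrm{T}_2\Rightarrow\mathrm{T}$, $l\colon\mathrm{T}\Rightarrow\mathrm{T}^2$, $c\colon\mathrm{T}^2\Rightarrow\mathrm{T}^2$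 such that: the $n$-fold pullbacks $\mathrm{T}_n$ of $p$ along itself exist in $\mathrm{End}(\mathbb{X})$, are pointwise, and are preserved by all $\mathrm{T}^m$; $(\mathrm{id},\mathrm{T},p,z,s)$ is an additive bundle in $\mathrm{End}(\mathbb{X})$; $(z,l)\colon(\mathrm{id},\mathrm{T},p,z,s)\to(\mathrm{T},\mathrm{T}^2,\mathrm{T}p,\mathrm{T}z,\mathrm{T}s)$ and $(\mathrm{id}_{\mathrm{T}},c)\colon(\mathrm{T},\mathrm{T}^2,\mathrm{T}p,\mathrm{T}z,\mathrm{T}s)\to(\mathrm{T},\mathrm{T}^2,p_{\mathrm{T}},z_{\mathrm{T}},s_{\mathrm{T}})$ are morphisms of additive bundles; $\mathrm{T}l\circ l=l_{\mathrm{T}}\circ l$; $c\circ c=\mathrm{id}$; $\mathrm{T}c\circ c_{\mathrm{T}}\circ\mathrm{T}c=c_{\mathrm{T}}\circ\mathrm{T}c\circ c_{\mathrm{T}}$; $c\circ l=l$; $\mathrm{T}l\circ c=c_{\mathrm{T}}\circ\mathrm{T}c\circ l_{\mathrm{T}}$; and the square with sides $\phi=\mathrm{T}s\circ\langle l\pi_1,z_{\mathrm{T}}\pi_2\rangle\colon\mathrm{T}_2\Rightarrow\mathrm{T}^2$, $\mathrm{T}p\colon\mathrm{T}^2\Rightarrow\mathrm{T}$, $p\pi_1\colon\mathrm{T}_2\Rightarrow\mathrm{id}$, $z\colon\mathrm{id}\Rightarrow\mathrm{T}$ is a pointwise pullback. A lax $1$-morphism $(F,\alpha)\colon(\mathbb{X},\mathbb{T})\to(\mathbb{X}',\mathbb{T}')$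 is a $1$-morphism $F$ with a $2$-morphism $\alpha\colon F\mathrm{T}\Rightarrow\mathrm{T}'F$ such that $(\mathrm{id}_F,\alpha)\colon(F,F\mathrm{T},Fp,Fz,Fs)\to(F,\mathrm{T}'F,p'_F,z'_F,s'_F)$ is additive, $\mathrm{T}'\alpha\circ\alpha_{\mathrm{T}}\circ Fl=l'_F\circ\alpha$ and $c'_F\circ\mathrm{T}'\alpha\circ\alpha_{\mathrm{T}}=\mathrm{T}'\alpha\circ\alpha_{\mathrm{T}}\circ Fc$. A colax $1$-morphism $(G,\beta)$ is a $1$-morphism $G$ with $\beta\colon\mathrm{T}'G\Rightarrow G\mathrm{T}$ satisfying the dual conditions, such that $\mathbb{K}(\mathbb{X},G)$ preserves the $n$-fold pointwise pullbacks of $p$ and the pointwise pullback of the universal property of the vertical lift. A colax $1$-morphism is strong if $\beta$ is invertible (it is then viewed also as a lax one via $\beta^{-1}$), and strict if $\beta$ is the identity. A lax $2$-morphism $\theta\colon(F,\alpha)\Rightarrow(G,\beta)$ is a $2$-morphism $\theta\colon F\Rightarrow G$ with $\mathrm{T}'\theta\circ\alpha=\beta\circ\theta_{\mathrm{T}}$; colax $2$-morphisms satisfy the dual condition. $\mathsf{Tng}(\mathbb{K})$ (resp. $\mathsf{Tng}_{\mathrm{co}}(\mathbb{K})$) is the $2$-category of tangent objects of $\mathbb{K}$ with lax (resp. colax) $1$- and $2$-morphisms; $\mathsf{Tng}_{\cong}(\mathbb{K})$ and $\mathsf{Tng}_{=}(\mathbb{K})$ are the sub-$2$-categories with strong, resp.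 strict, $1$-morphisms. A tangent category is a tangent object in $\mathsf{Cat}$ (concretely: a category $\mathbb{X}$ with an endofunctor $\mathrm{T}\colon\mathbb{X}\to\mathbb{X}$ and natural transformations $p\colon\mathrm{T}\Rightarrow\mathrm{id}$, $z\colon\mathrm{id}\Rightarrow\mathrm{T}$, $s\colon\mathrm{T}_2\Rightarrow\mathrm{T}$, $l\colon\mathrm{T}\Rightarrow\mathrm{T}^2$, $c\colon\mathrm{T}^2\Rightarrow\mathrm{T}^2$ such that, for every object $A$ of $\mathbb{X}$: the $n$-fold pullbacks $\mathrm{T}_nA$ of $p\colon\mathrm{T}A\to A$ along itself exist and are preserved by all $\mathrm{T}^m$; $(A,\mathrm{T}A,p,z,s)$ is an additive bundle in $\mathbb{X}$; $(z,l)\colon(A,\mathrm{T}A,p,z,s)\to(\mathrm{T}A,\mathrm{T}^2A,\mathrm{T}p,\mathrm{T}z,\mathrm{T}s)$ and $(\mathrm{id}_{\mathrm{T}A},c)\colon(\mathrm{T}A,\mathrm{T}^2A,\mathrm{T}p,\mathrm{T}z,\mathrm{T}s)\to(\mathrm{T}A,\mathrm{T}^2A,p_{\mathrm{T}},z_{\mathrm{T}},s_{\mathrm{T}})$ are morphisms of additive bundles; $\mathrm{T}l\circ l=l_{\mathrm{T}}\circ l$; $c\circ c=\mathrm{id}$; $\mathrm{T}c\circ c_{\mathrm{T}}\circ\mathrm{T}c=c_{\mathrm{T}}\circ\mathrm{T}c\circ c_{\mathrm{T}}$; $c\circ l=l$; $\mathrm{T}l\circ c=c_{\mathrm{T}}\circ\mathrm{T}c\circ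 l_{\mathrm{T}}$; and the square with sides $\phi=\mathrm{T}s\circ\langle l\pi_1,z_{\mathrm{T}}\pi_2\rangle\colon\mathrm{T}_2A\to\mathrm{T}^2A$, $\mathrm{T}p\colon\mathrm{T}^2A\to\mathrm{T}A$, $p\pi_1\colon\mathrm{T}_2A\to A$, $z\colon A\to\mathrm{T}A$ is a pullback; that is, with the limits computed and preserved objectwise), and lax/colax/strong/strict tangent morphisms and tangent natural transformations are the corresponding notions in $\mathsf{Cat}$ (a colax tangent morphism being required to preserve the $n$-fold pullbacks of $p$ and the vertical lift pullback). **Tangent fibrations.** A (cloven) tangent fibration $\Pi\colon(\mathbb{X}',\mathbb{T}')\to(\mathbb{X},\mathbb{T})$ between tangent categories is a cloven fibration $\Pi$ whose underlying functor is a strict tangent morphism and such that $(\mathrm{T},\mathrm{T}')\colon\Pi\to\Pi$ is a $1$-morphism of cloven fibrations. A lax (colax) morphism $\Pi_1\to\Pi_2$ of tangent fibrations consists of lax (colax) tangent morphisms $(F,\beta)\colon(\mathbb{X}_1,\mathbb{T}_1)\to(\mathbb{X}_2,\mathbb{T}_2)$ and $(F',\beta')\colon(\mathbb{X}'_1,\mathbb{T}'_1)\to(\mathbb{X}'_2,\mathbb{T}'_2)$ with $\Pi_2\circ(F',\beta')=(F,\beta)\circ\Pi_1$ as tangent morphisms and with $(F,F')$ a $1$-morphism of cloven fibrations. It is strong (strict) if both tangent morphisms are. The $2$-morphisms are pairs $(\theta,\theta')$ of lax (colax) tangent natural transformations with $\Pi_2\theta'=\theta\Pi_1$. $\mathsf{TngFib}$,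 $\mathsf{TngFib}_{\mathrm{co}}$, $\mathsf{TngFib}_{\cong}$, $\mathsf{TngFib}_{=}$ have tangent fibrations as objects and, respectively, lax, colax, strong, strict morphisms as $1$-morphisms (the base tangent morphism is not required to be strict in the first three).
   Formalization: Colax 1-morphisms as defined are not closed under composition, so in Tng_co(Fib) and TngFib_co the 1-morphisms are taken to be finite composites of colax ones; the equivalence is also shown to restrict to the colax 1-morphisms themselves. *)

(* Defs.v *)
From Stdlib Require Import ssreflect Fin.
From Stdlib Require Import ProofIrrelevance FunctionalExtensionality.
From Stdlib Require Import ClassicalEpsilon.

Set Implicit Arguments.
Unset Strict Implicit.
Unset Printing Implicit Defensive.
Unset Printing Records.

Record Category := {
  Ob :> Type;
  Hom : Ob -> Ob -> Type;
  idm : forall x, Hom x x;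
  comp : forall x y z, Hom y z -> Hom x y -> Hom x z;
  comp_idl : forall x y (f : Hom x y), comp (idm y) f = f;
  comp_idr : forall x y (f : Hom x y), comp f (idm x) = f;
  comp_assoc : forall w x y z (h : Hom y z) (g : Hom x y) (f : Hom w x),
    comp h (comp g f) = comp (comp h g) f }.

Arguments Hom {c} _ _.
Arguments idm {c} _.
Arguments comp {c x y z} _ _.
Infix "∘" := comp (at level 40, left associativity).

(* An equality of objects, seen as an (identity) morphism. *)
Definition idto {C : Category} {x y : C} (e : x = y) : Hom x y :=
  match e in _ = y' return Hom x y' with eq_refl => idm x end.

Definition is_iso {C : Category} {x y : C} (f : Hom x y) : Prop :=
  exists g : Hom y x, g ∘ f = idm x /\ f ∘ g = idm y.

(* Morphisms together with their source and target: [f ≡ g] says that f and g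
   have equal sources, equal targets, and are equal. *)
Record Arrow (C : Category) := pk { src : C; tgt : C; arr : Hom src tgt }.
Arguments pk {C src tgt} arr.
Notation "f ≡ g" := (pk f = pk g) (at level 70, no associativity).

Record Functor (C D : Category) := {
  fob :> C -> D;
  fmap : forall x y, Hom x y -> Hom (fob x) (fob y);
  fmap_id : forall x, fmap (idm x) = idm (fob x);
  fmap_comp : forall x y z (g : Hom y z) (f : Hom x y),
    fmap (g ∘ f) = fmap g ∘ fmap f }.
Arguments fmap {C D} f0 {x y} _.

Record NatTrans (C D : Category) (F G : Functor C D) := {
  nt :> forall x : C, Hom (F x) (G x);
  nt_nat : forall x y (f : Hom x y), nt y ∘ fmap F f = fmap G f ∘ nt x }.

Definition functor_id (C : Category) : Functor C C.
Proof. by unshelve refine {| fob := fun x => x; fmap := fun x y f => f |}. Defined.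

Definition functor_comp (C D E : Category) (G : Functor D E) (F : Functor C D) :
  Functor C E.
Proof.
  unshelve refine {| fob := fun x => G (F x);
                     fmap := fun x y f => fmap G (fmap F f) |}.
  - by move=> x; rewrite !fmap_id.
  - by move=> x y z g f; rewrite !fmap_comp.
Defined.

Lemma nt_eq (C D : Category) (F G : Functor C D) (a b : NatTrans F G) :
  (forall x, a x = b x) -> a = b.
Proof.
  case: a b => a Ha [b Hb] /= e.
  have e' : a = b by apply: functional_extensionality_dep.
  by subst b; f_equal; apply: proof_irrelevance.
Qed.

Definition nt_id (C D : Category) (F : Functor C D) : NatTrans F F.
Proof.
  unshelve refine {| nt := fun x => idm (F x) |}.
  by move=> x y f; rewrite comp_idl comp_idr.
Defined.

Definition nt_comp (C D : Category) (F G H : Functor C D)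
  (b : NatTrans G H) (a : NatTrans F G) : NatTrans F H.
Proof.
  unshelve refine {| nt := fun x => b x ∘ a x |}.
  by move=> x y f; rewrite -comp_assoc nt_nat comp_assoc nt_nat comp_assoc.
Defined.

Definition FunCat (C D : Category) : Category.
Proof.
  unshelve refine {| Ob := Functor C D; Hom := @NatTrans C D;
                     idm := @nt_id C D; comp := @nt_comp C D |}.
  - by move=> F G a; apply: nt_eq => x /=; rewrite comp_idl.
  - by move=> F G a; apply: nt_eq => x /=; rewrite comp_idr.
  - by move=> F G H K c b a; apply: nt_eq => x /=; rewrite comp_assoc.
Defined.

Definition nt_hcomp (C D E : Category) (G G' : Functor D E) (F F' : Functor C D)
  (b : NatTrans G G') (a : NatTrans F F') :
  NatTrans (functor_comp G F) (functor_comp G' F').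
Proof.
  unshelve refine (@Build_NatTrans C E (functor_comp G F) (functor_comp G' F')
                     (fun x => b (F' x) ∘ fmap G (a x)) _).
  move=> x y f /=.
  by rewrite -comp_assoc -fmap_comp [a y ∘ _]nt_nat fmap_comp comp_assoc
             [b _ ∘ _]nt_nat comp_assoc.
Defined.

Record TwoCat := {
  obj2 :> Type;
  hom : obj2 -> obj2 -> Category;
  id1 : forall x, hom x x;
  comp1 : forall x y z, hom y z -> hom x y -> hom x z;
  hcomp : forall x y z (g g' : hom y z) (f f' : hom x y),
    Hom g g' -> Hom f f' -> Hom (comp1 g f) (comp1 g' f');
  hcomp_id : forall x y z (g : hom y z) (f : hom x y),
    hcomp (idm g) (idm f) = idm (comp1 g f);
  hcomp_comp : forall x y z (g g' g'' : hom y z) (f f' f'' : hom x y)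
    (b' : Hom g' g'') (b : Hom g g') (a' : Hom f' f'') (a : Hom f f'),
    hcomp (b' ∘ b) (a' ∘ a) = hcomp b' a' ∘ hcomp b a;
  comp1_idl : forall x y (f : hom x y), comp1 (id1 y) f = f;
  comp1_idr : forall x y (f : hom x y), comp1 f (id1 x) = f;
  comp1_assoc : forall w x y z (h : hom y z) (g : hom x y) (f : hom w x),
    comp1 h (comp1 g f) = comp1 (comp1 h g) f;
  hcomp_idl : forall x y (f f' : hom x y) (a : Hom f f'),
    hcomp (idm (id1 y)) a ≡ a;
  hcomp_idr : forall x y (f f' : hom x y) (a : Hom f f'),
    hcomp a (idm (id1 x)) ≡ a;
  hcomp_assoc : forall w x y z (h h' : hom y z) (g g' : hom x y) (f f' : hom w x)
    (c : Hom h h') (b : Hom g g') (a : Hom f f'),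
    hcomp c (hcomp b a) ≡ hcomp (hcomp c b) a }.

Arguments hom {t} _ _.
Arguments id1 {t} x.
Arguments comp1 {t x y z} _ _.
Arguments hcomp {t x y z g g' f f'} _ _.
Infix "⊚" := comp1 (at level 38, right associativity).

Notation "g ◁ a" := (hcomp (idm g) a) (at level 37, right associativity).
Notation "b ▷ f" := (hcomp b (idm f)) (at level 37, right associativity).

Lemma comp1_idrl {K : TwoCat} {x y : K} (f : hom x y) : f ⊚ id1 x = id1 y ⊚ f.
Proof. by rewrite comp1_idr comp1_idl. Qed.

(* The associativity constraint; the 2-category being strict, it is an identity. *)
Definition asc {K : TwoCat} {w x y z : K}
  (h : hom y z) (g : hom x y) (f : hom w x) : Hom (h ⊚ (g ⊚ f)) ((h ⊚ g) ⊚ f) :=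
  idto (comp1_assoc h g f).
Definition asc' {K : TwoCat} {w x y z : K}
  (h : hom y z) (g : hom x y) (f : hom w x) : Hom ((h ⊚ g) ⊚ f) (h ⊚ (g ⊚ f)) :=
  idto (eq_sym (comp1_assoc h g f)).

(* [post g] is K(X,g) and [pre f] is K(f,Y). *)
Definition post {K : TwoCat} {x y z : K} (g : hom y z) : Functor (hom x y) (hom x z).
Proof.
  unshelve refine {| fob := fun f => g ⊚ f : hom x z; fmap := fun f f' a => g ◁ a |}.
  - by move=> f; apply: hcomp_id.
  - by move=> f f' f'' b a; rewrite -hcomp_comp comp_idl.
Defined.

Definition pre {K : TwoCat} {x y z : K} (f : hom x y) : Functor (hom y z) (hom x z).
Proof.
  unshelve refine {| fob := fun g => g ⊚ f : hom x z; fmap := fun g g' b => b ▷ f |}.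
  - by move=> g; apply: hcomp_id.
  - by move=> g g' g'' b a; rewrite -hcomp_comp comp_idl.
Defined.

Lemma pk_inj (C : Category) (x y : C) (f g : Hom x y) : f ≡ g -> f = g.
Proof.
  have H : forall A B : Arrow C, A = B -> forall (e1 : src A = src B) (e2 : tgt A = tgt B),
     idto e2 ∘ arr A = arr B ∘ idto e1.
    move=> A _ <- e1 e2.
    by rewrite (proof_irrelevance _ e1 eq_refl) (proof_irrelevance _ e2 eq_refl) /=
         comp_idl comp_idr.
  by move=> e; have := H _ _ e eq_refl eq_refl; rewrite /= comp_idl comp_idr.
Qed.

Lemma pk_eq (C : Category) (x y x' y' : C) (f : Hom x y) (g : Hom x' y')
  (ex : x = x') (ey : y = y') : idto ey ∘ f = g ∘ idto ex -> f ≡ g.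
Proof. by destruct ex, ey; rewrite /= comp_idl comp_idr => ->. Qed.

Definition pid {C : Category} (x : C) : Arrow C := pk (idm x).

Lemma pk_idto (C : Category) (x y : C) (e : x = y) : pk (idto e) = pid x.
Proof. by destruct e. Qed.

Definition vc {C : Category} (b a : Arrow C) : Arrow C :=
  match excluded_middle_informative (tgt a = src b) with
  | left e => pk (arr b ∘ idto e ∘ arr a)
  | right _ => a
  end.

Lemma pk_comp (C : Category) (x y z : C) (g : Hom y z) (f : Hom x y) :
  pk (g ∘ f) = vc (pk g) (pk f).
Proof.
  rewrite /vc; case: excluded_middle_informative => //= e.
  by rewrite (proof_irrelevance _ e eq_refl) /= comp_idr.
Qed.

Lemma vc_split (C : Category) (b a : Arrow C) : tgt a = src b ->
  exists x y z (g : Hom y z) (f : Hom x y), b = pk g /\ a = pk f.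
Proof.
  case: b a => y z g [x y' f] /= e; subst y'.
  by exists x, y, z, g, f.
Qed.

Lemma src_vc (C : Category) (b a : Arrow C) : tgt a = src b -> src (vc b a) = src a.
Proof. by move=> /vc_split [x [y [z [g [f [-> ->]]]]]]; rewrite -pk_comp. Qed.
Lemma tgt_vc (C : Category) (b a : Arrow C) : tgt a = src b -> tgt (vc b a) = tgt b.
Proof. by move=> /vc_split [x [y [z [g [f [-> ->]]]]]]; rewrite -pk_comp. Qed.

Lemma vc_idl (C : Category) (x : C) (a : Arrow C) : tgt a = x -> vc (pid x) a = a.
Proof. by case: a => y z a /= e; subst z; rewrite /pid -pk_comp comp_idl. Qed.
Lemma vc_idr (C : Category) (x : C) (a : Arrow C) : src a = x -> vc a (pid x) = a.
Proof. by case: a => y z a /= e; subst y; rewrite /pid -pk_comp comp_idr. Qed.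

Lemma vc_assoc (C : Category) (c b a : Arrow C) :
  tgt a = src b -> tgt b = src c -> vc c (vc b a) = vc (vc c b) a.
Proof.
  case: c b a => y z c [x y' b] [w x' a] /= e1 e2; subst.
  by rewrite -!pk_comp comp_assoc.
Qed.

Section HC.
Context {K : TwoCat}.

Definition hc {x y z : K} (b : Arrow (hom y z)) (a : Arrow (hom x y)) :
  Arrow (hom x z) := pk (hcomp (arr b) (arr a)).

Lemma pk_hcomp (x y z : K) (g g' : hom y z) (f f' : hom x y) (b : Hom g g')
  (a : Hom f f') : pk (hcomp b a) = hc (pk b) (pk a).
Proof. by []. Qed.

Lemma hc_assoc (w x y z : K) (c : Arrow (hom y z)) (b : Arrow (hom x y))
  (a : Arrow (hom w x)) : hc c (hc b a) = hc (hc c b) a.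
Proof. exact: hcomp_assoc. Qed.
Lemma hc_idl (x y : K) (a : Arrow (hom x y)) : hc (pid (id1 y)) a = a.
Proof. by rewrite /hc hcomp_idl; case: a. Qed.
Lemma hc_idr (x y : K) (a : Arrow (hom x y)) : hc a (pid (id1 x)) = a.
Proof. by rewrite /hc hcomp_idr; case: a. Qed.
Lemma hc_id (x y z : K) (g : hom y z) (f : hom x y) : hc (pid g) (pid f) = pid (g ⊚ f).
Proof. by rewrite /hc /pid /= hcomp_id. Qed.

Lemma hc_vc (x y z : K) (b' b : Arrow (hom y z)) (a' a : Arrow (hom x y)) :
  tgt b = src b' -> tgt a = src a' -> hc (vc b' b) (vc a' a) = vc (hc b' a') (hc b a).
Proof.
  move=> /vc_split [? [? [? [? [? [-> ->]]]]]] /vc_split [? [? [? [? [? [-> ->]]]]]].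
  by rewrite -!pk_comp /hc /= hcomp_comp.
Qed.

Lemma hc_vcr (x y z : K) (g : hom y z) (a' a : Arrow (hom x y)) :
  tgt a = src a' -> hc (pid g) (vc a' a) = vc (hc (pid g) a') (hc (pid g) a).
Proof. by move=> e; rewrite -hc_vc //= vc_idl. Qed.
Lemma hc_vcl (x y z : K) (f : hom x y) (b' b : Arrow (hom y z)) :
  tgt b = src b' -> hc (vc b' b) (pid f) = vc (hc b' (pid f)) (hc b (pid f)).
Proof. by move=> e; rewrite -hc_vc //= vc_idl. Qed.

Lemma hc_lr (x y z : K) (b : Arrow (hom y z)) (a : Arrow (hom x y)) :
  vc (hc b (pid (tgt a))) (hc (pid (src b)) a) = hc b a.
Proof. by rewrite -hc_vc //= vc_idl // vc_idr. Qed.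
Lemma hc_rl (x y z : K) (b : Arrow (hom y z)) (a : Arrow (hom x y)) :
  vc (hc (pid (tgt b)) a) (hc b (pid (src a))) = hc b a.
Proof. by rewrite -hc_vc //= vc_idl // vc_idr. Qed.
End HC.

Ltac bd :=
  cbn; repeat (first [rewrite src_vc; [solve [bd]|] | rewrite tgt_vc; [solve [bd]|]]; cbn);
  rewrite ?comp1_idl ?comp1_idr ?comp1_assoc; try reflexivity.
Ltac packed := rewrite ?pk_comp ?pk_hcomp ?pk_idto.
Ltac vid := repeat (first [rewrite vc_idl; [solve [bd]|] | rewrite vc_idr; [solve [bd]|]]).

Lemma functor_eq (C D : Category) (F G : Functor C D) :
  (forall x, F x = G x) -> (forall x y (f : Hom x y), fmap F f ≡ fmap G f) -> F = G.
Proof.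
  case: F G => F F1 Fi Fc [G G1 Gi Gc] /= eo em.
  have e : F = G by apply: functional_extensionality_dep.
  subst G.
  have e : F1 = G1.
    do 3 (apply: functional_extensionality_dep => ?).
    exact: pk_inj (em _ _ _).
  by subst G1; f_equal; apply: proof_irrelevance.
Qed.

Lemma nt_pk_eq (C D : Category) (F G F' G' : FunCat C D)
  (a : Hom F G) (a' : Hom F' G') :
  F = F' -> G = G' -> (forall x : C, nt a x ≡ nt a' x) -> a ≡ a'.
Proof.
  move=> e1 e2; subst F' G' => e.
  by congr pk; apply: nt_eq => x; apply: pk_inj.
Qed.

Definition Cat : TwoCat.
Proof.
  unshelve refine {| obj2 := Category; hom := FunCat; id1 := functor_id;
    comp1 := fun x y z g f => functor_comp g f;
    hcomp := fun x y z g g' f f' b a => nt_hcomp b a |}.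
  - by move=> x y z g f; apply: nt_eq => t /=; rewrite fmap_id comp_idl.
  - move=> x y z g g' g'' f f' f'' b' b a' a; apply: nt_eq => t /=.
    by rewrite fmap_comp !comp_assoc -(comp_assoc (b' _)) nt_nat comp_assoc.
  - by move=> x y f; apply: functor_eq.
  - by move=> x y f; apply: functor_eq.
  - by move=> w x y z h g f; apply: functor_eq.
  - move=> x y f f' a; apply: nt_pk_eq; try exact: functor_eq.
    by move=> t /=; rewrite comp_idl.
  - move=> x y f f' a; apply: nt_pk_eq; try exact: functor_eq.
    by move=> t /=; rewrite fmap_id comp_idr.
  - move=> w x y z h h' g g' f f' c b a; apply: nt_pk_eq; try exact: functor_eq.
    by move=> t /=; rewrite fmap_comp comp_assoc.
Defined.

Definition FullSub (C : Category) (P : C -> Prop) : Category.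
Proof.
  unshelve refine {| Ob := {x : C | P x};
            Hom := fun x y => Hom (proj1_sig x) (proj1_sig y);
            idm := fun x => idm (proj1_sig x);
            comp := fun x y z g f => g ∘ f |}.
  - by move=> x y f; apply: comp_idl.
  - by move=> x y f; apply: comp_idr.
  - by move=> w x y z h g f; apply: comp_assoc.
Defined.

Lemma sub_eq (T : Type) (P : T -> Prop) (x y : {t | P t}) :
  proj1_sig x = proj1_sig y -> x = y.
Proof.
  case: x y => x hx [y hy] /= e; subst y.
  by f_equal; apply: proof_irrelevance.
Qed.

Lemma sub_pk_eq (C : Category) (P : C -> Prop) (x y x' y' : FullSub P)
  (f : Hom x y) (f' : Hom x' y') :
  (f : Hom (proj1_sig x) (proj1_sig y)) ≡ (f' : Hom (proj1_sig x') (proj1_sig y')) ->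
  f ≡ f'.
Proof.
  move=> e.
  have ex : x = x' by apply: sub_eq; exact: (f_equal (@src C) e).
  have ey : y = y' by apply: sub_eq; exact: (f_equal (@tgt C) e).
  subst x' y'; apply: (f_equal (@pk (FullSub P) _ _)).
  exact: (@pk_inj C _ _ f f' e).
Qed.

(* The objects are reindexed along [i]; the 1-morphisms are those satisfying
   [P]; all 2-morphisms between them are kept. *)
Definition SubTwo (K : TwoCat) (O : Type) (i : O -> K)
  (P : forall x y : O, hom (i x) (i y) -> Prop)
  (Pid : forall x, P x x (id1 (i x)))
  (Pcomp : forall x y z (g : hom (i y) (i z)) (f : hom (i x) (i y)),
     P y z g -> P x y f -> P x z (g ⊚ f)) : TwoCat.
Proof.
  unshelve refine {| obj2 := O; hom := fun x y => FullSub (@P x y);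
    id1 := fun x => exist _ (id1 (i x)) (Pid x);
    comp1 := fun x y z g f => exist _ (proj1_sig g ⊚ proj1_sig f)
                               (Pcomp _ _ _ _ _ (proj2_sig g) (proj2_sig f));
    hcomp := fun x y z g g' f f' b a => @hcomp K _ _ _ (proj1_sig g) (proj1_sig g')
               (proj1_sig f) (proj1_sig f') b a |}.
  - by move=> *; apply: hcomp_id.
  - by move=> *; apply: hcomp_comp.
  - by move=> *; apply: sub_eq => /=; apply: comp1_idl.
  - by move=> *; apply: sub_eq => /=; apply: comp1_idr.
  - by move=> *; apply: sub_eq => /=; apply: comp1_assoc.
  - by move=> *; apply: sub_pk_eq => /=; apply: hcomp_idl.
  - by move=> *; apply: sub_pk_eq => /=; apply: hcomp_idr.
  - by move=> *; apply: sub_pk_eq => /=; apply: hcomp_assoc.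
Defined.

(* The 1-morphisms obtained from a class [P] by finite composition. *)
Inductive generated (K : TwoCat) (O : Type) (i : O -> K)
  (P : forall x y : O, hom (i x) (i y) -> Prop) :
  forall x y : O, hom (i x) (i y) -> Prop :=
| gen_mor x y (f : hom (i x) (i y)) : P x y f -> generated P f
| gen_id x : generated P (id1 (i x))
| gen_comp x y z (g : hom (i y) (i z)) (f : hom (i x) (i y)) :
    generated P g -> generated P f -> @generated K O i P x z (g ⊚ f).

Definition GenTwo (K : TwoCat) (O : Type) (i : O -> K)
  (P : forall x y : O, hom (i x) (i y) -> Prop) : TwoCat :=
  SubTwo (@gen_id K O i P) (@gen_comp K O i P).

Record Mor1 (K : TwoCat) := { m_dom : K; m_cod : K; m_arr :> hom m_dom m_cod }.

Record Sq (K : TwoCat) (P Q : Mor1 K) := {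
  sq_dom : hom (m_dom P) (m_dom Q);
  sq_cod : hom (m_cod P) (m_cod Q);
  sq_comm : Q ⊚ sq_dom = sq_cod ⊚ P }.

Record SqCell (K : TwoCat) (P Q : Mor1 K) (F G : Sq P Q) := {
  sc_dom : Hom (sq_dom F) (sq_dom G);
  sc_cod : Hom (sq_cod F) (sq_cod G);
  sc_comm : Q ◁ sc_dom ≡ sc_cod ▷ P }.

Lemma Sq_eq (K : TwoCat) (P Q : Mor1 K) (F G : Sq P Q) :
  sq_dom F = sq_dom G -> sq_cod F = sq_cod G -> F = G.
Proof.
  case: F G => d c e [d' c' e'] /= h1 h2; subst.
  by f_equal; apply: proof_irrelevance.
Qed.

Lemma SqCell_eq (K : TwoCat) (P Q : Mor1 K) (F G : Sq P Q) (a b : SqCell F G) :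
  sc_dom a = sc_dom b -> sc_cod a = sc_cod b -> a = b.
Proof.
  case: a b => d c e [d' c' e'] /= h1 h2; subst.
  by f_equal; apply: proof_irrelevance.
Qed.

Definition SqCat (K : TwoCat) (P Q : Mor1 K) : Category.
Proof.
  unshelve refine {| Ob := Sq P Q; Hom := @SqCell K P Q;
    idm := fun F => {| sc_dom := idm (sq_dom F); sc_cod := idm (sq_cod F) |};
    comp := fun F G H b a => {| sc_dom := sc_dom b ∘ sc_dom a;
                                sc_cod := sc_cod b ∘ sc_cod a |} |}.
  - by rewrite !hcomp_id sq_comm.
  - rewrite -(comp_idl (idm (m_arr Q))) -(comp_idl (idm (m_arr P))) !hcomp_comp !pk_comp.
    by rewrite !sc_comm.
  - by move=> *; apply: SqCell_eq; apply: comp_idl.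
  - by move=> *; apply: SqCell_eq; apply: comp_idr.
  - by move=> *; apply: SqCell_eq; apply: comp_assoc.
Defined.

Lemma SqCell_pk_eq (K : TwoCat) (P Q : Mor1 K) (F G F' G' : SqCat P Q)
  (a : Hom F G) (a' : Hom F' G') :
  sc_dom a ≡ sc_dom a' -> sc_cod a ≡ sc_cod a' -> a ≡ a'.
Proof.
  move=> e1 e2.
  have e : F = F'.
    apply: Sq_eq; [exact: (f_equal (@src _) e1) | exact: (f_equal (@src _) e2)].
  have e' : G = G'.
    apply: Sq_eq; [exact: (f_equal (@tgt _) e1) | exact: (f_equal (@tgt _) e2)].
  by subst F' G'; congr pk; apply: SqCell_eq; apply: pk_inj.
Qed.

Definition sq_id (K : TwoCat) (P : Mor1 K) : Sq P P.
Proof.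
  unshelve refine {| sq_dom := id1 (m_dom P); sq_cod := id1 (m_cod P) |}.
  by rewrite comp1_idl comp1_idr.
Defined.

Definition sq_comp (K : TwoCat) (P Q R : Mor1 K) (G : Sq Q R) (F : Sq P Q) : Sq P R.
Proof.
  unshelve refine {| sq_dom := sq_dom G ⊚ sq_dom F; sq_cod := sq_cod G ⊚ sq_cod F |}.
  by rewrite comp1_assoc (sq_comm G) -comp1_assoc (sq_comm F) comp1_assoc.
Defined.

Definition sq_hcomp (K : TwoCat) (P Q R : Mor1 K) (G G' : Sq Q R) (F F' : Sq P Q)
  (b : SqCell G G') (a : SqCell F F') : SqCell (sq_comp G F) (sq_comp G' F').
Proof.
  unshelve refine (@Build_SqCell K P R (sq_comp G F) (sq_comp G' F')
    (hcomp (sc_dom b) (sc_dom a)) (hcomp (sc_cod b) (sc_cod a)) _).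
  rewrite hcomp_assoc [LHS]pk_hcomp sc_comm -[LHS]pk_hcomp -hcomp_assoc.
  by rewrite [LHS]pk_hcomp sc_comm -[LHS]pk_hcomp hcomp_assoc.
Defined.

Definition ArrTwo (K : TwoCat) : TwoCat.
Proof.
  unshelve refine {| obj2 := Mor1 K; hom := @SqCat K; id1 := @sq_id K;
    comp1 := @sq_comp K; hcomp := @sq_hcomp K |}.
  - by move=> *; apply: SqCell_eq; apply: hcomp_id.
  - by move=> *; apply: SqCell_eq; apply: hcomp_comp.
  - by move=> *; apply: Sq_eq; apply: comp1_idl.
  - by move=> *; apply: Sq_eq; apply: comp1_idr.
  - by move=> *; apply: Sq_eq; apply: comp1_assoc.
  - by move=> *; apply: SqCell_pk_eq; apply: hcomp_idl.
  - by move=> *; apply: SqCell_pk_eq; apply: hcomp_idr.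
  - by move=> *; apply: SqCell_pk_eq; apply: hcomp_assoc.
Defined.

Record Endo (K : TwoCat) := { e_ob : K; e_T : hom e_ob e_ob }.

Section Lax.
Context {K : TwoCat}.

Record Lax (A B : Endo K) := {
  lx_F : hom (e_ob A) (e_ob B);
  lx_a : Hom (lx_F ⊚ e_T A) (e_T B ⊚ lx_F) }.

Record LaxCell (A B : Endo K) (F G : Lax A B) := {
  lxc :> Hom (lx_F F) (lx_F G);
  lxc_nat : e_T B ◁ lxc ∘ lx_a F = lx_a G ∘ lxc ▷ e_T A }.

Lemma Lax_eq (A B : Endo K) (F G : Lax A B) :
  lx_F F = lx_F G -> lx_a F ≡ lx_a G -> F = G.
Proof. by case: F G => F a [G b] /= e; subst G => /pk_inj ->. Qed.

Lemma LaxCell_eq (A B : Endo K) (F G : Lax A B) (a b : LaxCell F G) :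
  lxc a = lxc b -> a = b.
Proof. by case: a b => a h [b h'] /= e; subst b; f_equal; apply: proof_irrelevance. Qed.

Definition LaxCat (A B : Endo K) : Category.
Proof.
  unshelve refine {| Ob := Lax A B; Hom := @LaxCell A B;
    idm := fun F => {| lxc := idm (lx_F F) |};
    comp := fun F G H b a => {| lxc := lxc b ∘ lxc a |} |}.
  - by rewrite !hcomp_id comp_idl comp_idr.
  - rewrite -(comp_idl (idm (e_T B))) -(comp_idl (idm (e_T A))) !hcomp_comp.
    by rewrite -comp_assoc lxc_nat comp_assoc lxc_nat comp_assoc.
  - by move=> *; apply: LaxCell_eq; apply: comp_idl.
  - by move=> *; apply: LaxCell_eq; apply: comp_idr.
  - by move=> *; apply: LaxCell_eq; apply: comp_assoc.
Defined.

Lemma LaxCell_pk_eq (A B : Endo K) (F G F' G' : LaxCat A B)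
  (a : Hom F G) (a' : Hom F' G') : F = F' -> G = G' -> lxc a ≡ lxc a' -> a ≡ a'.
Proof.
  by move=> e1 e2; subst; move=> e; congr pk; apply: LaxCell_eq; apply: pk_inj.
Qed.

Definition lax_id (A : Endo K) : Lax A A :=
  {| lx_F := id1 (e_ob A);
     lx_a := idto (eq_sym (comp1_idrl (e_T A))) |}.

Definition lax_paste {X Y Z : K} {S : hom X X} {S' : hom Y Y} {S'' : hom Z Z}
  {F : hom X Y} {G : hom Y Z} (b : Hom (G ⊚ S') (S'' ⊚ G)) (a : Hom (F ⊚ S) (S' ⊚ F)) :
  Hom ((G ⊚ F) ⊚ S) (S'' ⊚ (G ⊚ F)) :=
  asc' S'' G F ∘ b ▷ F ∘ asc G S' F ∘ G ◁ a ∘ asc' G F S.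

Definition lax_comp (A B C : Endo K) (G : Lax B C) (F : Lax A B) : Lax A C :=
  {| lx_F := lx_F G ⊚ lx_F F; lx_a := lax_paste (lx_a G) (lx_a F) |}.

Lemma lax_id_pk (A : Endo K) : pk (lx_a (lax_id A)) = pid (e_T A).
Proof. by rewrite /= pk_idto comp1_idl. Qed.

Lemma lax_paste_pk {X Y Z : K} {S : hom X X} {S' : hom Y Y} {S'' : hom Z Z}
  {F : hom X Y} {G : hom Y Z} (b : Hom (G ⊚ S') (S'' ⊚ G)) (a : Hom (F ⊚ S) (S' ⊚ F)) :
  pk (lax_paste b a) = vc (hc (pk b) (pid F)) (hc (pid G) (pk a)).
Proof. by rewrite /lax_paste /asc /asc'; packed; vid. Qed.

Lemma lax_comp_pk (A B C : Endo K) (G : Lax B C) (F : Lax A B) :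
  pk (lx_a (lax_comp G F)) =
  vc (hc (pk (lx_a G)) (pid (lx_F F))) (hc (pid (lx_F G)) (pk (lx_a F))).
Proof. exact: lax_paste_pk. Qed.

Definition lax_hcomp (A B C : Endo K) (G G' : Lax B C) (F F' : Lax A B)
  (b : LaxCell G G') (a : LaxCell F F') : LaxCell (lax_comp G F) (lax_comp G' F').
Proof.
  unshelve refine (@Build_LaxCell _ _ (lax_comp G F) (lax_comp G' F')
    (hcomp (lxc b) (lxc a)) _).
  have E : vc (hc (pid (e_T C)) (hc (pk (lxc b)) (pk (lxc a)))) (pk (lx_a (lax_comp G F))) =
           vc (pk (lx_a (lax_comp G' F'))) (hc (hc (pk (lxc b)) (pk (lxc a))) (pid (e_T A))).
    rewrite !lax_comp_pk.
    have Ea := f_equal (@pk _ _ _) (lxc_nat a).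
    have Eb := f_equal (@pk _ _ _) (lxc_nat b).
    move: Ea Eb; rewrite !pk_comp !pk_hcomp -!/(pid _) => Ea Eb.
    rewrite vc_assoc; [bd|bd|].
    rewrite hc_assoc -hc_vc; [bd|bd|].
    rewrite Eb [vc (pk a) _]vc_idr //.
    have -> : hc (vc (pk (lx_a G')) (hc (pk b) (pid (e_T B)))) (pk a) =
              vc (hc (pk (lx_a G')) (pid (lx_F F'))) (hc (hc (pk b) (pid (e_T B))) (pk a)).
      by rewrite -hc_vc //; congr hc; rewrite vc_idl.
    rewrite -vc_assoc; [bd|bd|].
    rewrite -[RHS]vc_assoc; [bd|bd|]; congr vc.
    rewrite -!hc_assoc -hc_vc; [bd|bd|].
    rewrite -hc_vc; [bd|bd|].
    by rewrite Ea vc_idl // vc_idr.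
  apply: pk_inj; exact (eq_trans (pk_comp _ _) (eq_trans E (eq_sym (pk_comp _ _)))).
Defined.

Lemma lax_idl (A B : Endo K) (F : Lax A B) : lax_comp (lax_id B) F = F.
Proof.
  apply: Lax_eq; first exact: comp1_idl.
    rewrite lax_comp_pk lax_id_pk /= hc_id hc_idl. vid. done.
Qed.

Lemma lax_idr (A B : Endo K) (F : Lax A B) : lax_comp F (lax_id A) = F.
Proof.
  apply: Lax_eq; first exact: comp1_idr.
    rewrite lax_comp_pk lax_id_pk /= hc_id hc_idr. vid. done.
Qed.

Lemma lax_assoc (A B C D : Endo K) (H : Lax C D) (G : Lax B C) (F : Lax A B) :
  lax_comp H (lax_comp G F) = lax_comp (lax_comp H G) F.
Proof.
  apply: Lax_eq; first exact: comp1_assoc.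
    rewrite !lax_comp_pk /= -!hc_id hc_vcl; [bd|].
    rewrite hc_vcr; [bd|].
    by rewrite vc_assoc; [bd|bd|]; rewrite !hc_assoc.
Qed.

Definition LaxTwo : TwoCat.
Proof.
  unshelve refine {| obj2 := Endo K; hom := LaxCat; id1 := lax_id;
    comp1 := lax_comp; hcomp := lax_hcomp |}.
  - by move=> *; apply: LaxCell_eq; apply: hcomp_id.
  - by move=> *; apply: LaxCell_eq; apply: hcomp_comp.
  - exact: lax_idl.
  - exact: lax_idr.
  - exact: lax_assoc.
  - move=> A B F F' a; apply: LaxCell_pk_eq; try exact: hcomp_idl; exact: lax_idl.
  - move=> A B F F' a; apply: LaxCell_pk_eq; try exact: hcomp_idr; exact: lax_idr.
  - move=> *; apply: LaxCell_pk_eq; try exact: hcomp_assoc; exact: lax_assoc.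
Defined.
End Lax.

Section Colax.
Context {K : TwoCat}.

Record Colax (A B : Endo K) := {
  cx_F : hom (e_ob A) (e_ob B);
  cx_a : Hom (e_T B ⊚ cx_F) (cx_F ⊚ e_T A) }.

Record ColaxCell (A B : Endo K) (F G : Colax A B) := {
  cxc :> Hom (cx_F F) (cx_F G);
  cxc_nat : cx_a G ∘ e_T B ◁ cxc = cxc ▷ e_T A ∘ cx_a F }.

Lemma Colax_eq (A B : Endo K) (F G : Colax A B) :
  cx_F F = cx_F G -> cx_a F ≡ cx_a G -> F = G.
Proof. by case: F G => F a [G b] /= e; subst G => /pk_inj ->. Qed.

Lemma ColaxCell_eq (A B : Endo K) (F G : Colax A B) (a b : ColaxCell F G) :
  cxc a = cxc b -> a = b.
Proof. by case: a b => a h [b h'] /= e; subst b; f_equal; apply: proof_irrelevance. Qed.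

Definition ColaxCat (A B : Endo K) : Category.
Proof.
  unshelve refine {| Ob := Colax A B; Hom := @ColaxCell A B;
    idm := fun F => {| cxc := idm (cx_F F) |};
    comp := fun F G H b a => {| cxc := cxc b ∘ cxc a |} |}.
  - by rewrite !hcomp_id comp_idl comp_idr.
  - rewrite -(comp_idl (idm (e_T B))) -(comp_idl (idm (e_T A))) !hcomp_comp.
    by rewrite comp_assoc cxc_nat -comp_assoc cxc_nat comp_assoc.
  - by move=> *; apply: ColaxCell_eq; apply: comp_idl.
  - by move=> *; apply: ColaxCell_eq; apply: comp_idr.
  - by move=> *; apply: ColaxCell_eq; apply: comp_assoc.
Defined.

Lemma ColaxCell_pk_eq (A B : Endo K) (F G F' G' : ColaxCat A B)
  (a : Hom F G) (a' : Hom F' G') : F = F' -> G = G' -> cxc a ≡ cxc a' -> a ≡ a'.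
Proof.
  by move=> e1 e2; subst; move=> e; congr pk; apply: ColaxCell_eq; apply: pk_inj.
Qed.

Definition colax_id (A : Endo K) : Colax A A :=
  {| cx_F := id1 (e_ob A);
     cx_a := idto (comp1_idrl (e_T A)) |}.

Definition colax_paste {X Y Z : K} {S : hom X X} {S' : hom Y Y} {S'' : hom Z Z}
  {F : hom X Y} {G : hom Y Z} (b : Hom (S'' ⊚ G) (G ⊚ S')) (a : Hom (S' ⊚ F) (F ⊚ S)) :
  Hom (S'' ⊚ (G ⊚ F)) ((G ⊚ F) ⊚ S) :=
  asc G F S ∘ G ◁ a ∘ asc' G S' F ∘ b ▷ F ∘ asc S'' G F.

Definition colax_comp (A B C : Endo K) (G : Colax B C) (F : Colax A B) : Colax A C :=
  {| cx_F := cx_F G ⊚ cx_F F; cx_a := colax_paste (cx_a G) (cx_a F) |}.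

Lemma colax_id_pk (A : Endo K) : pk (cx_a (colax_id A)) = pid (e_T A).
Proof. by rewrite /= pk_idto comp1_idr. Qed.

Lemma colax_paste_pk {X Y Z : K} {S : hom X X} {S' : hom Y Y} {S'' : hom Z Z}
  {F : hom X Y} {G : hom Y Z} (b : Hom (S'' ⊚ G) (G ⊚ S')) (a : Hom (S' ⊚ F) (F ⊚ S)) :
  pk (colax_paste b a) = vc (hc (pid G) (pk a)) (hc (pk b) (pid F)).
Proof. by rewrite /colax_paste /asc /asc'; packed; vid. Qed.

Lemma colax_comp_pk (A B C : Endo K) (G : Colax B C) (F : Colax A B) :
  pk (cx_a (colax_comp G F)) =
  vc (hc (pid (cx_F G)) (pk (cx_a F))) (hc (pk (cx_a G)) (pid (cx_F F))).
Proof. exact: colax_paste_pk. Qed.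

Definition colax_hcomp (A B C : Endo K) (G G' : Colax B C) (F F' : Colax A B)
  (b : ColaxCell G G') (a : ColaxCell F F') :
  ColaxCell (colax_comp G F) (colax_comp G' F').
Proof.
  unshelve refine (@Build_ColaxCell _ _ (colax_comp G F) (colax_comp G' F')
    (hcomp (cxc b) (cxc a)) _).
  have E : vc (pk (cx_a (colax_comp G' F'))) (hc (pid (e_T C)) (hc (pk (cxc b)) (pk (cxc a)))) =
           vc (hc (hc (pk (cxc b)) (pk (cxc a))) (pid (e_T A))) (pk (cx_a (colax_comp G F))).
    rewrite !colax_comp_pk.
    have Ea := f_equal (@pk _ _ _) (cxc_nat a).
    have Eb := f_equal (@pk _ _ _) (cxc_nat b).
    move: Ea Eb; rewrite !pk_comp !pk_hcomp -!/(pid _) => Ea Eb.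
    rewrite -vc_assoc; [bd|bd|].
    rewrite hc_assoc -hc_vc; [bd|bd|].
    rewrite Eb [vc _ (pk a)]vc_idl //.
    have -> : hc (vc (hc (pk b) (pid (e_T B))) (pk (cx_a G))) (pk a) =
              vc (hc (hc (pk b) (pid (e_T B))) (pk a)) (hc (pk (cx_a G)) (pid (cx_F F))).
      by rewrite -hc_vc //; congr hc; rewrite vc_idr.
    rewrite vc_assoc; [bd|bd|].
    rewrite [RHS]vc_assoc; [bd|bd|]; congr vc.
    rewrite -!hc_assoc -hc_vc; [bd|bd|].
    rewrite -hc_vc; [bd|bd|].
    by rewrite Ea vc_idl // vc_idr.
  apply: pk_inj; exact (eq_trans (pk_comp _ _) (eq_trans E (eq_sym (pk_comp _ _)))).
Defined.

Lemma colax_idl (A B : Endo K) (F : Colax A B) : colax_comp (colax_id B) F = F.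
Proof.
  apply: Colax_eq; first exact: comp1_idl.
  by rewrite colax_comp_pk colax_id_pk /= hc_id hc_idl; vid.
Qed.

Lemma colax_idr (A B : Endo K) (F : Colax A B) : colax_comp F (colax_id A) = F.
Proof.
  apply: Colax_eq; first exact: comp1_idr.
  by rewrite colax_comp_pk colax_id_pk /= hc_id hc_idr; vid.
Qed.

Lemma colax_assoc (A B C D : Endo K) (H : Colax C D) (G : Colax B C) (F : Colax A B) :
  colax_comp H (colax_comp G F) = colax_comp (colax_comp H G) F.
Proof.
  apply: Colax_eq; first exact: comp1_assoc.
  rewrite !colax_comp_pk /= -!hc_id hc_vcl; [bd|].
  rewrite hc_vcr; [bd|].
  by rewrite vc_assoc; [bd|bd|]; rewrite !hc_assoc.
Qed.

Definition ColaxTwo : TwoCat.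
Proof.
  unshelve refine {| obj2 := Endo K; hom := ColaxCat; id1 := colax_id;
    comp1 := colax_comp; hcomp := colax_hcomp |}.
  - by move=> *; apply: ColaxCell_eq; apply: hcomp_id.
  - by move=> *; apply: ColaxCell_eq; apply: hcomp_comp.
  - exact: colax_idl.
  - exact: colax_idr.
  - exact: colax_assoc.
  - move=> A B F F' a; apply: ColaxCell_pk_eq; try exact: hcomp_idl; exact: colax_idl.
  - move=> A B F F' a; apply: ColaxCell_pk_eq; try exact: hcomp_idr; exact: colax_idr.
  - move=> *; apply: ColaxCell_pk_eq; try exact: hcomp_assoc; exact: colax_assoc.
Defined.
End Colax.

(* P is the fibred product over B of copies of q : E -> B indexed by J; the
   morphism b : P -> B is part of the data, so that J may be empty. *)
Definition is_wide_pullback {C : Category} {B E : C} (q : Hom E B) {J : Type}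
  {P : C} (b : Hom P B) (pr : J -> Hom P E) : Prop :=
  (forall j, q ∘ pr j = b) /\
  forall (X : C) (c : Hom X B) (u : J -> Hom X E), (forall j, q ∘ u j = c) ->
    exists! m : Hom X P, b ∘ m = c /\ forall j, pr j ∘ m = u j.

Record Square (C : Category) := {
  s_P : C; s_A : C; s_B : C; s_C : C;
  s_top : Hom s_P s_A; s_left : Hom s_P s_B;
  s_right : Hom s_A s_C; s_bot : Hom s_B s_C }.

Definition is_pullback {C : Category} (S : Square C) : Prop :=
  s_right S ∘ s_top S = s_bot S ∘ s_left S /\
  forall (X : C) (u : Hom X (s_A S)) (v : Hom X (s_B S)),
    s_right S ∘ u = s_bot S ∘ v ->
    exists! m : Hom X (s_P S), s_top S ∘ m = u /\ s_left S ∘ m = v.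

Definition map_square {C D : Category} (F : Functor C D) (S : Square C) : Square D :=
  {| s_top := fmap F (s_top S); s_left := fmap F (s_left S);
     s_right := fmap F (s_right S); s_bot := fmap F (s_bot S) |}.

(* The data of an additive bundle, with its (candidate) n-fold pullbacks. *)
Record Bundle (C : Category) := {
  b_B : C;
  b_E : C;
  b_q : Hom b_E b_B;
  b_n : nat -> C;
  b_b : forall n, Hom (b_n n) b_B;
  b_pr : forall n, Fin.t n -> Hom (b_n n) b_E;
  b_z : Hom b_B b_E;
  b_s : Hom (b_n 2) b_E }.

Definition map_bundle {C D : Category} (F : Functor C D) (b : Bundle C) : Bundle D :=
  {| b_q := fmap F (b_q b); b_n := fun n => F (b_n b n);
     b_b := fun n => fmap F (b_b b n); b_pr := fun n j => fmap F (b_pr b j);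
     b_z := fmap F (b_z b); b_s := fmap F (b_s b) |}.

Definition fst2 : Fin.t 2 := Fin.F1.
Definition snd2 : Fin.t 2 := Fin.FS Fin.F1.
Definition fst3 : Fin.t 3 := Fin.F1.
Definition snd3 : Fin.t 3 := Fin.FS Fin.F1.
Definition thd3 : Fin.t 3 := Fin.FS (Fin.FS Fin.F1).

Definition nfold_pullbacks {C : Category} (b : Bundle C) : Prop :=
  forall n, is_wide_pullback (b_q b) (b_b b n) (@b_pr C b n).

(* w = s ∘ ⟨u,v⟩ *)
Definition is_sum {C : Category} (b : Bundle C) {X : C} (u v w : Hom X (b_E b)) : Prop :=
  exists m : Hom X (b_n b 2), b_pr b fst2 ∘ m = u /\ b_pr b snd2 ∘ m = v /\ b_s b ∘ m = w.
Arguments is_sum {C} b {X} u v w.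

Record is_additive_bundle {C : Category} (b : Bundle C) : Prop := {
  ab_pullbacks : nfold_pullbacks b;
  ab_z : b_q b ∘ b_z b = idm (b_B b);
  ab_s : b_q b ∘ b_s b = b_b b 2;
  ab_unit_l : is_sum b (b_z b ∘ b_q b) (idm (b_E b)) (idm (b_E b));
  ab_unit_r : is_sum b (idm (b_E b)) (b_z b ∘ b_q b) (idm (b_E b));
  ab_comm : is_sum b (b_pr b snd2) (b_pr b fst2) (b_s b);
  ab_assoc : exists u v w : Hom (b_n b 3) (b_E b),
    is_sum b (b_pr b fst3) (b_pr b snd3) u /\ is_sum b u (b_pr b thd3) w /\
    is_sum b (b_pr b snd3) (b_pr b thd3) v /\ is_sum b (b_pr b fst3) v w }.

(* Also used when the n-fold pullbacks of [b] do not exist. *)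
Record is_bundle_morphism {C : Category} (b b' : Bundle C)
  (f : Hom (b_B b) (b_B b')) (g : Hom (b_E b) (b_E b')) : Prop := {
  bm_q : b_q b' ∘ g = f ∘ b_q b;
  bm_z : g ∘ b_z b = b_z b' ∘ f;
  bm_s : is_sum b' (g ∘ b_pr b fst2) (g ∘ b_pr b snd2) (g ∘ b_s b) }.
Arguments is_bundle_morphism {C} b b' f g.

Section Tangent.
Context {K : TwoCat}.

Definition pointwise_nfold {X Y : K} (b : Bundle (hom X Y)) : Prop :=
  nfold_pullbacks b /\
  forall (X0 : K) (f : hom X0 X), nfold_pullbacks (map_bundle (pre f) b).

Definition pointwise_pullback {X Y : K} (S : Square (hom X Y)) : Prop :=
  is_pullback S /\
  forall (X0 : K) (f : hom X0 X), is_pullback (map_square (pre f) S).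

Fixpoint iter1 {X : K} (m : nat) (T : hom X X) : hom X X :=
  match m with 0 => id1 X | S m => T ⊚ iter1 m T end.

(* The n-fold pullbacks of p are chosen for every n, without any compatibility
   being required of morphisms. *)
Record TangentData := {
  t_ob : K;
  t_T : hom t_ob t_ob;
  t_n : nat -> hom t_ob t_ob;
  t_b : forall n, Hom (t_n n) (id1 t_ob);
  t_pr : forall n, Fin.t n -> Hom (t_n n) t_T;
  t_p : Hom t_T (id1 t_ob);
  t_z : Hom (id1 t_ob) t_T;
  t_s : Hom (t_n 2) t_T;
  t_l : Hom t_T (t_T ⊚ t_T);
  t_c : Hom (t_T ⊚ t_T) (t_T ⊚ t_T) }.

Definition t_bundle (t : TangentData) : Bundle (hom (t_ob t) (t_ob t)) :=
  {| b_q := t_p t; b_b := t_b t; b_pr := t_pr t; b_z := t_z t; b_s := t_s t |}.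

Definition t_endo (t : TangentData) : Endo K := {| e_ob := t_ob t; e_T := t_T t |}.

(* z_T : T => T², Tp : T² => T, l_T : T² => T³ and c_T : T³ => T³, where T³ is
   T ⊚ (T ⊚ T). *)
Definition t_zT (t : TangentData) : Hom (t_T t) (t_T t ⊚ t_T t) :=
  t_z t ▷ t_T t ∘ idto (eq_sym (comp1_idl (t_T t))).
Definition t_Tp (t : TangentData) : Hom (t_T t ⊚ t_T t) (t_T t) :=
  idto (comp1_idr (t_T t)) ∘ t_T t ◁ t_p t.
Definition t_lT (t : TangentData) :
  Hom (t_T t ⊚ t_T t) (t_T t ⊚ (t_T t ⊚ t_T t)) :=
  asc' (t_T t) (t_T t) (t_T t) ∘ t_l t ▷ t_T t.
Definition t_cT (t : TangentData) :
  Hom (t_T t ⊚ (t_T t ⊚ t_T t)) (t_T t ⊚ (t_T t ⊚ t_T t)) :=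
  asc' (t_T t) (t_T t) (t_T t) ∘ t_c t ▷ t_T t ∘ asc (t_T t) (t_T t) (t_T t).

(* phi = Ts ∘ ⟨l π1, z_T π2⟩ *)
Definition is_vlift (t : TangentData) (phi : Hom (t_n t 2) (t_T t ⊚ t_T t)) : Prop :=
  is_sum (map_bundle (post (t_T t)) (t_bundle t))
    (t_l t ∘ t_pr t fst2) (t_zT t ∘ t_pr t snd2) phi.
Arguments is_vlift t phi : clear implicits.

Definition vlift_square (t : TangentData) (phi : Hom (t_n t 2) (t_T t ⊚ t_T t)) :
  Square (hom (t_ob t) (t_ob t)) :=
  {| s_top := phi; s_left := t_p t ∘ t_pr t fst2; s_right := t_Tp t; s_bot := t_z t |}.
Arguments vlift_square t phi : clear implicits.

Record is_tangent (t : TangentData) : Prop := {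
  tg_pullbacks : pointwise_nfold (t_bundle t);
  tg_preserved : forall m,
    pointwise_nfold (map_bundle (post (iter1 m (t_T t))) (t_bundle t));
  tg_additive : is_additive_bundle (t_bundle t);
  tg_zl : is_bundle_morphism (t_bundle t) (map_bundle (post (t_T t)) (t_bundle t))
    (idto (eq_sym (comp1_idr (t_T t))) ∘ t_z t) (t_l t);
  tg_idc : is_bundle_morphism (map_bundle (post (t_T t)) (t_bundle t))
    (map_bundle (pre (t_T t)) (t_bundle t))
    (idto (comp1_idrl (t_T t))) (t_c t);
  tg_ll : t_T t ◁ t_l t ∘ t_l t = t_lT t ∘ t_l t;
  tg_cc : t_c t ∘ t_c t = idm (t_T t ⊚ t_T t);
  tg_ccc : t_T t ◁ t_c t ∘ t_cT t ∘ t_T t ◁ t_c t = t_cT t ∘ t_T t ◁ t_c t ∘ t_cT t;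
  tg_cl : t_c t ∘ t_l t = t_l t;
  tg_lc : t_T t ◁ t_l t ∘ t_c t = t_cT t ∘ t_T t ◁ t_c t ∘ t_lT t;
  tg_vlift : exists phi, is_vlift t phi /\ pointwise_pullback (vlift_square t phi) }.

Record TangentObject := { t_data :> TangentData; t_tangent : is_tangent t_data }.

(* T'α ∘ α_T : F T² => T'² F *)
Definition lax2 {t t' : TangentData} (A : Lax (t_endo t) (t_endo t')) :
  Hom (lx_F A ⊚ (t_T t ⊚ t_T t)) ((t_T t' ⊚ t_T t') ⊚ lx_F A) :=
  asc (t_T t') (t_T t') (lx_F A) ∘ t_T t' ◁ lx_a A
    ∘ asc' (t_T t') (lx_F A) (t_T t) ∘ lx_a A ▷ t_T t ∘ asc (lx_F A) (t_T t) (t_T t).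

Record is_lax (t t' : TangentData) (A : Lax (t_endo t) (t_endo t')) : Prop := {
  lax_additive : is_bundle_morphism (map_bundle (post (lx_F A)) (t_bundle t))
    (map_bundle (pre (lx_F A)) (t_bundle t'))
    (idto (comp1_idrl (lx_F A))) (lx_a A);
  lax_l : lax2 A ∘ lx_F A ◁ t_l t = t_l t' ▷ lx_F A ∘ lx_a A;
  lax_c : t_c t' ▷ lx_F A ∘ lax2 A = lax2 A ∘ lx_F A ◁ t_c t }.

(* β_T ∘ T'β : T'² G => G T² *)
Definition colax2 {t t' : TangentData} (A : Colax (t_endo t) (t_endo t')) :
  Hom ((t_T t' ⊚ t_T t') ⊚ cx_F A) (cx_F A ⊚ (t_T t ⊚ t_T t)) :=
  asc' (cx_F A) (t_T t) (t_T t) ∘ cx_a A ▷ t_T t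
    ∘ asc (t_T t') (cx_F A) (t_T t) ∘ t_T t' ◁ cx_a A
    ∘ asc' (t_T t') (t_T t') (cx_F A).

(* The preserved limits are again required to be pointwise. *)
Record is_colax (t t' : TangentData) (A : Colax (t_endo t) (t_endo t')) : Prop := {
  colax_additive : is_bundle_morphism (map_bundle (pre (cx_F A)) (t_bundle t'))
    (map_bundle (post (cx_F A)) (t_bundle t))
    (idto (eq_sym (comp1_idrl (cx_F A)))) (cx_a A);
  colax_l : cx_F A ◁ t_l t ∘ cx_a A = colax2 A ∘ t_l t' ▷ cx_F A;
  colax_c : colax2 A ∘ t_c t' ▷ cx_F A = cx_F A ◁ t_c t ∘ colax2 A;
  colax_nfold : pointwise_nfold (map_bundle (post (cx_F A)) (t_bundle t));
  colax_vlift : forall phi, is_vlift t phi ->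
    pointwise_pullback (map_square (post (cx_F A)) (vlift_square t phi)) }.

Definition is_strong (t t' : TangentData) (A : Colax (t_endo t) (t_endo t')) : Prop :=
  is_colax A /\ is_iso (cx_a A).

Definition is_strict (t t' : TangentData) (A : Colax (t_endo t) (t_endo t')) : Prop :=
  is_colax A /\ cx_a A ≡ idm (t_T t' ⊚ cx_F A).

End Tangent.
Arguments TangentData K : clear implicits.
Arguments TangentObject K : clear implicits.
Arguments is_vlift {K} t phi.
Arguments vlift_square {K} t phi.

Section Closure.
Context {K : TwoCat}.

Lemma eq_pk {C : Category} {x y : C} {f g : Hom x y} : f = g -> f ≡ g.
Proof. by move=> ->. Qed.

Lemma lax_paste_nat {X Y Z : K} {S S1 : hom X X} {S' S1' : hom Y Y} {S'' S1'' : hom Z Z}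
  {F : hom X Y} {G : hom Y Z}
  (b : Hom (G ⊚ S') (S'' ⊚ G)) (a : Hom (F ⊚ S) (S' ⊚ F))
  (b1 : Hom (G ⊚ S1') (S1'' ⊚ G)) (a1 : Hom (F ⊚ S1) (S1' ⊚ F))
  (x : Hom S S1) (x' : Hom S' S1') (x'' : Hom S'' S1'') :
  x' ▷ F ∘ a = a1 ∘ F ◁ x -> x'' ▷ G ∘ b = b1 ∘ G ◁ x' ->
  x'' ▷ (G ⊚ F) ∘ lax_paste b a = lax_paste b1 a1 ∘ (G ⊚ F) ◁ x.
Proof.
  move=> /eq_pk; rewrite !pk_comp !pk_hcomp => ea /eq_pk; rewrite !pk_comp !pk_hcomp => eb.
  apply: pk_inj; rewrite pk_comp [RHS]pk_comp !pk_hcomp !lax_paste_pk -!/(pid _) -!hc_id.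
  rewrite -!/(pid _) in ea eb.
  rewrite vc_assoc; [bd|bd|]; rewrite hc_assoc -hc_vcl; [bd|].
  rewrite eb hc_vcl; [bd|].
  rewrite -vc_assoc; [bd|bd|]; rewrite -[RHS]vc_assoc; [bd|bd|]; congr vc.
  rewrite -!hc_assoc -!hc_vcr; [bd|bd|].
  by rewrite ea.
Qed.

Lemma lax2_pk {t t' : TangentData K} (A : Lax (t_endo t) (t_endo t')) :
  pk (lax2 A) = vc (hc (pid (t_T t')) (pk (lx_a A))) (hc (pk (lx_a A)) (pid (t_T t))).
Proof. by rewrite /lax2 /asc /asc'; packed; vid. Qed.

Lemma lax2_comp {t t' t'' : TangentData K} (B : Lax (t_endo t') (t_endo t''))
  (A : Lax (t_endo t) (t_endo t')) :
  lax2 (t := t) (t' := t'') (lax_comp B A) = lax_paste (lax2 B) (lax2 A).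
Proof.
  apply: pk_inj; rewrite lax_paste_pk !lax2_pk lax_comp_pk.
  rewrite hc_vcr; [bd|]; rewrite hc_vcl; [bd|].
  rewrite [in RHS]hc_vcr; [bd|]; rewrite [in RHS]hc_vcl; [bd|].
  rewrite -!vc_assoc; try bd.
  congr vc; first by rewrite hc_assoc.
  rewrite !vc_assoc; try bd.
  congr vc; last by rewrite hc_assoc.
  rewrite hc_assoc -[hc (hc _ _) (pid (t_T t))]hc_assoc !hc_id.
  rewrite -[hc (hc _ _) (pid (lx_F A))]hc_assoc [hc (pid (lx_F B)) _]hc_assoc !hc_id.
  exact: (eq_trans (hc_rl (pk (lx_a B)) (pk (lx_a A)))
    (eq_sym (hc_lr (pk (lx_a B)) (pk (lx_a A))))).
Qed.

Lemma lax_paste_idto {X Y Z : K} {S : hom X X} {S' : hom Y Y} {S'' : hom Z Z}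
  {F : hom X Y} {G : hom Y Z} (eb : G ⊚ S' = S'' ⊚ G) (ea : F ⊚ S = S' ⊚ F)
  (e : (G ⊚ F) ⊚ S = S'' ⊚ (G ⊚ F)) : lax_paste (idto eb) (idto ea) = idto e.
Proof.
  apply: pk_inj; rewrite lax_paste_pk !pk_idto !hc_id.
  rewrite vc_idl //=; first by rewrite -comp1_assoc ea.
  by rewrite comp1_assoc.
Qed.

Lemma id_nat {X : K} {S S1 : hom X X} (x : Hom S S1)
  (e : id1 X ⊚ S = S ⊚ id1 X) (e1 : id1 X ⊚ S1 = S1 ⊚ id1 X) :
  x ▷ id1 X ∘ idto e = idto e1 ∘ id1 X ◁ x.
Proof.
  apply: pk_inj; rewrite !pk_comp !pk_hcomp !pk_idto -!/(pid _) hc_idl hc_idr.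
  by rewrite vc_idl ?vc_idr //= ?comp1_idl.
Qed.

Lemma lax2_id (t : TangentData K)
  (e : id1 (t_ob t) ⊚ (t_T t ⊚ t_T t) = (t_T t ⊚ t_T t) ⊚ id1 (t_ob t)) :
  lax2 (t := t) (t' := t) (lax_id (t_endo t)) = idto e.
Proof.
  apply: pk_inj; rewrite lax2_pk lax_id_pk pk_idto /= hc_id comp1_idl.
  by rewrite vc_idl.
Qed.

Lemma is_lax_id (t : TangentData K) : is_lax (t := t) (t' := t) (lax_id (t_endo t)).
Proof.
  have e (S : hom (t_ob t) (t_ob t)) : id1 (t_ob t) ⊚ S = S ⊚ id1 (t_ob t).
    by rewrite comp1_idl comp1_idr.
  split.
  - split => /=; [exact: id_nat | exact: eq_sym (id_nat _ _ _) |].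
    by exists (idto (e (t_n t 2))) => /=; split; [|split]; apply: id_nat.
  - by rewrite (lax2_id (e _)) /=; exact: eq_sym (id_nat _ _ _).
  - by rewrite (lax2_id (e _)) /=; exact: id_nat.
Qed.

Lemma is_lax_comp (t t' t'' : TangentData K) (B : Lax (t_endo t') (t_endo t''))
  (A : Lax (t_endo t) (t_endo t')) :
  is_lax B -> is_lax A -> is_lax (t := t) (t' := t'') (lax_comp B A).
Proof.
  move=> [[/= Bq Bz [/= mB [Bs1 [Bs2 Bs]]]] Bl Bc] [[/= Aq Az [/= mA [As1 [As2 As]]]] Al Ac].
  split.
  - split => /=.
    + by rewrite (lax_paste_nat Aq Bq) (lax_paste_idto _ _ (comp1_idrl _)).
    + rewrite -(lax_paste_nat (eq_sym Az) (eq_sym Bz)) (lax_paste_idto _ _ (comp1_idrl _)); reflexivity.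
    + by exists (lax_paste mB mA) => /=; split; [|split];
        [exact: (lax_paste_nat As1 Bs1) | exact: (lax_paste_nat As2 Bs2) | exact: (lax_paste_nat As Bs)].
  - by rewrite lax2_comp; exact: eq_sym (lax_paste_nat (eq_sym Al) (eq_sym Bl)).
  - by rewrite lax2_comp; exact: (lax_paste_nat Ac Bc).
Qed.

Lemma colax_paste_nat {X Y Z : K} {S S1 : hom X X} {S' S1' : hom Y Y} {S'' S1'' : hom Z Z}
  {F : hom X Y} {G : hom Y Z}
  (b : Hom (S'' ⊚ G) (G ⊚ S')) (a : Hom (S' ⊚ F) (F ⊚ S))
  (b1 : Hom (S1'' ⊚ G) (G ⊚ S1')) (a1 : Hom (S1' ⊚ F) (F ⊚ S1))
  (x : Hom S S1) (x' : Hom S' S1') (x'' : Hom S'' S1'') :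
  F ◁ x ∘ a = a1 ∘ x' ▷ F -> G ◁ x' ∘ b = b1 ∘ x'' ▷ G ->
  (G ⊚ F) ◁ x ∘ colax_paste b a = colax_paste b1 a1 ∘ x'' ▷ (G ⊚ F).
Proof.
  move=> /eq_pk; rewrite !pk_comp !pk_hcomp => ea /eq_pk; rewrite !pk_comp !pk_hcomp => eb.
  apply: pk_inj; rewrite pk_comp [RHS]pk_comp !pk_hcomp !colax_paste_pk -!/(pid _) -!hc_id.
  rewrite -!/(pid _) in ea eb.
  rewrite vc_assoc; [bd|bd|]; rewrite -hc_assoc -hc_vcr; [bd|].
  rewrite ea hc_vcr; [bd|].
  rewrite -vc_assoc; [bd|bd|]; rewrite -[RHS]vc_assoc; [bd|bd|]; congr vc.
  rewrite !hc_assoc -!hc_vcl; [bd|bd|].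
  by rewrite eb.
Qed.

Lemma colax2_pk {t t' : TangentData K} (A : Colax (t_endo t) (t_endo t')) :
  pk (colax2 A) = vc (hc (pk (cx_a A)) (pid (t_T t))) (hc (pid (t_T t')) (pk (cx_a A))).
Proof. by rewrite /colax2 /asc /asc'; packed; vid. Qed.

Lemma colax2_comp {t t' t'' : TangentData K} (B : Colax (t_endo t') (t_endo t''))
  (A : Colax (t_endo t) (t_endo t')) :
  colax2 (t := t) (t' := t'') (colax_comp B A) = colax_paste (colax2 B) (colax2 A).
Proof.
  apply: pk_inj; rewrite colax_paste_pk !colax2_pk colax_comp_pk.
  rewrite hc_vcl; [bd|]; rewrite hc_vcr; [bd|].
  rewrite [in RHS]hc_vcr; [bd|]; rewrite [in RHS]hc_vcl; [bd|].
  rewrite -!vc_assoc; try bd.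
  congr vc; first by rewrite hc_assoc.
  rewrite !vc_assoc; try bd.
  congr vc; last by rewrite hc_assoc.
  rewrite -[hc (hc _ _) (pid (t_T t))]hc_assoc [hc (pid (t_T t'')) _]hc_assoc !hc_id.
  rewrite [hc (pid (cx_F B)) _]hc_assoc -[hc (hc _ _) (pid (cx_F A))]hc_assoc !hc_id.
  exact: (eq_trans (hc_lr (pk (cx_a B)) (pk (cx_a A)))
    (eq_sym (hc_rl (pk (cx_a B)) (pk (cx_a A))))).
Qed.

Lemma colax_paste_idto {X Y Z : K} {S : hom X X} {S' : hom Y Y} {S'' : hom Z Z}
  {F : hom X Y} {G : hom Y Z} (eb : S'' ⊚ G = G ⊚ S') (ea : S' ⊚ F = F ⊚ S)
  (e : S'' ⊚ (G ⊚ F) = (G ⊚ F) ⊚ S) : colax_paste (idto eb) (idto ea) = idto e.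
Proof.
  apply: pk_inj; rewrite colax_paste_pk !pk_idto !hc_id.
  rewrite vc_idl //=; first by rewrite eb comp1_assoc.
  by rewrite comp1_assoc.
Qed.

Lemma id_conat {X : K} {S S1 : hom X X} (x : Hom S S1)
  (e : S ⊚ id1 X = id1 X ⊚ S) (e1 : S1 ⊚ id1 X = id1 X ⊚ S1) :
  id1 X ◁ x ∘ idto e = idto e1 ∘ x ▷ id1 X.
Proof.
  apply: pk_inj; rewrite !pk_comp !pk_hcomp !pk_idto -!/(pid _) hc_idl hc_idr.
  by rewrite vc_idl ?vc_idr //= ?comp1_idr.
Qed.

Lemma colax2_id (t : TangentData K)
  (e : (t_T t ⊚ t_T t) ⊚ id1 (t_ob t) = id1 (t_ob t) ⊚ (t_T t ⊚ t_T t)) :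
  colax2 (t := t) (t' := t) (colax_id (t_endo t)) = idto e.
Proof.
  apply: pk_inj; rewrite colax2_pk colax_id_pk pk_idto /= hc_id comp1_idr.
  by rewrite vc_idl.
Qed.
End Closure.

Section Isos.
Context {C : Category}.

Lemma idto_iso {x y : C} (e : x = y) : is_iso (idto e).
Proof. by destruct e; exists (idm x); rewrite /= comp_idl. Qed.

Lemma iso_comp {x y z : C} (g : Hom y z) (f : Hom x y) :
  is_iso g -> is_iso f -> is_iso (g ∘ f).
Proof.
  move=> [g' [h1 h2]] [f' [h3 h4]]; exists (f' ∘ g'); split.
  - by rewrite -comp_assoc (comp_assoc g') h1 comp_idl.
  - by rewrite -comp_assoc (comp_assoc f) h4 comp_idl.
Qed.

Lemma iso_mono {x y z : C} (g : Hom y z) (f f' : Hom x y) :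
  is_iso g -> g ∘ f = g ∘ f' -> f = f'.
Proof.
  move=> [g' [h1 h2]] e.
  by rewrite -(comp_idl f) -(comp_idl f') -h1 -!comp_assoc e.
Qed.

Lemma iso_epi {x y z : C} (g g' : Hom y z) (f : Hom x y) :
  is_iso f -> g ∘ f = g' ∘ f -> g = g'.
Proof.
  move=> [f' [h1 h2]] e.
  by rewrite -(comp_idr g) -(comp_idr g') -h2 !comp_assoc e.
Qed.

Lemma iso_pk {x y x' y' : C} (f : Hom x y) (f' : Hom x' y') :
  f ≡ f' -> is_iso f -> is_iso f'.
Proof.
  move=> e; have ex := f_equal (@src _) e; have ey := f_equal (@tgt _) e.
  by move: ex ey => /= ex ey; subst; rewrite (pk_inj e).
Qed.

Lemma wide_pullback_iso {J : Type} {B E P B' E' P' : C}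
  (q : Hom E B) (b : Hom P B) (pr : J -> Hom P E)
  (q' : Hom E' B') (b' : Hom P' B') (pr' : J -> Hom P' E')
  (iB : Hom B B') (iE : Hom E E') (iP : Hom P P') :
  is_iso iB -> is_iso iE -> is_iso iP ->
  q' ∘ iE = iB ∘ q -> b' ∘ iP = iB ∘ b -> (forall j, pr' j ∘ iP = iE ∘ pr j) ->
  is_wide_pullback q b pr -> is_wide_pullback q' b' pr'.
Proof.
  move=> hB hE hP eq eb ep [h1 h2]; split.
  - move=> j; apply: (iso_epi hP).
    by rewrite -comp_assoc ep comp_assoc eq -comp_assoc h1 eb.
  - move=> X c u hu.
    have [jB [jB1 jB2]] := hB; have [jE [jE1 jE2]] := hE; have [jP [jP1 jP2]] := hP.
    case: (h2 X (jB ∘ c) (fun j => jE ∘ u j)) => [j|m [[m1 m2] mu]].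
      apply: (iso_mono hB); rewrite !comp_assoc -eq jB2 comp_idl.
      by rewrite -[q' ∘ iE ∘ jE]comp_assoc jE2 comp_idr hu.
    exists (iP ∘ m); split; [split|].
    + by rewrite comp_assoc eb -comp_assoc m1 comp_assoc jB2 comp_idl.
    + by move=> j; rewrite comp_assoc ep -comp_assoc m2 comp_assoc jE2 comp_idl.
    + move=> m' [m1' m2'].
      have -> : m = jP ∘ m'; last by rewrite comp_assoc jP2 comp_idl.
        apply: mu; split.
        * apply: (iso_mono hB).
          by rewrite !comp_assoc -eb -[_ ∘ iP ∘ jP]comp_assoc jP2 comp_idr jB2 comp_idl.
        * move=> j; apply: (iso_mono hE).
          by rewrite !comp_assoc -ep -[_ ∘ iP ∘ jP]comp_assoc jP2 comp_idr jE2 comp_idl.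
Qed.

Lemma wide_pullback_unique {J : Type} {B E P B' E' P' : C}
  (q : Hom E B) (b : Hom P B) (pr : J -> Hom P E)
  (q' : Hom E' B') (b' : Hom P' B') (pr' : J -> Hom P' E')
  (iB : Hom B B') (iE : Hom E E') : is_iso iB -> is_iso iE -> q' ∘ iE = iB ∘ q ->
  is_wide_pullback q b pr -> is_wide_pullback q' b' pr' ->
  exists iP : Hom P P', is_iso iP /\ b' ∘ iP = iB ∘ b /\ forall j, pr' j ∘ iP = iE ∘ pr j.
Proof.
  move=> hB hE eq [h1 h2] [h1' h2'].
  case: (h2' P (iB ∘ b) (fun j => iE ∘ pr j)) => [j|i [[i1 i2] iu]].
    by rewrite comp_assoc eq -comp_assoc h1.
  exists i; split; last by split.
  have [jB [jB1 jB2]] := hB; have [jE [jE1 jE2]] := hE.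
  case: (h2 P' (jB ∘ b') (fun j => jE ∘ pr' j)) => [j|k [[k1 k2] ku]].
    apply: (iso_mono hB); rewrite !comp_assoc -eq jB2 comp_idl.
    by rewrite -[q' ∘ iE ∘ jE]comp_assoc jE2 comp_idr h1'.
  exists k; split.
  - case: (h2 P b pr h1) => w [_ wu].
    have <- : w = k ∘ i; last by apply: wu; split=> [|j]; rewrite comp_idr.
      apply: wu; split=> [|j]; rewrite comp_assoc.
      * by rewrite k1 -comp_assoc i1 comp_assoc jB1 comp_idl.
      * by rewrite k2 -comp_assoc i2 comp_assoc jE1 comp_idl.
  - case: (h2' P' b' pr' h1') => w [_ wu].
    have <- : w = i ∘ k; last by apply: wu; split=> [|j]; rewrite comp_idr.
      apply: wu; split=> [|j]; rewrite comp_assoc.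
      * by rewrite i1 -comp_assoc k1 comp_assoc jB2 comp_idl.
      * by rewrite i2 -comp_assoc k2 comp_assoc jE2 comp_idl.
Qed.

Lemma wide_pullback_joint {J : Type} {B E P X : C} (q : Hom E B) (b : Hom P B)
  (pr : J -> Hom P E) (j0 : J) (f g : Hom X P) :
  is_wide_pullback q b pr -> (forall j, pr j ∘ f = pr j ∘ g) -> f = g.
Proof.
  move=> [h1 h2] e.
  case: (h2 X (b ∘ g) (fun j => pr j ∘ g)) => [j|m [_ mu]].
    by rewrite comp_assoc h1.
  have <- : m = f by apply: mu; split=> //; rewrite -(h1 j0) -!comp_assoc e.
  by apply: mu.
Qed.

Lemma pullback_iso (S S' : Square C) (iP : Hom (s_P S) (s_P S')) (iA : Hom (s_A S) (s_A S'))
  (iB : Hom (s_B S) (s_B S')) (iC : Hom (s_C S) (s_C S')) :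
  is_iso iP -> is_iso iA -> is_iso iB -> is_iso iC ->
  s_top S' ∘ iP = iA ∘ s_top S -> s_left S' ∘ iP = iB ∘ s_left S ->
  s_right S' ∘ iA = iC ∘ s_right S -> s_bot S' ∘ iB = iC ∘ s_bot S ->
  is_pullback S -> is_pullback S'.
Proof.
  move=> hP hA hB hC et el er eb [h1 h2]; split.
  - apply: (iso_epi hP).
    by rewrite -!comp_assoc et el !comp_assoc er eb -!comp_assoc h1.
  - move=> X u v e.
    have [jP [jP1 jP2]] := hP; have [jA [jA1 jA2]] := hA; have [jB [jB1 jB2]] := hB.
    case: (h2 X (jA ∘ u) (jB ∘ v)) => [|m [[m1 m2] mu]].
      apply: (iso_mono hC); rewrite !comp_assoc -er -eb.
      by rewrite -[_ ∘ iA ∘ _]comp_assoc -[_ ∘ iB ∘ _]comp_assoc jA2 jB2 !comp_idr.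
    exists (iP ∘ m); split; [split|].
    + by rewrite comp_assoc et -comp_assoc m1 comp_assoc jA2 comp_idl.
    + by rewrite comp_assoc el -comp_assoc m2 comp_assoc jB2 comp_idl.
    + move=> m' [m1' m2'].
      have -> : m = jP ∘ m'; last by rewrite comp_assoc jP2 comp_idl.
        apply: mu; split.
        * apply: (iso_mono hA).
          by rewrite !comp_assoc -et -[_ ∘ iP ∘ jP]comp_assoc jP2 comp_idr jA2 comp_idl.
        * apply: (iso_mono hB).
          by rewrite !comp_assoc -el -[_ ∘ iP ∘ jP]comp_assoc jP2 comp_idr jB2 comp_idl.
Qed.
End Isos.

Section Strong.
Context {K : TwoCat}.

Lemma iso_post {X Y Z : K} (G : hom Y Z) (f f' : hom X Y) (a : Hom f f') :
  is_iso a -> is_iso (G ◁ a).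
Proof.
  move=> [b [h1 h2]]; exists (G ◁ b); rewrite -!hcomp_comp !comp_idl h1 h2.
  by rewrite !hcomp_id.
Qed.

Lemma iso_pre {X Y Z : K} (F : hom X Y) (g g' : hom Y Z) (a : Hom g g') :
  is_iso a -> is_iso (a ▷ F).
Proof.
  move=> [b [h1 h2]]; exists (b ▷ F); rewrite -!hcomp_comp !comp_idl h1 h2.
  by rewrite !hcomp_id.
Qed.

Definition cxnat {X Y : K} {G : hom X Y} {S S1 : hom X X} {S' S1' : hom Y Y}
  (x : Hom S S1) (x' : Hom S' S1') (k : Hom (S' ⊚ G) (G ⊚ S))
  (k1 : Hom (S1' ⊚ G) (G ⊚ S1)) : Prop := G ◁ x ∘ k = k1 ∘ x' ▷ G.

Definition colax_vpaste {X Y : K} {G : hom X Y} {S R : hom X X} {S' R' : hom Y Y}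
  (b : Hom (S' ⊚ G) (G ⊚ S)) (k : Hom (R' ⊚ G) (G ⊚ R)) :
  Hom ((S' ⊚ R') ⊚ G) (G ⊚ (S ⊚ R)) :=
  asc' G S R ∘ b ▷ R ∘ asc S' G R ∘ S' ◁ k ∘ asc' S' R' G.

Section Fixed.
Context {X Y : K} {G : hom X Y}.

Lemma cxnat_comp {S S1 S2 : hom X X} {S' S1' S2' : hom Y Y}
  {x : Hom S S1} {x' : Hom S' S1'} {y : Hom S1 S2} {y' : Hom S1' S2'}
  {k : Hom (S' ⊚ G) (G ⊚ S)} {k1 : Hom (S1' ⊚ G) (G ⊚ S1)}
  {k2 : Hom (S2' ⊚ G) (G ⊚ S2)} :
  cxnat y y' k1 k2 -> cxnat x x' k k1 -> cxnat (y ∘ x) (y' ∘ x') k k2.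
Proof.
  rewrite /cxnat => hy hx.
  rewrite (fmap_comp (post G) y x : G ◁ (y ∘ x) = _).
  rewrite (fmap_comp (pre G) y' x' : (y' ∘ x') ▷ G = _).
  by rewrite /= -comp_assoc hx !comp_assoc hy.
Qed.

Lemma cxnat_idto {S S1 : hom X X} {S' S1' : hom Y Y} (e : S = S1) (e' : S' = S1')
  (k : Hom (S' ⊚ G) (G ⊚ S)) (k1 : Hom (S1' ⊚ G) (G ⊚ S1)) :
  k ≡ k1 -> cxnat (idto e) (idto e') k k1.
Proof.
  destruct e, e' => /= /pk_inj ->.
  by rewrite /cxnat !hcomp_id comp_idl comp_idr.
Qed.

Lemma colax_vpaste_pk {S R : hom X X} {S' R' : hom Y Y}
  (b : Hom (S' ⊚ G) (G ⊚ S)) (k : Hom (R' ⊚ G) (G ⊚ R)) :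
  pk (colax_vpaste b k) = vc (hc (pk b) (pid R)) (hc (pid S') (pk k)).
Proof. by rewrite /colax_vpaste /asc /asc'; packed; vid. Qed.

Lemma colax_vpaste_iso {S R : hom X X} {S' R' : hom Y Y}
  (b : Hom (S' ⊚ G) (G ⊚ S)) (k : Hom (R' ⊚ G) (G ⊚ R)) :
  is_iso b -> is_iso k -> is_iso (colax_vpaste b k).
Proof.
  move=> hb hk; rewrite /colax_vpaste /asc /asc'.
  by repeat apply: iso_comp; try exact: idto_iso; [apply: iso_pre|apply: iso_post].
Qed.

Lemma cxnat_hcomp {S S1 R R1 : hom X X} {S' S1' R' R1' : hom Y Y}
  {x : Hom S S1} {x' : Hom S' S1'} {y : Hom R R1} {y' : Hom R' R1'}
  {b : Hom (S' ⊚ G) (G ⊚ S)} {b1 : Hom (S1' ⊚ G) (G ⊚ S1)}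
  {k : Hom (R' ⊚ G) (G ⊚ R)} {k1 : Hom (R1' ⊚ G) (G ⊚ R1)} :
  cxnat x x' b b1 -> cxnat y y' k k1 ->
  cxnat (hcomp x y) (hcomp x' y') (colax_vpaste b k) (colax_vpaste b1 k1).
Proof.
  rewrite /cxnat => /eq_pk; rewrite !pk_comp !pk_hcomp => ex /eq_pk.
  rewrite !pk_comp !pk_hcomp => ey.
  apply: pk_inj; rewrite pk_comp [RHS]pk_comp !pk_hcomp !colax_vpaste_pk.
  rewrite -!/(pid _) in ex ey *.
  rewrite vc_assoc; [bd|bd|]; rewrite hc_assoc -hc_vc; [bd|bd|].
  rewrite ex [vc (pk y) _]vc_idr //.
  rewrite -[RHS]vc_assoc; [bd|bd|]; rewrite -hc_assoc -hc_vc; [bd|bd|].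
  rewrite -ey [vc _ (pk x')]vc_idl //.
  have -> : hc (vc (pk b1) (hc (pk x') (pid G))) (pk y) =
            vc (hc (pk b1) (pid R1)) (hc (pk x') (hc (pid G) (pk y))).
    by rewrite (hc_assoc (pk x') (pid G) (pk y)) -hc_vc //=; congr hc; rewrite vc_idl.
  rewrite -vc_assoc; [bd|bd|]; congr vc.
  rewrite -hc_vc; [bd|bd|].
  by rewrite [vc (pk x') _]vc_idr.
Qed.

Definition cxw {X0 : K} (f : hom X0 X) {S : hom X X} {S' : hom Y Y}
  (k : Hom (S' ⊚ G) (G ⊚ S)) : Hom (S' ⊚ (G ⊚ f)) ((G ⊚ S) ⊚ f) :=
  k ▷ f ∘ asc S' G f.

Lemma cxw_iso {X0 : K} (f : hom X0 X) {S : hom X X} {S' : hom Y Y}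
  (k : Hom (S' ⊚ G) (G ⊚ S)) : is_iso k -> is_iso (cxw f k).
Proof. by move=> hk; apply: iso_comp; [apply: iso_pre|apply: idto_iso]. Qed.

Lemma cxw_nat {X0 : K} (f : hom X0 X) {S S1 : hom X X} {S' S1' : hom Y Y}
  (x : Hom S S1) (x' : Hom S' S1') (k : Hom (S' ⊚ G) (G ⊚ S))
  (k1 : Hom (S1' ⊚ G) (G ⊚ S1)) : cxnat x x' k k1 ->
  (G ◁ x) ▷ f ∘ cxw f k = cxw f k1 ∘ x' ▷ (G ⊚ f).
Proof.
  rewrite /cxnat => /eq_pk; rewrite !pk_comp !pk_hcomp -!/(pid _) => e.
  have P0 (R : hom X X) (R' : hom Y Y) (h : Hom (R' ⊚ G) (G ⊚ R)) :
      pk (cxw f h) = hc (pk h) (pid f).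
    by rewrite /cxw /asc; packed; vid.
  apply: pk_inj; rewrite pk_comp [RHS]pk_comp !pk_hcomp !P0 -!/(pid _) -hc_id hc_assoc.
  by rewrite -!hc_vcl ?e //; bd.
Qed.
End Fixed.
End Strong.

Lemma fin2 (j : Fin.t 2) : j = fst2 \/ j = snd2.
Proof.
  pattern j; apply: Fin.caseS'; first by left.
  move=> i; right; congr FS; pattern i; apply: Fin.caseS' => // i'.
  exact: (Fin.case0 (fun _ => _)).
Qed.

Section StrongColax.
Context {K : TwoCat}.

Definition idx {X Y : K} (G : hom X Y) : Hom (id1 Y ⊚ G) (G ⊚ id1 X) :=
  idto (eq_sym (comp1_idrl G)).

Section OneMorphism.
Context {t t' : TangentData K} (A : Colax (t_endo t) (t_endo t')).

Definition nfold_cells : Prop := forall n,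
  exists k : Hom (t_n t' n ⊚ cx_F A) (cx_F A ⊚ t_n t n),
    is_iso k /\ cxnat (t_b t n) (t_b t' n) k (idx (cx_F A)) /\
    forall j, cxnat (t_pr t j) (t_pr t' j) k (cx_a A).

Hypothesis hiso : is_iso (cx_a A).
Hypothesis hp : cxnat (t_p t) (t_p t') (cx_a A) (idx (cx_F A)).
Hypothesis ht' : is_tangent t'.

Lemma nfold_cells_of : nfold_pullbacks (map_bundle (post (cx_F A)) (t_bundle t)) ->
  nfold_cells.
Proof.
  move=> h n.
  have h' := proj2 (tg_pullbacks ht') _ (cx_F A) n.
  case: (wide_pullback_unique (idto_iso (eq_sym (comp1_idrl (cx_F A)))) hiso hp h' (h n)).
  by move=> k [h1 [h2 h3]]; exists k.
Qed.

Lemma nfold_of_cells : nfold_cells ->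
  pointwise_nfold (map_bundle (post (cx_F A)) (t_bundle t)).
Proof.
  move=> hk; split=> [n | X0 f n]; have [k [h1 [h2 h3]]] := hk n.
  - exact: (wide_pullback_iso (idto_iso (eq_sym (comp1_idrl (cx_F A)))) hiso h1 hp h2 h3
              (proj2 (tg_pullbacks ht') _ (cx_F A) n)).
  - apply: (wide_pullback_iso (cxw_iso f (idto_iso (eq_sym (comp1_idrl (cx_F A)))))
              (cxw_iso f hiso) (cxw_iso f h1) _ _ _
              (proj2 (tg_pullbacks ht') _ (cx_F A ⊚ f) n)).
    + exact: cxw_nat.
    + exact: cxw_nat.
    + move=> j. exact: (cxw_nat f (h3 j)).
Qed.

Lemma colax2_vpaste : colax2 A = colax_vpaste (cx_a A) (cx_a A).
Proof. by []. Qed.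

Hypothesis hz : cxnat (t_z t) (t_z t') (idx (cx_F A)) (cx_a A).
Hypothesis hl : cxnat (t_l t) (t_l t') (cx_a A) (colax2 A).
Hypothesis hs : exists k : Hom (t_n t' 2 ⊚ cx_F A) (cx_F A ⊚ t_n t 2),
  (forall j, cxnat (t_pr t j) (t_pr t' j) k (cx_a A)) /\ cxnat (t_s t) (t_s t') k (cx_a A).

Lemma hid : cxnat (idm (t_T t)) (idm (t_T t')) (cx_a A) (cx_a A).
Proof. by rewrite /cxnat !hcomp_id comp_idl comp_idr. Qed.

Lemma hzT : cxnat (t_zT t) (t_zT t') (cx_a A) (colax2 A).
Proof.
  rewrite colax2_vpaste; apply: (cxnat_comp (cxnat_hcomp hz hid)).
  apply: cxnat_idto; rewrite colax_vpaste_pk /idx pk_idto hc_id hc_idl -comp1_assoc.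
  by vid.
Qed.

Lemma hTp : cxnat (t_Tp t) (t_Tp t') (colax2 A) (cx_a A).
Proof.
  rewrite colax2_vpaste; apply: (cxnat_comp _ (cxnat_hcomp hid hp)).
  apply: cxnat_idto; rewrite colax_vpaste_pk /idx pk_idto hc_id hc_idr.
  by rewrite vc_idr //= comp1_assoc comp1_idr.
Qed.

Lemma vlift_of_cells : nfold_cells -> forall phi, is_vlift t phi ->
  pointwise_pullback (map_square (post (cx_F A)) (vlift_square t phi)).
Proof.
  move=> hk phi [m [/= m1 [m2 ms]]].
  have [phi' [[m' [/= m1' [m2' ms']]] hpb]] := tg_vlift ht'.
  have [k [k1 [k2 k3]]] := hk 2.
  have hsk : cxnat (t_s t) (t_s t') k (cx_a A).
    have [k' [k1' k2']] := hs.
    suff -> : k = k' by [].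
    apply: (wide_pullback_joint fst2 (proj1 (nfold_of_cells hk) 2)) => j /=.
    by rewrite (k3 j) (k1' j).
  have hm : cxnat m m' k (colax_vpaste (cx_a A) k).
    have hV : is_iso (colax_vpaste (cx_a A) k) by apply: colax_vpaste_iso.
    have [V' [V1 V2]] := hV.
    rewrite /cxnat.
    have hj (j : Fin.t 2) : cxnat (t_T t ◁ t_pr t j) (t_T t' ◁ t_pr t' j)
              (colax_vpaste (cx_a A) k) (colax2 A) := cxnat_hcomp hid (k3 j).
    have hj' (j : Fin.t 2) : cxnat (t_T t ◁ t_pr t j ∘ m) (t_T t' ◁ t_pr t' j ∘ m') k (colax2 A).
      case: (fin2 j) => ->.
        rewrite m1 m1'; exact: cxnat_comp hl (k3 _).
      rewrite m2 m2'; exact: cxnat_comp hzT (k3 _).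
    have e : V' ∘ (cx_F A ◁ m ∘ k) = m' ▷ cx_F A.
      have E : iter1 1 (t_T t') = t_T t' by apply: comp1_idr.
      have hP0 := tg_preserved ht' 1; rewrite E in hP0.
      have hP := proj2 hP0 _ (cx_F A) 2.
      apply: (wide_pullback_joint fst2 hP) => j /=.
      have hc2 : is_iso (colax2 A) by apply: colax_vpaste_iso.
      apply: (iso_mono hc2).
      rewrite [LHS]comp_assoc -(hj j) -[LHS]comp_assoc [_ ∘ (V' ∘ _)]comp_assoc V2 comp_idl.
      rewrite [LHS]comp_assoc.
      rewrite -(fmap_comp (post (cx_F A)) (t_T t ◁ t_pr t j) m : _ = _ ∘ _).
      rewrite -(fmap_comp (pre (cx_F A)) (t_T t' ◁ t_pr t' j) m' : _ = _ ∘ _).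
      exact: hj'.
    by rewrite -e comp_assoc V2 comp_idl.
  have hphi : cxnat phi phi' k (colax2 A).
    by rewrite -ms -ms'; apply: cxnat_comp hm; apply: cxnat_hcomp hid hsk.
  have hleft : cxnat (t_p t ∘ t_pr t fst2) (t_p t' ∘ t_pr t' fst2) k (idx (cx_F A)).
    exact: cxnat_comp hp (k3 _).
  have hi2 : is_iso (colax2 A) by apply: colax_vpaste_iso.
  have hi : is_iso (idx (cx_F A)) by apply: idto_iso.
  split=> [|X0 f].
  - exact: (@pullback_iso _ (map_square (pre (cx_F A)) (vlift_square t' phi'))
      (map_square (post (cx_F A)) (vlift_square t phi)) k (colax2 A) (idx (cx_F A)) (cx_a A)
      k1 hi2 hi hiso hphi hleft hTp hz (proj2 hpb _ (cx_F A))).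
  - exact: (@pullback_iso _ (map_square (pre (cx_F A ⊚ f)) (vlift_square t' phi'))
      (map_square (pre f) (map_square (post (cx_F A)) (vlift_square t phi)))
      (cxw f k) (cxw f (colax2 A)) (cxw f (idx (cx_F A))) (cxw f (cx_a A))
      (cxw_iso f k1) (cxw_iso f hi2) (cxw_iso f hi) (cxw_iso f hiso)
      (cxw_nat f hphi) (cxw_nat f hleft) (cxw_nat f hTp) (cxw_nat f hz)
      (proj2 hpb _ (cx_F A ⊚ f))).
Qed.

End OneMorphism.

Lemma is_strong_of (t t' : TangentData K) (A : Colax (t_endo t) (t_endo t')) :
  is_tangent t' -> is_iso (cx_a A) ->
  is_bundle_morphism (map_bundle (pre (cx_F A)) (t_bundle t'))
    (map_bundle (post (cx_F A)) (t_bundle t)) (idx (cx_F A)) (cx_a A) ->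
  cx_F A ◁ t_l t ∘ cx_a A = colax2 A ∘ t_l t' ▷ cx_F A ->
  colax2 A ∘ t_c t' ▷ cx_F A = cx_F A ◁ t_c t ∘ colax2 A ->
  nfold_cells A -> is_strong A.
Proof.
  move=> ht' hi hb hl hc hk; split=> //; split=> //.
  - exact: nfold_of_cells (bm_q hb) ht' hk.
  - case: hb => /= hp hz [m [/= m1 [m2 m3]]].
    apply: vlift_of_cells => //.
    exists m; split=> // j.
    by case: (fin2 j) => ->.
Qed.

Lemma is_strong_id (t : TangentData K) : is_tangent t ->
  is_strong (t := t) (t' := t) (colax_id (t_endo t)).
Proof.
  move=> ht.
  have e (S : hom (t_ob t) (t_ob t)) : S ⊚ id1 (t_ob t) = id1 (t_ob t) ⊚ S.
    by rewrite comp1_idl comp1_idr.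
  apply: is_strong_of => //=.
  - exact: idto_iso.
  - split => /=; [exact: id_conat | exact: eq_sym (id_conat _ _ _) |].
    by exists (idto (e (t_n t 2))) => /=; split; [|split]; apply: id_conat.
  - by rewrite (colax2_id (e _)); exact: id_conat.
  - by rewrite (colax2_id (e _)); exact: eq_sym (id_conat _ _ _).
  - move=> n; exists (idto (e (t_n t n))); split; first exact: idto_iso.
    by split=> [|j]; apply: id_conat.
Qed.

Lemma colax_paste_iso {X Y Z : K} {S : hom X X} {S' : hom Y Y} {S'' : hom Z Z}
  {F : hom X Y} {G : hom Y Z} (b : Hom (S'' ⊚ G) (G ⊚ S')) (a : Hom (S' ⊚ F) (F ⊚ S)) :
  is_iso b -> is_iso a -> is_iso (colax_paste b a).
Proof.
  move=> hb ha; rewrite /colax_paste /asc /asc'.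
  by repeat apply: iso_comp; try exact: idto_iso; [apply: iso_post|apply: iso_pre].
Qed.

Lemma is_strong_comp (t t' t'' : TangentData K) (B : Colax (t_endo t') (t_endo t''))
  (A : Colax (t_endo t) (t_endo t')) :
  is_tangent t' -> is_tangent t'' ->
  is_strong B -> is_strong A -> is_strong (t := t) (t' := t'') (colax_comp B A).
Proof.
  move=> ht' ht'' [[hBa Bl Bc Bn _] hB] [[hAa Al Ac An _] hA].
  have kB := nfold_cells_of hB (bm_q hBa) ht'' (proj1 Bn).
  have kA := nfold_cells_of hA (bm_q hAa) ht' (proj1 An).
  have eI : colax_paste (idx (cx_F B)) (idx (cx_F A)) = idx (cx_F B ⊚ cx_F A).
    exact: colax_paste_idto.
  case: hBa hAa => /= Bq Bz [mB [/= Bs1 [Bs2 Bs]]] [/= Aq Az [mA [/= As1 [As2 As]]]].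
  apply: is_strong_of => //.
  - exact: colax_paste_iso.
  - split => /=.
    + by rewrite (colax_paste_nat Aq Bq) eI.
    + by rewrite -eI; exact: eq_sym (colax_paste_nat (eq_sym Az) (eq_sym Bz)).
    + exists (colax_paste mB mA) => /=; split; [|split].
      * exact: (colax_paste_nat As1 Bs1).
      * exact: (colax_paste_nat As2 Bs2).
      * exact: (colax_paste_nat As Bs).
  - by rewrite colax2_comp; exact: (colax_paste_nat Al Bl).
  - by rewrite colax2_comp; exact: eq_sym (colax_paste_nat (eq_sym Ac) (eq_sym Bc)).
  - move=> n; have [k [k1 [k2 k3]]] := kA n; have [h [h1 [h2 h3]]] := kB n.
    exists (colax_paste h k); split; first exact: colax_paste_iso.
    split=> [|j].
    + by rewrite /cxnat (colax_paste_nat k2 h2) eI.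
    + exact: (colax_paste_nat (k3 j) (h3 j)).
Qed.

Lemma is_strict_strong (t t' : TangentData K) (A : Colax (t_endo t) (t_endo t')) :
  is_strict A -> is_strong A.
Proof.
  move=> [h e]; split=> //; apply: (iso_pk (eq_sym e)).
  exact: (idto_iso eq_refl).
Qed.

Lemma is_strict_id (t : TangentData K) : is_tangent t ->
  is_strict (t := t) (t' := t) (colax_id (t_endo t)).
Proof.
  move=> ht; split; first exact: (proj1 (is_strong_id ht)).
  exact: pk_idto.
Qed.

Lemma is_strict_comp (t t' t'' : TangentData K) (B : Colax (t_endo t') (t_endo t''))
  (A : Colax (t_endo t) (t_endo t')) :
  is_tangent t' -> is_tangent t'' ->
  is_strict B -> is_strict A -> is_strict (t := t) (t' := t'') (colax_comp B A).
Proof.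
  move=> ht' ht'' hB hA; split.
    exact: proj1 (is_strong_comp ht' ht'' (is_strict_strong hB) (is_strict_strong hA)).
  case: hB hA => _ eB [_ eA].
  rewrite colax_comp_pk eB eA -!/(pid _) !hc_id.
  have := f_equal (@tgt _) eB => /= eB'.
  by rewrite vc_idl /= comp1_assoc // -eB'.
Qed.
End StrongColax.

Definition Tng (K : TwoCat) : TwoCat :=
  @SubTwo (@LaxTwo K) (TangentObject K) (fun t => t_endo t)
    (fun t t' A => is_lax (t := t) (t' := t') A)
    (fun t => is_lax_id t) (fun _ _ _ B A => @is_lax_comp K _ _ _ B A).

Definition Tng_strong (K : TwoCat) : TwoCat :=
  @SubTwo (@ColaxTwo K) (TangentObject K) (fun t => t_endo t)
    (fun t t' A => is_strong (t := t) (t' := t') A)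
    (fun t => is_strong_id (t_tangent t))
    (fun _ t' t'' B A => @is_strong_comp K _ _ _ B A (t_tangent t') (t_tangent t'')).

Definition Tng_strict (K : TwoCat) : TwoCat :=
  @SubTwo (@ColaxTwo K) (TangentObject K) (fun t => t_endo t)
    (fun t t' A => is_strict (t := t) (t' := t') A)
    (fun t => is_strict_id (t_tangent t))
    (fun _ t' t'' B A => @is_strict_comp K _ _ _ B A (t_tangent t') (t_tangent t'')).

(* Colax 1-morphisms are not closed under composition: for (G,β) : X -> X' and
   (H,γ) : X' -> X'', the functor H preserves the pullbacks of p', while HG has
   to preserve those of p, that is, H has to preserve the pullbacks of Gp. For
   instance G = (id, z) from (X, T) to X with the trivial tangent structure, and
   H an arbitrary functor between categories with trivial tangent structures.
   The 1-morphisms of Tng_co are therefore the finite composites of colax ones. *)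
Definition Tng_co (K : TwoCat) : TwoCat :=
  @GenTwo (@ColaxTwo K) (TangentObject K) (fun t => t_endo t)
    (fun t t' A => is_colax (t := t) (t' := t') A).

Definition Tng_co_colax (K : TwoCat) (t t' : Tng_co K) (A : hom t t') : Prop :=
  is_colax (t := t_data t) (t' := t_data t') (proj1_sig A).

Definition is_cartesian {X' X : Category} (P : Functor X' X) {E0 E' : X'}
  (phi : Hom E0 E') : Prop :=
  forall (E : X') (psi : Hom E E') (h : Hom (P E) (P E0)),
    fmap P phi ∘ h = fmap P psi ->
    exists! xi : Hom E E0, fmap P xi = h /\ phi ∘ xi = psi.

Definition is_vertical {X' X : Category} (P : Functor X' X) {E E' : X'}
  (phi : Hom E E') : Prop :=
  exists A : X, fmap P phi ≡ idm A.

Record Cleavage {X' X : Category} (P : Functor X' X) := {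
  cl_ob : forall (A : X) (E' : X') (f : Hom A (P E')), X';
  cl_map : forall (A : X) (E' : X') (f : Hom A (P E')), Hom (cl_ob f) E';
  cl_over : forall (A : X) (E' : X') (f : Hom A (P E')), fmap P (cl_map f) ≡ f;
  cl_cart : forall (A : X) (E' : X') (f : Hom A (P E')), is_cartesian P (cl_map f) }.

(* [g] is [fmap F f] with its target F (P1 E') rewritten to P2 (F' E'), these two
   objects being equal when (F, F') is a commuting square. *)
Definition preserves_cleavage {X1' X1 X2' X2 : Category}
  {P1 : Functor X1' X1} {P2 : Functor X2' X2} (c1 : Cleavage P1) (c2 : Cleavage P2)
  (F : Functor X1 X2) (F' : Functor X1' X2') : Prop :=
  forall (A : X1) (E' : X1') (f : Hom A (P1 E')) (g : Hom (F A) (P2 (F' E'))),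
    g ≡ fmap F f ->
    exists k : Hom (F' (cl_ob c1 f)) (cl_ob c2 g),
      is_vertical P2 k /\ cl_map c2 g ∘ k = fmap F' (cl_map c1 f) /\ is_iso k.

Lemma fmap_pk (C D : Category) (F : Functor C D) (x y x' y' : C)
  (f : Hom x y) (g : Hom x' y') : f ≡ g -> fmap F f ≡ fmap F g.
Proof.
  move=> e; have ex := f_equal (@src _) e; have ey := f_equal (@tgt _) e.
  by move: ex ey => /= ex ey; subst; rewrite (pk_inj e).
Qed.

Lemma preserves_cleavage_id {X' X : Category} (P : Functor X' X) (c : Cleavage P) :
  preserves_cleavage c c (functor_id X) (functor_id X').
Proof.
  move=> A E' f g /pk_inj /= ->.
  exists (idm (cl_ob c f)); split; [|split].
  - by exists (P (cl_ob c f)); rewrite fmap_id.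
  - exact: comp_idr.
  - exact: (idto_iso eq_refl).
Qed.

Lemma preserves_cleavage_comp {X1' X1 X2' X2 X3' X3 : Category}
  {P1 : Functor X1' X1} {P2 : Functor X2' X2} {P3 : Functor X3' X3}
  (c1 : Cleavage P1) (c2 : Cleavage P2) (c3 : Cleavage P3)
  (G : Functor X2 X3) (G' : Functor X2' X3') (F : Functor X1 X2) (F' : Functor X1' X2') :
  functor_comp P2 F' = functor_comp F P1 -> functor_comp P3 G' = functor_comp G P2 ->
  preserves_cleavage c2 c3 G G' -> preserves_cleavage c1 c2 F F' ->
  preserves_cleavage c1 c3 (functor_comp G F) (functor_comp G' F').
Proof.
  move=> eF eG hG hF A E' f g e.
  have eo : F (P1 E') = P2 (F' E') := f_equal (fun H : Functor X1' X2 => H E') (eq_sym eF).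
  have e1 : idto eo ∘ fmap F f ≡ fmap F f.
    by rewrite pk_comp pk_idto vc_idl.
  have [k [k1 [k2 k3]]] := hF A E' f (idto eo ∘ fmap F f) e1.
  have e2 : g ≡ fmap G (idto eo ∘ fmap F f) by rewrite e (fmap_pk _ e1).
  have [h [h1 [h2 h3]]] := hG _ _ _ g e2.
  have iso_map x y (m : Hom x y) : is_iso m -> is_iso (fmap G' m).
    by move=> [n [n1 n2]]; exists (fmap G' n); rewrite -!fmap_comp n1 n2 !fmap_id.
  exists (h ∘ fmap G' k); split; [|split].
  - case: h1 => B hB; case: k1 => B' hB'; exists B.
    have hk : fmap P3 (fmap G' k) ≡ idm (G B').
      have -> : fmap P3 (fmap G' k) ≡ fmap G (fmap P2 k).
        exact: (f_equal (fun H : Functor X2' X3 => pk (fmap H k)) eG).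
      by rewrite -fmap_id; apply: fmap_pk.
    have es := f_equal (@tgt _) hk; have es' := f_equal (@src _) hB.
    rewrite /= in es es'.
    by rewrite fmap_comp pk_comp hB hk vc_idl //= -es es'.
  - by rewrite comp_assoc h2 -(fmap_comp G') k2.
  - by apply: iso_comp => //; apply: iso_map.
Qed.

Record Fibration := {
  f_tot : Category;
  f_base : Category;
  f_fun : Functor f_tot f_base;
  f_cl : Cleavage f_fun }.

Definition f_mor1 (P : Fibration) : Mor1 Cat :=
  @Build_Mor1 Cat (f_tot P) (f_base P) (f_fun P).

Definition is_fibration_morphism (P Q : Fibration) (F : Sq (f_mor1 P) (f_mor1 Q)) : Prop :=
  preserves_cleavage (f_cl P) (f_cl Q) (sq_cod F) (sq_dom F).

Lemma is_fibration_morphism_comp (P Q R : Fibration) (G : Sq (f_mor1 Q) (f_mor1 R))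
  (F : Sq (f_mor1 P) (f_mor1 Q)) :
  is_fibration_morphism G -> is_fibration_morphism F ->
  is_fibration_morphism (P := P) (Q := R) (sq_comp G F).
Proof. exact: preserves_cleavage_comp (sq_comm F) (sq_comm G). Qed.

Definition Fib : TwoCat :=
  @SubTwo (ArrTwo Cat) Fibration f_mor1 is_fibration_morphism
    (fun P => preserves_cleavage_id (f_cl P)) is_fibration_morphism_comp.

Record TangentFibration := {
  tf_tot : TangentObject Cat;
  tf_base : TangentObject Cat;
  tf_fun : @hom Cat (t_ob tf_tot) (t_ob tf_base);
  tf_cl : Cleavage tf_fun;
  tf_comm : t_T tf_base ⊚ tf_fun = tf_fun ⊚ t_T tf_tot;
  tf_strict : is_strict (t := tf_tot) (t' := tf_base)
    (@Build_Colax Cat (t_endo tf_tot) (t_endo tf_base) tf_fun (idto tf_comm));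
  tf_T : preserves_cleavage tf_cl tf_cl (t_T tf_base) (t_T tf_tot) }.

(* The projection as a lax, respectively colax, tangent morphism. *)
Definition tf_lax (P : TangentFibration) : Mor1 (@LaxTwo Cat) :=
  @Build_Mor1 (@LaxTwo Cat) (t_endo (tf_tot P)) (t_endo (tf_base P))
    (@Build_Lax Cat (t_endo (tf_tot P)) (t_endo (tf_base P)) (tf_fun P)
       (idto (eq_sym (tf_comm P)))).
Definition tf_colax (P : TangentFibration) : Mor1 (@ColaxTwo Cat) :=
  @Build_Mor1 (@ColaxTwo Cat) (t_endo (tf_tot P)) (t_endo (tf_base P))
    (@Build_Colax Cat (t_endo (tf_tot P)) (t_endo (tf_base P)) (tf_fun P)
       (idto (tf_comm P))).

Record is_lax_tf (P Q : TangentFibration) (F : Sq (tf_lax P) (tf_lax Q)) : Prop := {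
  ltf_base : is_lax (t := tf_base P) (t' := tf_base Q) (sq_cod F);
  ltf_tot : is_lax (t := tf_tot P) (t' := tf_tot Q) (sq_dom F);
  ltf_fib : preserves_cleavage (tf_cl P) (tf_cl Q) (lx_F (sq_cod F)) (lx_F (sq_dom F)) }.

(* [R] is one of is_colax, is_strong and is_strict. *)
Record is_colax_tf
  (R : forall t t' : TangentData Cat, Colax (t_endo t) (t_endo t') -> Prop)
  (P Q : TangentFibration) (F : Sq (tf_colax P) (tf_colax Q)) : Prop := {
  ctf_base : R (tf_base P) (tf_base Q) (sq_cod F);
  ctf_tot : R (tf_tot P) (tf_tot Q) (sq_dom F);
  ctf_fib : preserves_cleavage (tf_cl P) (tf_cl Q) (cx_F (sq_cod F)) (cx_F (sq_dom F)) }.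

Lemma is_lax_tf_id (P : TangentFibration) :
  is_lax_tf (P := P) (Q := P) (sq_id (tf_lax P)).
Proof. by split; [exact: is_lax_id | exact: is_lax_id | exact: preserves_cleavage_id]. Qed.

Lemma is_lax_tf_comp (P Q R : TangentFibration) (G : Sq (tf_lax Q) (tf_lax R))
  (F : Sq (tf_lax P) (tf_lax Q)) :
  is_lax_tf G -> is_lax_tf F -> is_lax_tf (P := P) (Q := R) (sq_comp G F).
Proof.
  move=> [Gb Gt Gf] [Fb Ft Ff]; split.
  - exact: is_lax_comp Gb Fb.
  - exact: is_lax_comp Gt Ft.
  - exact: (preserves_cleavage_comp
      (f_equal (@lx_F _ _ _) (sq_comm F)) (f_equal (@lx_F _ _ _) (sq_comm G)) Gf Ff).
Qed.

Lemma is_colax_tf_id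
  (R : forall t t' : TangentData Cat, Colax (t_endo t) (t_endo t') -> Prop) :
  (forall t : TangentObject Cat, R t t (colax_id (t_endo t))) ->
  forall P : TangentFibration, is_colax_tf R (P := P) (Q := P) (sq_id (tf_colax P)).
Proof.
  move=> h P; split; [exact: h | exact: h | exact: preserves_cleavage_id].
Qed.

Lemma is_colax_tf_comp (R : forall t t' : TangentData Cat, Colax (t_endo t) (t_endo t') -> Prop) :
  (forall (t t' t'' : TangentObject Cat) (B : Colax (t_endo t') (t_endo t''))
     (A : Colax (t_endo t) (t_endo t')), R t' t'' B -> R t t' A ->
     R t t'' (colax_comp B A)) ->
  forall (P Q S : TangentFibration) (G : Sq (tf_colax Q) (tf_colax S))
    (F : Sq (tf_colax P) (tf_colax Q)),
  is_colax_tf R G -> is_colax_tf R F -> is_colax_tf R (P := P) (Q := S) (sq_comp G F).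
Proof.
  move=> h P Q S G F [Gb Gt Gf] [Fb Ft Ff]; split.
  - exact: h Gb Fb.
  - exact: h Gt Ft.
  - exact: (preserves_cleavage_comp
      (f_equal (@cx_F _ _ _) (sq_comm F)) (f_equal (@cx_F _ _ _) (sq_comm G)) Gf Ff).
Qed.

Definition TngFib : TwoCat :=
  @SubTwo (ArrTwo (@LaxTwo Cat)) TangentFibration tf_lax is_lax_tf
    is_lax_tf_id is_lax_tf_comp.

Definition TngFib_strong : TwoCat :=
  @SubTwo (ArrTwo (@ColaxTwo Cat)) TangentFibration tf_colax (is_colax_tf (@is_strong Cat))
    (is_colax_tf_id (fun t => is_strong_id (t_tangent t)))
    (is_colax_tf_comp (fun _ t' t'' B A =>
       @is_strong_comp Cat _ _ _ B A (t_tangent t') (t_tangent t''))).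

Definition TngFib_strict : TwoCat :=
  @SubTwo (ArrTwo (@ColaxTwo Cat)) TangentFibration tf_colax (is_colax_tf (@is_strict Cat))
    (is_colax_tf_id (fun t => is_strict_id (t_tangent t)))
    (is_colax_tf_comp (fun _ t' t'' B A =>
       @is_strict_comp Cat _ _ _ B A (t_tangent t') (t_tangent t''))).

Definition TngFib_co : TwoCat :=
  @GenTwo (ArrTwo (@ColaxTwo Cat)) TangentFibration tf_colax (is_colax_tf (@is_colax Cat)).

Definition TngFib_co_colax (P Q : TngFib_co) (F : hom P Q) : Prop :=
  is_colax_tf (@is_colax Cat) (P := P) (Q := Q) (proj1_sig F).

Record TwoFunctor (A B : TwoCat) := {
  fn_ob :> A -> B;
  fn_hom : forall x y : A, Functor (hom x y) (hom (fn_ob x) (fn_ob y));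
  fn_id1 : forall x : A, fn_hom x x (id1 x) = id1 (fn_ob x);
  fn_comp1 : forall (x y z : A) (g : hom y z) (f : hom x y),
    fn_hom x z (g ⊚ f) = fn_hom y z g ⊚ fn_hom x y f;
  fn_hcomp : forall (x y z : A) (g g' : hom y z) (f f' : hom x y)
    (b : Hom g g') (a : Hom f f'),
    fmap (fn_hom x z) (hcomp b a) ≡ hcomp (fmap (fn_hom y z) b) (fmap (fn_hom x y) a) }.
Arguments fn_hom {A B} t {x y}.

Definition two_functor_id (A : TwoCat) : TwoFunctor A A.
Proof.
  by unshelve refine {| fn_ob := fun x => x; fn_hom := fun x y => functor_id (hom x y) |}.
Defined.

Definition two_functor_comp (A B C : TwoCat) (G : TwoFunctor B C) (F : TwoFunctor A B) :
  TwoFunctor A C.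
Proof.
  unshelve refine {| fn_ob := fun x => G (F x);
    fn_hom := fun x y => functor_comp (@fn_hom _ _ G (F x) (F y)) (@fn_hom _ _ F x y) |}.
  - by move=> x /=; rewrite !fn_id1.
  - by move=> x y z g f /=; rewrite !fn_comp1.
  - by move=> x y z g g' f f' b a /=; rewrite (fmap_pk _ (fn_hcomp _ _ _)) fn_hcomp.
Defined.

Record TwoNatIso (A B : TwoCat) (F G : TwoFunctor A B) := {
  ni_mor : forall x : A, hom (F x) (G x);
  ni_inv : forall x : A, hom (G x) (F x);
  ni_invl : forall x : A, ni_inv x ⊚ ni_mor x = id1 (F x);
  ni_invr : forall x : A, ni_mor x ⊚ ni_inv x = id1 (G x);
  ni_nat1 : forall (x y : A) (f : hom x y),
    fn_hom G f ⊚ ni_mor x = ni_mor y ⊚ fn_hom F f;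
  ni_nat2 : forall (x y : A) (f f' : hom x y) (a : Hom f f'),
    fmap (fn_hom G) a ▷ ni_mor x ≡ ni_mor y ◁ fmap (fn_hom F) a }.

Record TwoEquivalence (A B : TwoCat) := {
  te_fun : TwoFunctor A B;
  te_inv : TwoFunctor B A;
  te_unit : TwoNatIso (two_functor_id A) (two_functor_comp te_inv te_fun);
  te_counit : TwoNatIso (two_functor_comp te_fun te_inv) (two_functor_id B) }.

Definition equivalent2 (A B : TwoCat) : Prop := inhabited (TwoEquivalence A B).

(* The equivalence restricts to given classes of 1-morphisms. *)
Record restricts (A B : TwoCat) (E : TwoEquivalence A B)
  (P : forall x y : A, hom x y -> Prop) (Q : forall x y : B, hom x y -> Prop) : Prop := {
  rs_fun : forall (x y : A) (f : hom x y), P x y f <-> Q _ _ (fn_hom (te_fun E) f);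
  rs_inv : forall (x y : B) (g : hom x y), Q x y g <-> P _ _ (fn_hom (te_inv E) g);
  rs_unit : forall x : A, P _ _ (ni_mor (te_unit E) x) /\ P _ _ (ni_inv (te_unit E) x);
  rs_counit : forall y : B, Q _ _ (ni_mor (te_counit E) y) /\ Q _ _ (ni_inv (te_counit E) y) }.

(* Main.v *)
Require Import Defs.
From Stdlib Require Import ssreflect Fin.
From Stdlib Require Import ProofIrrelevance FunctionalExtensionality PropExtensionality.
From Stdlib Require Import ClassicalEpsilon.

(* The projections Dom, Cod : Fib -> Cat onto the total and the base categories
   jointly preserve and reflect every ingredient of a tangent structure. For
   pointwise limits, preservation holds because evaluation at an object of the total
   (base) category is a right adjoint on Fib(1 -> 1, P) (on Fib(0 -> 1, P)), hence
   preserves limits. So a tangent object of Fib consists of two tangent categories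
   and a cloven fibration that commutes strictly with T, p, z, l, c and with the
   chosen pullbacks T_n. A tangent fibration commutes with T_n only up to an
   isomorphism, along which the cleavage transports T_n.

   Changing the T_n does not affect morphisms: they only see T, p, z, l, c and the
   relation u + v = w. Forgetting the T_n, both 2-categories of the theorem embed,
   fully on 2-morphisms, into squares of (co)lax morphisms over the same family of
   structures, and have the same image there. *)

Set Implicit Arguments.
Unset Strict Implicit.
Unset Printing Implicit Defensive.

(** * 2-categories over a common family of objects *)

(** The round trips between the two kinds of objects may change the T_n, so the 2-categories cannot
    be compared by mutually inverse formulas. A representation that is injective on 1-morphisms and
    bijective on 2-morphisms allows 2-functors, unit and counit to be chosen as preimages, with all
    their laws verified after mapping down. It then remains to describe both images by one
    predicate. Such a predicate may not name T_n; this forces the addition to be recorded as a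
    relation, and the preservation of pullbacks by colax morphisms to be stated for arbitrary
    pullback cones. Testing an axiom on the total and the base category separately meets one
    obstacle: a 2-cell of [Fib] is a pair subject to an equation in the base. To see that two
    mediating morphisms satisfy it, the base limit has to survive whiskering by the projection,
    which is what being pointwise provides. Conversely, making T_n strict over the base needs two
    facts about cartesian morphisms: those over isomorphisms are isomorphisms, and a limit of
    cartesian morphisms is cartesian if the projection preserves the limit. *)

(* Several objects may share a value of [rp_ob] (they differ by the chosen T_n): this
   is why the 2-categories compared are equivalent and not isomorphic. *)
Record Rep (K : TwoCat) (O : Type) (i : O -> K) (U : TwoCat) (R : Type) (v : R -> U) := {
  rp_ob :> O -> R;
  rp_hom : forall x y : O, Functor (hom (i x) (i y)) (hom (v (rp_ob x)) (v (rp_ob y)));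
  rp_id1 : forall x : O, rp_hom x x (id1 (i x)) = id1 (v (rp_ob x));
  rp_comp1 : forall (x y z : O) (g : hom (i y) (i z)) (f : hom (i x) (i y)),
    rp_hom x z (g ⊚ f) = rp_hom y z g ⊚ rp_hom x y f;
  rp_hcomp : forall (x y z : O) (g g' : hom (i y) (i z)) (f f' : hom (i x) (i y))
    (b : Hom g g') (a : Hom f f'),
    fmap (rp_hom x z) (hcomp b a) ≡ hcomp (fmap (rp_hom y z) b) (fmap (rp_hom x y) a);
  rp_inj : forall (x y : O) (f g : hom (i x) (i y)), rp_hom x y f = rp_hom x y g -> f = g;
  rp_faithful : forall (x y : O) (f g : hom (i x) (i y)) (a b : Hom f g),
    fmap (rp_hom x y) a = fmap (rp_hom x y) b -> a = b;
  rp_full : forall (x y : O) (f g : hom (i x) (i y)) (b : Hom (rp_hom x y f) (rp_hom x y g)),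
    exists a : Hom f g, fmap (rp_hom x y) a = b }.
Arguments rp_hom {K O i U R v} r {x y}.

(** Fullness and faithfulness survive because [SubTwo] keeps all 2-morphisms; only the image on
    1-morphisms shrinks. *)
Definition rep_sub (K : TwoCat) (O : Type) (i : O -> K) (U : TwoCat) (R : Type) (v : R -> U)
  (r : Rep i v) (P : forall x y : O, hom (i x) (i y) -> Prop)
  (Pid : forall x, P x x (id1 (i x)))
  (Pcomp : forall x y z (g : hom (i y) (i z)) (f : hom (i x) (i y)),
     P y z g -> P x y f -> P x z (g ⊚ f)) :
  Rep (fun x : SubTwo Pid Pcomp => x) v.
Proof.
  unshelve refine (@Build_Rep (SubTwo Pid Pcomp) O (fun x => x) U R v r
    (fun x y => @Build_Functor (FullSub (@P x y)) _ (fun f => rp_hom r (proj1_sig f))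
       (fun f g a => @fmap _ _ (rp_hom r) (proj1_sig f) (proj1_sig g) a) _ _) _ _ _ _ _ _).
  - by move=> f; apply: fmap_id.
  - by move=> f g h b a; apply: (fmap_comp (rp_hom r)).
  - by move=> x; apply: rp_id1.
  - by move=> x y z g f; apply: rp_comp1.
  - by move=> x y z g g' f f' b a; apply: (rp_hcomp r).
  - by move=> x y f g e; apply: sub_eq; apply: (rp_inj (r := r)) e.
  - by move=> x y f g a b; apply: (rp_faithful (r := r)).
  - by move=> x y f g b; apply: (rp_full (r := r)).
Defined.

(** * Morphisms packed with their end points *)

Section Packed.
Context (U : TwoCat) (R : Type) (v : R -> U).

(* Comparing morphisms of U whose end points are only propositionally equal. *)
Record Pk1 := pk1 { k_s : R; k_t : R; k_f : hom (v k_s) (v k_t) }.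
Record Pk2 := pk2 { c_s : R; c_t : R; c_f : hom (v c_s) (v c_t); c_g : hom (v c_s) (v c_t);
                    c_a : Hom c_f c_g }.
Arguments pk1 {k_s k_t} k_f.
Arguments pk2 {c_s c_t c_f c_g} c_a.

Lemma pk1_inj (s t : R) (f g : hom (v s) (v t)) : pk1 f = pk1 g -> f = g.
Proof.
  move=> e; injection e => e'.
  exact: (inj_pairT2 _ _ _ _ _ (inj_pairT2 _ _ _ _ _ e')).
Qed.

Lemma pk2_inj (s t : R) (f g f' g' : hom (v s) (v t)) (a : Hom f g) (a' : Hom f' g') :
  pk2 a = pk2 a' -> a ≡ a'.
Proof.
  move=> e.
  (* Stated for arbitrary packed cells so that the equality can be eliminated. When the end points
     coincide, proof irrelevance turns both transports into identities. *)
  have H : forall A A' : Pk2, A = A' -> forall (e1 : c_s A = c_s A') (e2 : c_t A = c_t A'),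
    eq_rect _ (fun s => Arrow (hom (v s) (v (c_t A'))))
      (eq_rect _ (fun t => Arrow (hom (v (c_s A)) (v t))) (pk (c_a A)) _ e2) _ e1 = pk (c_a A').
    move=> A _ <- e1 e2.
    by rewrite (proof_irrelevance _ e1 eq_refl) (proof_irrelevance _ e2 eq_refl).
  exact: (H _ _ e eq_refl eq_refl).
Qed.

Lemma pk2_eq (s t : R) (f g f' g' : hom (v s) (v t)) (a : Hom f g) (a' : Hom f' g') :
  a ≡ a' -> pk2 a = pk2 a'.
Proof.
  move=> e; have ex := f_equal (@src _) e; have ey := f_equal (@tgt _) e.
  by move: ex ey => /= ex ey; subst; rewrite (pk_inj e).
Qed.

Lemma pk2_dest (s t s' t' : R) (f g : hom (v s) (v t)) (a : Hom f g)
  (f' g' : hom (v s') (v t')) : pk1 f' = pk1 f -> pk1 g' = pk1 g ->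
  exists b : Hom f' g', pk2 b = pk2 a.
Proof.
  move=> ef eg.
  have es : s' = s := f_equal k_s ef; have et : t' = t := f_equal k_t ef; subst s' t'.
  by have ef' := pk1_inj ef; have eg' := pk1_inj eg; subst; exists a.
Qed.

Lemma pk1_dest (s t s' t' : R) (f : hom (v s) (v t)) : s' = s -> t' = t ->
  exists f' : hom (v s') (v t'), pk1 f' = pk1 f.
Proof. by move=> -> ->; exists f. Qed.

Lemma pk1_comp (x y z x' y' z' : R) (g : hom (v y) (v z)) (f : hom (v x) (v y))
  (g' : hom (v y') (v z')) (f' : hom (v x') (v y')) :
  pk1 g = pk1 g' -> pk1 f = pk1 f' -> pk1 (g ⊚ f) = pk1 (g' ⊚ f').
Proof.
  move=> eg ef.
  have ex : x' = x := eq_sym (f_equal k_s ef); have ey : y' = y := eq_sym (f_equal k_t ef).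
  have ez : z' = z := eq_sym (f_equal k_t eg); subst x' y' z'.
  by rewrite (pk1_inj eg) (pk1_inj ef).
Qed.

Lemma pk2_comp (s t s' t' : R) (f g h : hom (v s) (v t)) (b : Hom g h) (a : Hom f g)
  (f' g' h' : hom (v s') (v t')) (b' : Hom g' h') (a' : Hom f' g') :
  pk2 b = pk2 b' -> pk2 a = pk2 a' -> pk2 (b ∘ a) = pk2 (b' ∘ a').
Proof.
  move=> eb ea.
  have es : s' = s := eq_sym (f_equal c_s ea); have et : t' = t := eq_sym (f_equal c_t ea).
  subst s' t'; apply: pk2_eq; rewrite !pk_comp.
  by rewrite (pk2_inj eb) (pk2_inj ea).
Qed.

Lemma pk2_hcomp (x y z x' y' z' : R) (g h : hom (v y) (v z)) (f k : hom (v x) (v y))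
  (b : Hom g h) (a : Hom f k) (g' h' : hom (v y') (v z')) (f' k' : hom (v x') (v y'))
  (b' : Hom g' h') (a' : Hom f' k') :
  pk2 b = pk2 b' -> pk2 a = pk2 a' -> pk2 (hcomp b a) = pk2 (hcomp b' a').
Proof.
  move=> eb ea.
  have ex : x' = x := eq_sym (f_equal c_s ea); have ey : y' = y := eq_sym (f_equal c_t ea).
  have ez : z' = z := eq_sym (f_equal c_t eb); subst x' y' z'; apply: pk2_eq.
  by rewrite !pk_hcomp (pk2_inj eb) (pk2_inj ea).
Qed.

Lemma pk1_id (x x' : R) : x = x' -> pk1 (id1 (v x)) = pk1 (id1 (v x')).
Proof. by move=> ->. Qed.

Lemma pk2_idm (s t s' t' : R) (f : hom (v s) (v t)) (f' : hom (v s') (v t')) :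
  pk1 f = pk1 f' -> pk2 (idm f) = pk2 (idm f').
Proof.
  move=> ef.
  have es : s' = s := eq_sym (f_equal k_s ef); have et : t' = t := eq_sym (f_equal k_t ef).
  by subst s' t'; rewrite (pk1_inj ef).
Qed.
End Packed.
Arguments pk1 {U R v k_s k_t} k_f.
Arguments pk2 {U R v c_s c_t c_f c_g} c_a.

(** * 2-functors and their isomorphisms chosen as preimages *)

Section Compare.
Context (U : TwoCat) (R : Type) (v : R -> U).
Context (P : forall r r' : R, hom (v r) (v r') -> Prop).

Definition Represented (A : TwoCat) := Rep (fun x : A => x) v.

(** On 2-morphisms [Rep] already gives bijections, so [P] determines the whole image. *)
Definition has_image (A : TwoCat) (a : Represented A) : Prop :=
  forall (x y : A) (f : hom (v (a x)) (v (a y))), (exists g, rp_hom a g = f) <-> P f.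

Definition rk1 (A : TwoCat) (a : Represented A) (x y : A) (f : hom x y) : Pk1 v :=
  pk1 (rp_hom a f).
Definition rk2 (A : TwoCat) (a : Represented A) (x y : A) (f g : hom x y) (t : Hom f g) :
  Pk2 v := pk2 (fmap (rp_hom a) t).

Lemma rk1_inj (A : TwoCat) (a : Represented A) (x y : A) (f g : hom x y) :
  rk1 a f = rk1 a g -> f = g.
Proof. by move=> e; apply: (rp_inj (r := a)); apply: pk1_inj e. Qed.

Lemma rk2_inj (A : TwoCat) (a : Represented A) (x y : A) (f g f' g' : hom x y)
  (t : Hom f g) (t' : Hom f' g') : rk2 a t = rk2 a t' -> t ≡ t'.
Proof.
  move=> e0; have e := pk2_inj e0.
  have ef : f = f' by apply: (rp_inj (r := a)); exact: (f_equal (@src _) e).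
  have eg : g = g' by apply: (rp_inj (r := a)); exact: (f_equal (@tgt _) e).
  subst f' g'; congr pk; apply: (rp_faithful (r := a)); exact: pk_inj e.
Qed.

Lemma rk1_id (A : TwoCat) (a : Represented A) (x : A) : rk1 a (id1 x) = pk1 (id1 (v (a x))).
Proof. by rewrite /rk1 (rp_id1 a). Qed.
Lemma rk1_comp (A : TwoCat) (a : Represented A) (x y z : A) (g : hom y z) (f : hom x y) :
  rk1 a (g ⊚ f) = pk1 (rp_hom a g ⊚ rp_hom a f).
Proof. by rewrite /rk1 (rp_comp1 a). Qed.
Lemma rk2_hcomp (A : TwoCat) (a : Represented A) (x y z : A) (g g' : hom y z)
  (f f' : hom x y) (t : Hom g g') (s : Hom f f') :
  rk2 a (hcomp t s) = pk2 (hcomp (fmap (rp_hom a) t) (fmap (rp_hom a) s)).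
Proof. by apply: pk2_eq; apply: (rp_hcomp a). Qed.
Lemma rk2_comp (A : TwoCat) (a : Represented A) (x y : A) (f g h : hom x y)
  (t : Hom g h) (s : Hom f g) :
  rk2 a (t ∘ s) = pk2 (fmap (rp_hom a) t ∘ fmap (rp_hom a) s).
Proof. by rewrite /rk2 fmap_comp. Qed.
Lemma rk2_id (A : TwoCat) (a : Represented A) (x y : A) (f : hom x y) :
  rk2 a (idm f) = pk2 (idm (rp_hom a f)).
Proof. by rewrite /rk2 fmap_id. Qed.

Section Lift.
Context (A B : TwoCat) (a : Represented A) (b : Represented B).

Lemma lift1 : has_image a -> has_image b ->
  forall (x y : A) (x' y' : B), b x' = a x -> b y' = a y -> forall f : hom x y,
  exists g : hom x' y', rk1 b g = rk1 a f.
Proof.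
  move=> ha hb x y x' y' ex ey f.
  have hf : P (rp_hom a f) by apply/ha; exists f.
  rewrite /rk1; move: (rp_hom a f) hf; rewrite -ex -ey => F /hb [g <-].
  by exists g.
Qed.

Lemma lift2 (x y : A) (x' y' : B) (f g : hom x y) (f' g' : hom x' y') :
  rk1 b f' = rk1 a f -> rk1 b g' = rk1 a g -> forall t : Hom f g,
  exists t' : Hom f' g', rk2 b t' = rk2 a t.
Proof.
  move=> ef eg t.
  case: (pk2_dest (fmap (rp_hom a) t) ef eg) => s hs.
  by case: (rp_full s) => t' ht; exists t'; rewrite /rk2 ht.
Qed.

Context (ha : has_image a) (hb : has_image b).
Context (phi : A -> B) (hphi : forall x, b (phi x) = a x).

(** The choice is forced: [rk1 b] is injective on morphisms with given end points. This is why the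
    laws of [lift_functor] may be checked after applying [rk1] and [rk2]. *)
Definition lift_ob (x y : A) (f : hom x y) : {g : hom (phi x) (phi y) | rk1 b g = rk1 a f} :=
  constructive_indefinite_description _ (lift1 ha hb (hphi x) (hphi y) f).

Definition lift_mor (x y : A) (f g : hom x y) (t : Hom f g) :
  {t' : Hom (proj1_sig (lift_ob f)) (proj1_sig (lift_ob g)) | rk2 b t' = rk2 a t} :=
  constructive_indefinite_description _
    (lift2 (proj2_sig (lift_ob f)) (proj2_sig (lift_ob g)) t).

Definition lift_hom (x y : A) : Functor (hom x y) (hom (phi x) (phi y)).
Proof.
  unshelve refine {| fob := fun f => proj1_sig (lift_ob f);
                     fmap := fun f g t => proj1_sig (lift_mor t) |}.
  - move=> f; apply: pk_inj; apply: (rk2_inj (a := b)).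
    rewrite (proj2_sig (lift_mor _)) !rk2_id; apply: pk2_idm.
    by rewrite -![pk1 _]/(rk1 _ _) (proj2_sig (lift_ob _)).
  - move=> f g h s t; apply: pk_inj; apply: (rk2_inj (a := b)).
    rewrite (proj2_sig (lift_mor _)) !rk2_comp; apply: pk2_comp.
      by rewrite -![pk2 _]/(rk2 _ _) (proj2_sig (lift_mor _)).
    by rewrite -![pk2 _]/(rk2 _ _) (proj2_sig (lift_mor _)).
Defined.

Lemma lift_hom_rk1 (x y : A) (f : hom x y) : rk1 b (lift_hom x y f) = rk1 a f.
Proof. exact: (proj2_sig (lift_ob f)). Qed.
Lemma lift_hom_rk2 (x y : A) (f g : hom x y) (t : Hom f g) :
  rk2 b (fmap (lift_hom x y) t) = rk2 a t.
Proof. exact: (proj2_sig (lift_mor t)). Qed.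

Definition lift_functor : TwoFunctor A B.
Proof.
  unshelve refine {| fn_ob := phi; fn_hom := lift_hom |}.
  - move=> x; apply: (rk1_inj (a := b)).
    by rewrite lift_hom_rk1 !rk1_id; apply: pk1_id; rewrite hphi.
  - move=> x y z g f; apply: (rk1_inj (a := b)).
    by rewrite lift_hom_rk1 !rk1_comp; apply: pk1_comp; apply: eq_sym; apply: lift_hom_rk1.
  - move=> x y z g g' f f' s t; apply: (rk2_inj (a := b)).
    by rewrite lift_hom_rk2 !rk2_hcomp; apply: pk2_hcomp; apply: eq_sym; apply: lift_hom_rk2.
Defined.
End Lift.

Section LiftIso.
Context (A B : TwoCat) (b : Represented B) (a : Represented A) (hb : has_image b)
  (F G : TwoFunctor A B).
Context (hF : forall x, b (F x) = a x) (hG : forall x, b (G x) = a x).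
Context (hF1 : forall x y (f : hom x y), rk1 b (fn_hom F f) = rk1 a f).
Context (hG1 : forall x y (f : hom x y), rk1 b (fn_hom G f) = rk1 a f).
Context (hF2 : forall x y (f g : hom x y) (t : Hom f g), rk2 b (fmap (fn_hom F) t) = rk2 a t).
Context (hG2 : forall x y (f g : hom x y) (t : Hom f g), rk2 b (fmap (fn_hom G) t) = rk2 a t).

(** Two distinct objects of B over the same [r] are isomorphic. The identity of [v r] is in the
    image, being the value of [id1 x], and [lift1] from B to itself moves it to the pair x, y. *)
Lemma ident_exists (x y : B) (r : R) : b x = r -> b y = r ->
  exists m : hom x y, rk1 b m = pk1 (id1 (v r)).
Proof.
  move=> ex ey.
  have [m hm] := lift1 hb hb eq_refl (eq_trans ey (eq_sym ex)) (id1 x).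
  by exists m; rewrite hm rk1_id; apply: pk1_id.
Qed.

Definition ident (x y : B) (r : R) (ex : b x = r) (ey : b y = r) :
  {m : hom x y | rk1 b m = pk1 (id1 (v r))} :=
  constructive_indefinite_description _ (ident_exists ex ey).

Lemma rk1_compE (x y z : B) (g : hom y z) (f : hom x y) (x' y' z' : R)
  (g' : hom (v y') (v z')) (f' : hom (v x') (v y')) :
  rk1 b g = pk1 g' -> rk1 b f = pk1 f' -> rk1 b (g ⊚ f) = pk1 (g' ⊚ f').
Proof. by move=> eg ef; rewrite rk1_comp; apply: pk1_comp. Qed.

Lemma rk2_hcompE (x y z : B) (g h : hom y z) (f k : hom x y) (s : Hom g h) (t : Hom f k)
  (x' y' z' : R) (g' h' : hom (v y') (v z')) (f' k' : hom (v x') (v y'))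
  (s' : Hom g' h') (t' : Hom f' k') :
  rk2 b s = pk2 s' -> rk2 b t = pk2 t' -> rk2 b (hcomp s t) = pk2 (hcomp s' t').
Proof. by move=> es et; rewrite rk2_hcomp; apply: pk2_hcomp. Qed.

(** All components lie over identities, so invertibility and naturality reduce to the unit laws of
    [U]. *)
Definition lift_iso : TwoNatIso F G.
Proof.
  unshelve refine {| ni_mor := fun x => proj1_sig (ident (hF x) (hG x));
                     ni_inv := fun x => proj1_sig (ident (hG x) (hF x)) |}.
  - move=> x; apply: (rk1_inj (a := b)).
    rewrite (rk1_compE (proj2_sig (ident _ _)) (proj2_sig (ident _ _))) comp1_idl rk1_id.
    by apply: pk1_id.
  - move=> x; apply: (rk1_inj (a := b)).
    rewrite (rk1_compE (proj2_sig (ident _ _)) (proj2_sig (ident _ _))) comp1_idl rk1_id.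
    by apply: pk1_id.
  - move=> x y f; apply: (rk1_inj (a := b)).
    rewrite (rk1_compE (hG1 f) (proj2_sig (ident _ _))).
    by rewrite (rk1_compE (proj2_sig (ident _ _)) (hF1 f)) comp1_idl comp1_idr.
  - move=> x y f f' t; apply: (rk2_inj (a := b)).
    have hi z : rk2 b (idm (proj1_sig (ident (hF z) (hG z)))) = pk2 (idm (id1 (v (a z)))).
      by rewrite rk2_id; apply: pk2_idm; exact: (proj2_sig (ident (hF z) (hG z))).
    rewrite (rk2_hcompE (hG2 t) (hi x)) (rk2_hcompE (hi y) (hF2 t)).
    by apply: pk2_eq; rewrite hcomp_idl hcomp_idr.
Defined.
End LiftIso.

(** The clause on [PA] and [PB] serves the colax case, where [P] is the class of finite composites
    and [Q] singles out the colax morphisms themselves. Unit and counit lie over identities, hence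
    the condition that [Q] contains these. *)
Lemma compare (A B : TwoCat) (a : Represented A) (b : Represented B) :
  has_image a -> has_image b ->
  (forall x : A, exists y : B, b y = a x) -> (forall y : B, exists x : A, a x = b y) ->
  exists E : TwoEquivalence A B,
    forall (PA : forall x y : A, hom x y -> Prop) (PB : forall x y : B, hom x y -> Prop)
      (Q : forall r r' : R, hom (v r) (v r') -> Prop),
    (forall x y (f : hom x y), PA x y f <-> Q _ _ (rp_hom a f)) ->
    (forall x y (f : hom x y), PB x y f <-> Q _ _ (rp_hom b f)) ->
    (forall r, Q r r (id1 (v r))) -> restricts E PA PB.
Proof.
  move=> ha hb hab hba.
  pose phi x := proj1_sig (constructive_indefinite_description _ (hab x)).
  pose psi y := proj1_sig (constructive_indefinite_description _ (hba y)).
  have hphi x : b (phi x) = a x by exact: (proj2_sig (constructive_indefinite_description _ (hab x))).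
  have hpsi y : a (psi y) = b y by exact: (proj2_sig (constructive_indefinite_description _ (hba y))).
  pose F := lift_functor ha hb hphi.
  pose G := lift_functor hb ha hpsi.
  have F1 x y (f : hom x y) : rk1 b (fn_hom F f) = rk1 a f by apply: lift_hom_rk1.
  have G1 x y (f : hom x y) : rk1 a (fn_hom G f) = rk1 b f by apply: lift_hom_rk1.
  have F2 x y (f g : hom x y) (t : Hom f g) : rk2 b (fmap (fn_hom F) t) = rk2 a t.
    by apply: lift_hom_rk2.
  have G2 x y (f g : hom x y) (t : Hom f g) : rk2 a (fmap (fn_hom G) t) = rk2 b t.
    by apply: lift_hom_rk2.
  have hGF x : a (two_functor_comp G F x) = a x by rewrite /= hpsi hphi.
  have hFG x : b (two_functor_comp F G x) = b x by rewrite /= hphi hpsi.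
  have GF1 x y (f : hom x y) : rk1 a (fn_hom (two_functor_comp G F) f) = rk1 a f.
    by rewrite /= G1 F1.
  have FG1 x y (f : hom x y) : rk1 b (fn_hom (two_functor_comp F G) f) = rk1 b f.
    by rewrite /= F1 G1.
  have GF2 x y (f g : hom x y) (t : Hom f g) :
    rk2 a (fmap (fn_hom (two_functor_comp G F)) t) = rk2 a t by rewrite /= G2 F2.
  have FG2 x y (f g : hom x y) (t : Hom f g) :
    rk2 b (fmap (fn_hom (two_functor_comp F G)) t) = rk2 b t by rewrite /= F2 G2.
  pose u := @lift_iso A A a a ha (two_functor_id A) (two_functor_comp G F)
    (fun _ => eq_refl) hGF (fun _ _ _ => eq_refl) GF1 (fun _ _ _ _ _ => eq_refl) GF2.
  pose c := @lift_iso B B b b hb (two_functor_comp F G) (two_functor_id B)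
    hFG (fun _ => eq_refl) FG1 (fun _ _ _ => eq_refl) FG2 (fun _ _ _ _ _ => eq_refl).
  exists {| te_fun := F; te_inv := G; te_unit := u; te_counit := c |}.
  move=> PA PB Q hPA hPB hQ.
  (* On packed morphisms the predicate can be rewritten along equalities of [rk1], whose two sides
     live over different objects. *)
  pose Q' (k : Pk1 v) := Q _ _ (k_f k).
  have A' x y (f : hom x y) : PA x y f <-> Q' (rk1 a f) by apply: hPA.
  have B' x y (f : hom x y) : PB x y f <-> Q' (rk1 b f) by apply: hPB.
  split=> /=.
  - by move=> x y f; rewrite A' B' F1.
  - by move=> x y f; rewrite A' B' G1.
  - move=> x; split; apply/A'.
      by rewrite (proj2_sig (ident _ _ _)); apply: hQ.
    by rewrite (proj2_sig (ident _ _ _)); apply: hQ.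
  - move=> x; split; apply/B'.
      by rewrite (proj2_sig (ident _ _ _)); apply: hQ.
    by rewrite (proj2_sig (ident _ _ _)); apply: hQ.
Qed.
End Compare.

(** A composite in [U] passes through intermediate values in [R], which surjectivity of [r] lifts to
    objects. An identity of [U] may have to be lifted between two different objects over the same
    value; there it is the image of a generator, because [P] contains identities. *)
Lemma image_generated (K : TwoCat) (O : Type) (i : O -> K) (U : TwoCat) (R : Type)
  (v : R -> U) (r : Rep i v) (PA : forall x y : O, hom (i x) (i y) -> Prop)
  (P : forall s s' : R, hom (v s) (v s') -> Prop) :
  (forall s, exists x : O, r x = s) -> (forall s, P s s (id1 (v s))) ->
  (forall x y (f : hom (v (r x)) (v (r y))),
     (exists g, PA x y g /\ rp_hom r g = f) <-> P _ _ f) ->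
  forall x y (f : hom (v (r x)) (v (r y))),
     (exists g, generated PA (x := x) (y := y) g /\ rp_hom r g = f) <-> generated P (x := r x) (y := r y) f.
Proof.
  move=> hs hid h x y f; split.
  - move=> [g [hg <-]]; elim: hg => {x y f g} [x y f hf|x|x y z g f _ hg _ hf].
    + by apply: gen_mor; apply/h; exists f.
    + by rewrite rp_id1; apply: (@gen_id U R v).
    + by rewrite rp_comp1; apply: (@gen_comp U R v _ _ (r y)).
  - move=> hf.
    have H : forall s s' (f : hom (v s) (v s')), generated P (x := s) (y := s') f ->
       forall x y (ex : r x = s) (ey : r y = s'),
       exists g, generated PA (x := x) (y := y) g /\ pk1 (rp_hom r g) = pk1 f.
      move=> s s' F; elim=> {s s' F} [s s' F hF|s|s1 s2 s3 g F _ hg _ hF] x0 y0 ex ey.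
      + subst s s'; case/h: hF => g [g1 g2]; exists g; split; first exact: gen_mor.
        by rewrite g2.
      + have [F ef] := pk1_dest (id1 (v s)) ex ey.
        have : P _ _ F.
          subst s.
          have H (s' : R) (e : s' = r x0) (k : hom (v (r x0)) (v s')) :
              pk1 k = pk1 (id1 (v (r x0))) -> P _ _ k.
            by subst s'; move=> ek; rewrite (pk1_inj ek).
          exact: H _ ey F ef.
        by move/h => [g [g1 g2]]; exists g; split; [exact: gen_mor|rewrite g2].
      + have [z ez] := hs s2.
        have [g' [g1 g2]] := hg z y0 ez ey; have [f' [f1 f2]] := hF x0 z ex ez.
        exists (g' ⊚ f'); split; first exact: gen_comp g1 f1.
        by rewrite rp_comp1; apply: pk1_comp.
      + have [g [g1 g2]] := H _ _ _ hf x y eq_refl eq_refl.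
        by exists g; split=> //; apply: pk1_inj g2.
Qed.

Lemma rep_sub_has_image (K : TwoCat) (O : Type) (i : O -> K) (U : TwoCat) (R : Type) (v : R -> U)
  (r : Rep i v) (P : forall x y : O, hom (i x) (i y) -> Prop) Pid Pcomp
  (Q : forall s s' : R, hom (v s) (v s') -> Prop) :
  (forall x y (f : hom (v (r x)) (v (r y))), (exists g, P x y g /\ rp_hom r g = f) <-> Q _ _ f) ->
  @has_image U R v Q (@SubTwo K O i P Pid Pcomp) (rep_sub r Pid Pcomp).
Proof.
  move=> h x y f; rewrite -[Q _ _ f]h; split; first by move=> [[g hg] e]; exists g.
  by move=> [g [hg e]]; exists (exist _ g hg).
Qed.

(** * Tangent structures without chosen pullbacks *)

Section Core.
Context {K : TwoCat}.

(* A tangent structure up to the choice of the n-fold pullbacks: the addition is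
   only recorded as the relation u + v = w on generalized elements. *)
Record Core (E : Endo K) := {
  co_p : Hom (e_T E) (id1 (e_ob E));
  co_z : Hom (id1 (e_ob E)) (e_T E);
  co_l : Hom (e_T E) (e_T E ⊚ e_T E);
  co_c : Hom (e_T E ⊚ e_T E) (e_T E ⊚ e_T E);
  co_sum : forall S (u v w : Hom S (e_T E)), Prop;
  co_sum_pre : forall Y (F : hom Y (e_ob E)) S (u v w : Hom S (e_T E ⊚ F)), Prop }.

Definition core (t : TangentData K) : Core (t_endo t) :=
  {| co_p := t_p t : Hom (e_T (t_endo t)) (id1 (e_ob (t_endo t)));
     co_z := t_z t : Hom (id1 (e_ob (t_endo t))) (e_T (t_endo t));
     co_l := t_l t : Hom (e_T (t_endo t)) (e_T (t_endo t) ⊚ e_T (t_endo t));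
     co_c := t_c t : Hom (e_T (t_endo t) ⊚ e_T (t_endo t)) (e_T (t_endo t) ⊚ e_T (t_endo t));
     co_sum := fun S u v w => is_sum (t_bundle t) u v w;
     co_sum_pre := fun Y F S u v w => is_sum (map_bundle (pre F) (t_bundle t)) u v w |}.

(** Convertible to [lax2] on tangent data, and restated because a [Core] sits on a bare
    endomorphism. *)
Definition endo_lax2 {A B : Endo K} (F : Lax A B) :
  Hom (lx_F F ⊚ (e_T A ⊚ e_T A)) ((e_T B ⊚ e_T B) ⊚ lx_F F) :=
  asc (e_T B) (e_T B) (lx_F F) ∘ e_T B ◁ lx_a F
    ∘ asc' (e_T B) (lx_F F) (e_T A) ∘ lx_a F ▷ e_T A ∘ asc (lx_F F) (e_T A) (e_T A).

Definition endo_colax2 {A B : Endo K} (F : Colax A B) :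
  Hom ((e_T B ⊚ e_T B) ⊚ cx_F F) (cx_F F ⊚ (e_T A ⊚ e_T A)) :=
  asc' (cx_F F) (e_T A) (e_T A) ∘ cx_a F ▷ e_T A
    ∘ asc (e_T B) (cx_F F) (e_T A) ∘ e_T B ◁ cx_a F
    ∘ asc' (e_T B) (e_T B) (cx_F F).

(** Additivity takes the form of preservation of the relation u + v = w. The sums on the right are
    those of the bundle of the target whiskered by F, which is why [Core] also records
    [co_sum_pre]. *)
Record core_lax (E E' : Endo K) (r : Core E) (r' : Core E') (A : Lax E E') : Prop := {
  cl_p : co_p r' ▷ lx_F A ∘ lx_a A = idto (comp1_idrl (lx_F A)) ∘ lx_F A ◁ co_p r;
  cl_z : lx_a A ∘ lx_F A ◁ co_z r = co_z r' ▷ lx_F A ∘ idto (comp1_idrl (lx_F A));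
  cl_sum : forall S (u v w : Hom S (e_T E)), co_sum r u v w ->
    co_sum_pre r' (lx_a A ∘ lx_F A ◁ u) (lx_a A ∘ lx_F A ◁ v) (lx_a A ∘ lx_F A ◁ w);
  cl_l : endo_lax2 A ∘ lx_F A ◁ co_l r = co_l r' ▷ lx_F A ∘ lx_a A;
  cl_c : co_c r' ▷ lx_F A ∘ endo_lax2 A = endo_lax2 A ∘ lx_F A ◁ co_c r }.

Lemma is_lax_core (t t' : TangentData K) (A : Lax (t_endo t) (t_endo t')) :
  is_lax A <-> core_lax (core t) (core t') A.
Proof.
  split.
  - move=> [[/= hp hz [/= m [m1 [m2 m3]]]] hl hc]; split=> //= S u v w [n [/= n1 [n2 n3]]].
    exists (m ∘ lx_F A ◁ n) => /=; rewrite !comp_assoc m1 m2 m3 -!comp_assoc.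
    have E (x : Hom (t_n t 2) (t_T t)) : lx_F A ◁ x ∘ lx_F A ◁ n = lx_F A ◁ (x ∘ n).
      exact: eq_sym (fmap_comp (post (lx_F A)) x n).
    by rewrite !E n1 n2 n3.
  - move=> [/= hp hz hs hl hc]; split=> //; split=> //.
    (* The universal instance π₁ + π₂ = s, witnessed by the identity of T₂. *)
    apply: hs; exists (idm _); by rewrite !comp_idr.
Qed.

(** A sum in the bundle F T is a morphism into F T₂. To avoid naming T₂, [cc_sum] allows a morphism
    into F R for any R that carries a sum u' + v' = w' in T. For the same reason [cc_nfold] and
    [cc_vlift] range over all pointwise pullback cones instead of the chosen ones. *)
Record core_colax (E E' : Endo K) (r : Core E) (r' : Core E') (A : Colax E E') : Prop := {
  cc_p : cx_F A ◁ co_p r ∘ cx_a A =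
    idto (eq_sym (comp1_idrl (cx_F A))) ∘ co_p r' ▷ cx_F A;
  cc_z : cx_a A ∘ co_z r' ▷ cx_F A =
    cx_F A ◁ co_z r ∘ idto (eq_sym (comp1_idrl (cx_F A)));
  cc_sum : forall S (u v w : Hom S (e_T E')), co_sum r' u v w ->
    exists R (u' v' w' : Hom R (e_T E)) (m : Hom (S ⊚ cx_F A) (cx_F A ⊚ R)),
      co_sum r u' v' w' /\ cx_F A ◁ u' ∘ m = cx_a A ∘ u ▷ cx_F A /\
      cx_F A ◁ v' ∘ m = cx_a A ∘ v ▷ cx_F A /\ cx_F A ◁ w' ∘ m = cx_a A ∘ w ▷ cx_F A;
  cc_l : cx_F A ◁ co_l r ∘ cx_a A = endo_colax2 A ∘ co_l r' ▷ cx_F A;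
  cc_c : endo_colax2 A ∘ co_c r' ▷ cx_F A = cx_F A ◁ co_c r ∘ endo_colax2 A;
  cc_nfold : forall n S (b : Hom S (id1 (e_ob E)))
    (pr : Fin.t n -> Hom S (e_T E)),
    (forall X0 (f : hom X0 _), is_wide_pullback (co_p r ▷ f) (b ▷ f) (fun j => pr j ▷ f)) ->
    forall X0 (f : hom X0 _), is_wide_pullback ((cx_F A ◁ co_p r) ▷ f) ((cx_F A ◁ b) ▷ f)
      (fun j => (cx_F A ◁ pr j) ▷ f);
  cc_vlift : forall S (a : Hom S (e_T E ⊚ e_T E))
    (b : Hom S (id1 (e_ob E))),
    let Q := {| s_top := a; s_left := b;
                s_right := idto (comp1_idr (e_T E)) ∘ e_T E ◁ co_p r;
                s_bot := co_z r |} in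
    pointwise_pullback Q -> pointwise_pullback (map_square (post (cx_F A)) Q) }.
End Core.

Lemma pullback_unique {C : Category} (A B D P P' : C) (r : Hom A D) (b : Hom B D)
  (u : Hom P A) (v : Hom P B) (u' : Hom P' A) (v' : Hom P' B) :
  is_pullback {| s_top := u; s_left := v; s_right := r; s_bot := b |} ->
  is_pullback {| s_top := u'; s_left := v'; s_right := r; s_bot := b |} ->
  exists i : Hom P P', is_iso i /\ u' ∘ i = u /\ v' ∘ i = v.
Proof.
  move=> [/= h1 h2] [/= h1' h2'].
  case: (h2' P u v h1) => i [[i1 i2] iu]; case: (h2 P' u' v' h1') => k [[k1 k2] ku].
  exists i; split; last by split.
  exists k; split.
  - case: (h2 P u v h1) => w [_ wu].
    rewrite -(wu (k ∘ i)); first by rewrite /= !comp_assoc k1 k2.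
    by apply: wu; rewrite /= !comp_idr.
  - case: (h2' P' u' v' h1') => w [_ wu].
    rewrite -(wu (i ∘ k)); first by rewrite /= !comp_assoc i1 i2.
    by apply: wu; rewrite /= !comp_idr.
Qed.

Section CoreColax.
Context {K : TwoCat}.

Lemma idto_nat {C : Category} (x y x' y' : C) (ex : x = x') (ey : y = y')
  (f : Hom x y) (g : Hom x' y') : f ≡ g -> g ∘ idto ex = idto ey ∘ f.
Proof. by destruct ex, ey => /pk_inj ->; rewrite /= comp_idl comp_idr. Qed.

Lemma wide_pullback_id1 {X Y : K} (B E S : hom X Y) (q : Hom E B) J (b : Hom S B)
  (pr : J -> Hom S E) :
  is_wide_pullback (q ▷ id1 X) (b ▷ id1 X) (fun j => pr j ▷ id1 X) ->
  is_wide_pullback q b pr.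
Proof.
  have i (R : hom X Y) : is_iso (idto (comp1_idr R)) by apply: idto_iso.
  by apply: (wide_pullback_iso (i B) (i E) (i S)) => [||j]; apply: idto_nat; apply: hcomp_idr.
Qed.

Lemma pointwise_nfold_pre {X Y : K} (b : Bundle (hom X Y)) :
  (forall X0 (f : hom X0 X), nfold_pullbacks (map_bundle (pre f) b)) -> pointwise_nfold b.
Proof. by move=> h; split=> // n; apply: wide_pullback_id1; apply: (h X (id1 X) n). Qed.

Lemma is_sum_unique {C : Category} (b : Bundle C) (X : C) (u v w w' : Hom X (b_E b)) :
  nfold_pullbacks b -> is_sum b u v w -> is_sum b u v w' -> w = w'.
Proof.
  move=> h [m [m1 [m2 <-]]] [n [n1 [n2 <-]]].
  suff -> : m = n by [].
  apply: (wide_pullback_joint fst2 (h 2)) => j.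
  by case: (fin2 j) => ->; rewrite ?m1 ?m2 ?n1 ?n2.
Qed.

Lemma tangent_preserved1 (t : TangentData K) : is_tangent t ->
  pointwise_nfold (map_bundle (post (t_T t)) (t_bundle t)).
Proof.
  move=> ht; have E : iter1 1 (t_T t) = t_T t by apply: comp1_idr.
  by have := tg_preserved ht 1; rewrite E.
Qed.

Lemma is_vlift_unique (t : TangentData K) phi phi' : is_tangent t ->
  is_vlift t phi -> is_vlift t phi' -> phi = phi'.
Proof. by move=> ht; apply: is_sum_unique; apply: (proj1 (tangent_preserved1 ht)). Qed.

(** Any pointwise cone is isomorphic to the chosen one, and F carries this isomorphism along;
    conversely the chosen cones are instances of the quantified ones. *)
Lemma is_colax_core (t t' : TangentData K) (A : Colax (t_endo t) (t_endo t')) :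
  is_tangent t ->
  is_colax A <-> core_colax (core t) (core t') A.
Proof.
  move=> ht; split.
  - move=> [[/= hp hz [/= m [m1 [m2 m3]]]] hl hc hn hv]; split=> //.
    + move=> S u v w [n [/= n1 [n2 n3]]].
      (* One source serves for every u, v, w: the universal sum on T₂, reached through the pairing
         of u and v. *)
      exists (t_n t 2), (t_pr t fst2), (t_pr t snd2), (t_s t), (m ∘ n ▷ cx_F A).
      split; first by exists (idm _); rewrite !comp_idr.
      have E (x : Hom (t_n t' 2) (t_T t')) : x ▷ cx_F A ∘ n ▷ cx_F A = (x ∘ n) ▷ cx_F A.
        exact: eq_sym (fmap_comp (pre (cx_F A)) x n).
      by rewrite !comp_assoc m1 m2 m3 -!comp_assoc !E n1 n2 n3.
    + move=> n S b pr hS X0 f /=.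
      have hS' := wide_pullback_id1 (hS _ (id1 _)).
      have i (C : Category) (x : C) : is_iso (idm x) by exact: (idto_iso eq_refl).
      case: (wide_pullback_unique (i _ _) (i _ _) _ (proj1 (tg_pullbacks ht) n) hS').
        by rewrite comp_idl comp_idr.
      move=> k [hk [k1 k2]].
      apply: (wide_pullback_iso (i _ _) (i _ _) (iso_pre f (iso_post (cx_F A) hk)) _ _ _
               (proj2 hn _ f n)) => /=.
      * by rewrite comp_idl comp_idr.
      * rewrite comp_idl -(fmap_comp (pre f)) /= -(fmap_comp (post (cx_F A))) /= k1.
        by rewrite comp_idl.
      * move=> j; rewrite comp_idl -(fmap_comp (pre f)) /= -(fmap_comp (post (cx_F A))) /= k2.
        by rewrite comp_idl.
    + move=> S a b Q hQ.
      have [phi [h1 h2]] := tg_vlift ht.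
      have [k [hk [k1 k2]]] := pullback_unique (proj1 h2) (proj1 hQ).
      have [h3 h4] := hv _ h1.
      have i (C : Category) (x : C) : is_iso (idm x) by exact: (idto_iso eq_refl).
      have H := iso_post (cx_F A) hk.
      split=> [|X0 f].
      * apply: (@pullback_iso _ (map_square (post (cx_F A)) (vlift_square t phi))
          (map_square (post (cx_F A)) Q) (cx_F A ◁ k) (idm _) (idm _) (idm _)) => //=;
          rewrite ?comp_idl ?comp_idr // -(fmap_comp (post (cx_F A))) /= ?k1 ?k2 //.
      * apply: (@pullback_iso _ (map_square (pre f) (map_square (post (cx_F A)) (vlift_square t phi)))
          (map_square (pre f) (map_square (post (cx_F A)) Q)) ((cx_F A ◁ k) ▷ f) (idm _) (idm _) (idm _)) => //=;
          rewrite ?comp_idl ?comp_idr // -?(fmap_comp (pre f)) /= -?(fmap_comp (post (cx_F A))) /= ?k1 ?k2 //.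
        exact: iso_pre.
  - move=> [/= hp hz hs hl hc hn hv]; split=> //.
    + split=> //.
      have h0 : is_sum (t_bundle t') (t_pr t' fst2) (t_pr t' snd2) (t_s t').
        by exists (idm _); rewrite !comp_idr.
      have [R [u [v [w [m [[n [/= n1 [n2 n3]]] [m1 [m2 m3]]]]]]]] := hs _ _ _ _ h0.
      exists (cx_F A ◁ n ∘ m) => /=.
      have E (x : Hom (t_n t 2) (t_T t)) :
          cx_F A ◁ x ∘ (cx_F A ◁ n ∘ m) = cx_F A ◁ (x ∘ n) ∘ m.
        by rewrite comp_assoc -(fmap_comp (post (cx_F A))).
      by rewrite !E n1 n2 n3.
    + apply: pointwise_nfold_pre => X0 f n; apply: hn.
      move=> X1 g; exact: (proj2 (tg_pullbacks ht) _ g n).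
    (* Preservation is asked for every [phi] with [is_vlift]; since T preserves T₂ there is only
       one, and [cc_vlift] applies to it. *)
    + move=> phi hphi; have [phi' [h1 h2]] := tg_vlift ht.
      by rewrite (is_vlift_unique ht hphi h1); apply: hv.
Qed.
End CoreColax.

(** * Pointwise limits in Cat *)

Section Limits.
Context {C : Category}.

(* Common generalization of [is_wide_pullback] and [is_pullback] (J = bool). *)
Definition is_limit {J : Type} {E : J -> C} {B P : C} (q : forall j, Hom (E j) B)
  (b : Hom P B) (pr : forall j, Hom P (E j)) : Prop :=
  (forall j, q j ∘ pr j = b) /\
  forall (X : C) (c : Hom X B) (u : forall j, Hom X (E j)), (forall j, q j ∘ u j = c) ->
    exists! m : Hom X P, b ∘ m = c /\ forall j, pr j ∘ m = u j.

Definition sq_ob (S : Square C) (j : bool) : C := if j then s_A S else s_B S.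
Definition sq_q (S : Square C) (j : bool) : Hom (sq_ob S j) (s_C S) :=
  match j with true => s_right S | false => s_bot S end.
Definition sq_pr (S : Square C) (j : bool) : Hom (s_P S) (sq_ob S j) :=
  match j with true => s_top S | false => s_left S end.

Lemma pullback_limit (S : Square C) :
  is_pullback S <-> is_limit (sq_q S) (s_right S ∘ s_top S) (sq_pr S).
Proof.
  split.
  - move=> [h1 h2]; split; first by case=> //=; rewrite h1.
    move=> X c u hu.
    case: (h2 X (u true) (u false)) => [|m [[m1 m2] mu]].
      by rewrite (hu true) (hu false).
    exists m; split; first split.
    + by rewrite -comp_assoc m1 (hu true).
    + by case.
    + by move=> m' [_ h]; apply: mu; split; [apply: (h true)|apply: (h false)].
  - move=> [h1 h2]; split; first by rewrite -(h1 false).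
    move=> X u v e.
    case: (h2 X (s_right S ∘ u) (fun j => match j return Hom X (sq_ob S j) with
      true => u | false => v end)) => [|m [[m0 m1] mu]]; first by case.
    exists m; split; first by split; [exact: (m1 true)|exact: (m1 false)].
    move=> m' [e1 e2]; apply: mu; split; first by rewrite -comp_assoc e1.
    by case.
Qed.

Lemma limit_joint {J : Type} {E : J -> C} {B P X : C} (q : forall j, Hom (E j) B)
  (b : Hom P B) (pr : forall j, Hom P (E j)) (f g : Hom X P) :
  is_limit q b pr -> b ∘ f = b ∘ g -> (forall j, pr j ∘ f = pr j ∘ g) -> f = g.
Proof.
  move=> [h1 h2] eb e.
  case: (h2 X (b ∘ g) (fun j => pr j ∘ g)) => [j|m [_ mu]].
    by rewrite comp_assoc h1.
  by rewrite -(mu f) ?(mu g).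
Qed.

(** Joint monicity for arrows whose end points agree only propositionally, as for the two whiskered
    cells in [square_comm]. *)
Lemma limit_joint_pk {J : Type} {E : J -> C} {B P : C} (q : forall j, Hom (E j) B)
  (b : Hom P B) (pr : forall j, Hom P (E j)) (f g : Arrow C) :
  is_limit q b pr -> src f = src g -> tgt f = P -> tgt g = P ->
  vc (pk b) f = vc (pk b) g -> (forall j, vc (pk (pr j)) f = vc (pk (pr j)) g) -> f = g.
Proof.
  case: f g => X P' f [X' P'' g] h /= e1 e2 e3; subst X' P' P''; rewrite -!pk_comp => eb e.
  congr pk; apply: (limit_joint h); first exact: pk_inj.
  by move=> j; move: (e j); rewrite -!pk_comp => /pk_inj.
Qed.
End Limits.

Lemma limit_eq {C : Category} {J : Type} {E : J -> C} {B P : C} (q q' : forall j, Hom (E j) B)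
  (b b' : Hom P B) (pr pr' : forall j, Hom P (E j)) :
  (forall j, q j = q' j) -> b = b' -> (forall j, pr j = pr' j) ->
  is_limit q b pr -> is_limit q' b' pr'.
Proof.
  move=> eq eb ep.
  have -> : q' = q by apply: functional_extensionality_dep.
  have -> : pr' = pr by apply: functional_extensionality_dep.
  by rewrite eb.
Qed.

(** The left adjoint is encoded by universal arrows, one for each Z, so that no functor and no
    triangle identities have to be supplied. *)
Definition right_adjoint {C D : Category} (G : Functor C D) : Prop :=
  forall Z : D, exists (L : C) (eta : Hom Z (G L)),
    forall (Y : C) (u : Hom Z (G Y)), exists! v : Hom L Y, fmap G v ∘ eta = u.

Lemma right_adjoint_limit {C D : Category} (G : Functor C D) {J : Type} {E : J -> C}
  {B P : C} (q : forall j, Hom (E j) B) (b : Hom P B) (pr : forall j, Hom P (E j)) :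
  right_adjoint G -> is_limit q b pr ->
  is_limit (fun j => fmap G (q j)) (fmap G b) (fun j => fmap G (pr j)).
Proof.
  move=> hG [h1 h2]; split; first by move=> j; rewrite -fmap_comp h1.
  move=> Z c u hu; have [L [eta hL]] := hG Z.
  have inj Y (v w : Hom L Y) : fmap G v ∘ eta = fmap G w ∘ eta -> v = w.
    by move=> e; have [x [_ hx]] := hL _ (fmap G w ∘ eta); rewrite -(hx v) ?(hx w).
  have [c' [hc _]] := hL _ c.
  pose u' j := constructive_indefinite_description _ (hL _ (u j)).
  have hu' j : fmap G (proj1_sig (u' j)) ∘ eta = u j by case: (proj2_sig (u' j)).
  case: (h2 L c' (fun j => proj1_sig (u' j))) => [j|m [[m1 m2] mu]].
    by apply: inj; rewrite fmap_comp -comp_assoc hu' hu hc.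
  exists (fmap G m ∘ eta); split; first split.
  - by rewrite comp_assoc -fmap_comp m1.
  - by move=> j; rewrite comp_assoc -fmap_comp m2 hu'.
  - move=> n [n1 n2]; have [n' [hn _]] := hL _ n.
    rewrite -hn (mu n') //; split.
      by apply: inj; rewrite fmap_comp -comp_assoc hn n1 hc.
    by move=> j; apply: inj; rewrite fmap_comp -comp_assoc hn n2 hu'.
Qed.

Lemma funcat_limit {C D : Category} {J : Type} {E : J -> FunCat C D} {B P : FunCat C D}
  (q : forall j, Hom (E j) B) (b : Hom P B) (pr : forall j, Hom P (E j)) :
  (forall x, is_limit (fun j => nt (q j) x) (nt b x) (fun j => nt (pr j) x)) ->
  is_limit q b pr.
Proof.
  move=> h; split.
    by move=> j; apply: nt_eq => x; exact: (proj1 (h x) j).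
  move=> X c u hu.
  have hu' x j : nt (q j) x ∘ nt (u j) x = nt c x by rewrite -(hu j).
  pose m x := constructive_indefinite_description _ (proj2 (h x) _ _ _ (hu' x)).
  have m1 x : nt b x ∘ proj1_sig (m x) = nt c x by case: (proj2_sig (m x)) => -[].
  have m2 x j : nt (pr j) x ∘ proj1_sig (m x) = nt (u j) x by case: (proj2_sig (m x)) => -[].
  have hm x y (f : Hom x y) : proj1_sig (m y) ∘ fmap X f = fmap P f ∘ proj1_sig (m x).
    apply: (limit_joint (h y)) => [|j]; rewrite !comp_assoc.
      by rewrite m1 !nt_nat -comp_assoc m1.
    by rewrite m2 !nt_nat -comp_assoc m2.
  exists (@Build_NatTrans _ _ X P (fun x => proj1_sig (m x)) hm); split; first split.
  - exact: nt_eq.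
  - by move=> j; apply: nt_eq => x; apply: m2.
  - move=> m' [e1 e2]; apply: nt_eq => x /=.
    apply: (limit_joint (h x)) => [|j]; first by rewrite m1 -e1.
    by rewrite m2 -e2.
Qed.

(* [Chaotic unit] is the terminal category, [Chaotic Empty_set] the initial one. *)
Definition Chaotic (T : Type) : Category.
Proof.
  by unshelve refine {| Ob := T; Hom := fun _ _ => unit; idm := fun _ => tt;
                        comp := fun _ _ _ _ _ => tt |} => // x y [].
Defined.

Definition const_functor (C D : Category) (Z : D) : Functor C D.
Proof.
  unshelve refine {| fob := fun _ => Z; fmap := fun _ _ _ => idm Z |} => //.
  by move=> *; rewrite comp_idl.
Defined.

Definition evaluation (C D : Category) (x : C) : Functor (FunCat C D) D.
Proof.
  by unshelve refine {| fob := fun F : FunCat C D => (F : Functor C D) x;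
                        fmap := fun F G (a : Hom F G) => nt a x |}.
Defined.

Lemma chaotic_fmap (T : Type) (D : Category) (F : Functor (Chaotic T) D) (x : Chaotic T)
  (f : Hom x x) : fmap F f = idm (F x).
Proof. by case: f; rewrite -fmap_id. Qed.

Definition point_nt (D : Category) (Z : D) (G : Functor (Chaotic unit) D) (u : Hom Z (G tt)) :
  NatTrans (const_functor (Chaotic unit) Z) G.
Proof.
  unshelve refine (@Build_NatTrans _ _ (const_functor (Chaotic unit) Z) G
    (fun x : Chaotic unit => match x as y return Hom Z (G y) with tt => u end) _).
  by move=> [] [] f /=; rewrite comp_idr chaotic_fmap comp_idl.
Defined.

Lemma evaluation_right_adjoint (D : Category) :
  right_adjoint (evaluation (C := Chaotic unit) D tt).
Proof.
  move=> Z; exists (const_functor _ Z), (idm Z) => G u.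
  exists (point_nt u); split; first by rewrite /= comp_idr.
  by move=> v <-; apply: nt_eq => -[] /=; rewrite comp_idr.
Qed.

(** The families [fun j => fmap F (sq_q S j)] and [sq_q (map_square F S)] have types that agree only
    after case analysis on j; hence the two limit conditions are matched leg by leg. *)
Lemma map_pullback_limit {C D : Category} (F : Functor C D) (S : Square C) :
  is_pullback (map_square F S) <->
  is_limit (fun j => fmap F (sq_q S j)) (fmap F (s_right S ∘ s_top S))
    (fun j => fmap F (sq_pr S j)).
Proof.
  rewrite pullback_limit.
  have ec : s_right (map_square F S) ∘ s_top (map_square F S) =
            fmap F (s_right S ∘ s_top S) := eq_sym (fmap_comp F (s_right S) (s_top S)).
  split=> -[h1 h2]; split.
  - by move=> j; rewrite -ec -(h1 j); case: j.
  - move=> Z c u hu.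
    case: (h2 Z c (fun j => match j return Hom Z (sq_ob (map_square F S) j) with
      true => u true | false => u false end)) => [|m [[m1 m2] mu]].
      by case; [exact: (hu true)|exact: (hu false)].
    exists m; split; first split.
    + by rewrite -ec.
    + by case; [exact: (m2 true)|exact: (m2 false)].
    + move=> m' [n1 n2]; apply: mu; split; first by rewrite ec.
      by case; [exact: (n2 true)|exact: (n2 false)].
  - by case; rewrite [RHS]ec; [exact: (h1 true)|exact: (h1 false)].
  - move=> Z c u hu.
    case: (h2 Z c (fun j => match j return Hom Z (F (sq_ob S j)) with
      true => u true | false => u false end)) => [|m [[m1 m2] mu]].
      by case; [exact: (hu true)|exact: (hu false)].
    exists m; split; first split.
    + by rewrite ec.
    + by case; [exact: (m2 true)|exact: (m2 false)].
    + move=> m' [n1 n2]; apply: mu; split; first by rewrite -ec.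
      by case; [exact: (n2 true)|exact: (n2 false)].
Qed.

Section Pointwise.
Context {K : TwoCat} {X Y : K}.

Definition pointwise_limit {J : Type} {E : J -> hom X Y} {B P : hom X Y}
  (q : forall j, Hom (E j) B) (b : Hom P B) (pr : forall j, Hom P (E j)) : Prop :=
  is_limit q b pr /\
  forall (X0 : K) (f : hom X0 X), is_limit (fun j => q j ▷ f) (b ▷ f) (fun j => pr j ▷ f).

Lemma pointwise_nfold_limit (b : Bundle (hom X Y)) :
  pointwise_nfold b <->
  forall n, pointwise_limit (fun _ => b_q b) (b_b b n) (@b_pr _ b n).
Proof.
  split; first by move=> [h1 h2] n; split; [exact: h1|move=> X0 f; exact: (h2 _ f n)].
  by move=> h; split=> [n|X0 f n]; [exact: proj1 (h n)|exact: (proj2 (h n) _ f)].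
Qed.

Lemma pointwise_map_pullback {C : Category} (F : Functor C (hom X Y)) (S : Square C) :
  pointwise_pullback (map_square F S) <->
  pointwise_limit (fun j => fmap F (sq_q S j)) (fmap F (s_right S ∘ s_top S))
    (fun j => fmap F (sq_pr S j)).
Proof.
  have e X0 (f : hom X0 X) := map_pullback_limit (functor_comp (pre f) F) S.
  split=> -[h1 h2]; split.
  - exact: (proj1 (map_pullback_limit F S) h1).
  - by move=> X0 f; apply/e; apply: h2.
  - exact: (proj2 (map_pullback_limit F S) h1).
  - by move=> X0 f; apply/(e X0 f); apply: h2.
Qed.

Lemma pointwise_pullback_limit (S : Square (hom X Y)) :
  pointwise_pullback S <-> pointwise_limit (sq_q S) (s_right S ∘ s_top S) (sq_pr S).
Proof.
  have e : map_square (functor_id _) S = S by case: S.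
  by rewrite -[in X in X <-> _]e; apply: (pointwise_map_pullback (functor_id _)).
Qed.
End Pointwise.

(** An object x of C is a functor from the terminal category. Precomposing with it and evaluating at
    the unique object computes values at x; the pointwise clause covers the first step and right
    adjointness of evaluation the second. *)
Lemma cat_pointwise_limit {C D : Category} {J : Type} {E : J -> @hom Cat C D}
  {B P : @hom Cat C D} (q : forall j, Hom (E j) B) (b : Hom P B)
  (pr : forall j, Hom P (E j)) :
  pointwise_limit q b pr <->
  forall x, is_limit (fun j => nt (q j) x) (nt b x) (fun j => nt (pr j) x).
Proof.
  split.
  - move=> [_ h] x.
    have := right_adjoint_limit (@evaluation_right_adjoint D)
      (h _ (const_functor (Chaotic unit) x)).
    by apply: limit_eq => [j||j] /=; rewrite fmap_id comp_idr.
  - move=> h; split=> [|C0 F]; first exact: funcat_limit.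
    apply: funcat_limit => x; have := h ((F : Functor _ _) x).
    by apply: limit_eq => [j||j] /=; rewrite fmap_id comp_idr.
Qed.

(** * Pointwise limits in Fib *)

Section Cartesian.
Context {X' X : Category} (P : Functor X' X).

Lemma iso_cartesian {E0 E1 : X'} (phi : Hom E0 E1) : is_iso phi -> is_cartesian P phi.
Proof.
  move=> [g [g1 g2]] E psi h e; exists (g ∘ psi); split.
    split; last by rewrite comp_assoc g2 comp_idl.
    by rewrite fmap_comp -e comp_assoc -fmap_comp g1 fmap_id comp_idl.
  by move=> xi [_ <-]; rewrite comp_assoc g1 comp_idl.
Qed.

Lemma cartesian_comp {E0 E1 E2 : X'} (psi : Hom E1 E2) (phi : Hom E0 E1) :
  is_cartesian P psi -> is_cartesian P phi -> is_cartesian P (psi ∘ phi).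
Proof.
  move=> hpsi hphi E chi h; rewrite fmap_comp -comp_assoc => e.
  have [u [[u1 u2] uu]] := hpsi _ _ _ e.
  have [v [[v1 v2] vu]] := hphi _ u h (eq_sym u1).
  exists v; split; first by rewrite -comp_assoc v2.
  move=> w [w1 w2]; apply: vu; split=> //; apply: eq_sym; apply: uu.
  by rewrite fmap_comp w1 comp_assoc.
Qed.

Lemma cartesian_over_iso {E0 E1 : X'} (phi : Hom E0 E1) :
  is_cartesian P phi -> is_iso (fmap P phi) -> is_iso phi.
Proof.
  move=> hphi [g [g1 g2]].
  case: (hphi _ (idm E1) g) => [|xi [[x1 x2] _]]; first by rewrite g2 fmap_id.
  exists xi; split=> //.
  case: (hphi _ phi (idm _)) => [|u [_ uu]]; first by rewrite comp_idr.
  rewrite -(uu (xi ∘ phi)); last by apply: uu; rewrite fmap_id comp_idr.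
  by rewrite fmap_comp x1 g1 comp_assoc x2 comp_idl.
Qed.

Lemma cartesian_lift {E0 E1 : X'} (phi : Hom E0 E1) : is_cartesian P phi ->
  forall (E : X') (psi : Hom E E1) (a : Arrow X), src a = P E -> tgt a = P E0 ->
  vc (pk (fmap P phi)) a = pk (fmap P psi) ->
  exists! xi : Hom E E0, pk (fmap P xi) = a /\ phi ∘ xi = psi.
Proof.
  move=> h E psi [A B a] /= e1 e2; subst A B; rewrite -pk_comp => e.
  have [xi [[x1 x2] xu]] := h E psi a (pk_inj e).
  exists xi; split; first by rewrite x1.
  by move=> y [/pk_inj y1 y2]; apply: xu.
Qed.

Lemma cartesian_joint {E0 E1 E : X'} (phi : Hom E0 E1) (f g : Hom E E0) :
  is_cartesian P phi -> fmap P f = fmap P g -> phi ∘ f = phi ∘ g -> f = g.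
Proof.
  move=> h e1 e2; case: (h E (phi ∘ g) (fmap P g)) => [|u [_ uu]]; first by rewrite fmap_comp.
  by rewrite -(uu f) ?(uu g).
Qed.

Lemma cartesian_unique {E0 E0' E1 : X'} (phi : Hom E0 E1) (phi' : Hom E0' E1) :
  is_cartesian P phi -> is_cartesian P phi' -> fmap P phi ≡ fmap P phi' ->
  exists k : Hom E0 E0', is_vertical P k /\ phi' ∘ k = phi /\ is_iso k.
Proof.
  move=> h h' e; have e0 : P E0 = P E0' := f_equal (@src _) e.
  case: (cartesian_lift h' (psi := phi) (a := pid (P E0))) => [||| k [[k1 k2] _]] //.
    by rewrite -e vc_idr.
  case: (cartesian_lift h (psi := phi') (a := pid (P E0'))) => [||| j [[j1 j2] _]] //.
    by rewrite e vc_idr.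
  exists k; split; [by exists (P E0)|split=> //].
  exists j; split.
  - apply: (cartesian_joint h); last by rewrite comp_assoc j2 k2 comp_idr.
    by apply: pk_inj; rewrite fmap_id fmap_comp pk_comp j1 k1 vc_idl.
  - apply: (cartesian_joint h'); last by rewrite comp_assoc k2 j2 comp_idr.
    by apply: pk_inj; rewrite fmap_id fmap_comp pk_comp j1 k1 vc_idl.
Qed.
End Cartesian.

Section Preservation.
Context {X1' X1 X2' X2 : Category} {P1 : Functor X1' X1} {P2 : Functor X2' X2}.
Context (c1 : Cleavage P1) (c2 : Cleavage P2) (F : Functor X1 X2) (F' : Functor X1' X2').
Context (comm : functor_comp P2 F' = functor_comp F P1).

Lemma comm_pk (x y : X1') (f : Hom x y) : fmap P2 (fmap F' f) ≡ fmap F (fmap P1 f).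
Proof. exact: (f_equal (fun H : Functor X1' X2 => pk (fmap H f)) comm). Qed.

(** The comparison with the lift chosen by [c2] is an isomorphism exactly when the image of the lift
    is cartesian. The second form speaks of cartesian morphisms only, which makes it stable under
    composition with isomorphisms and under limits. *)
Lemma preserves_cleavage_iff : preserves_cleavage c1 c2 F F' <->
  forall (A : X1) (E' : X1') (f : Hom A (P1 E')), is_cartesian P2 (fmap F' (cl_map c1 f)).
Proof.
  have over (A : X1) (E' : X1') (f : Hom A (P1 E')) :
    fmap P2 (fmap F' (cl_map c1 f)) ≡ fmap F f.
    by rewrite comm_pk; apply: fmap_pk; apply: cl_over.
  split=> h A E' f.
  - have eo : F (P1 E') = P2 (F' E') := f_equal (fun H : Functor X1' X2 => H E') (eq_sym comm).
    have e1 : idto eo ∘ fmap F f ≡ fmap F f by rewrite pk_comp pk_idto vc_idl.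
    have [k [k1 [<- k3]]] := h A E' f _ e1.
    by apply: cartesian_comp; [apply: cl_cart|apply: iso_cartesian].
  - move=> g e; apply: cartesian_unique; [exact: h|exact: cl_cart|].
    by rewrite over cl_over e.
Qed.
End Preservation.

Section SquareLimits.
Context {K : TwoCat} {P R : Mor1 K} {J : Type} {E : J -> SqCat P R} {B N : SqCat P R}.
Context (q : forall j, Hom (E j) B) (b : Hom N B) (pr : forall j, Hom N (E j)).

(** Both sides are cells into the base vertex whiskered by P. The base limit is pointwise, hence
    survives this whiskering, so the cells can be compared on its legs. There [sc_comm] of [b] and
    [pr j] reduces the claim to [sc_comm] of the given cone. *)
Lemma square_comm {X : SqCat P R} (c : Hom X B) (u : forall j, Hom X (E j)) m' m :
  pointwise_limit (fun j => sc_cod (q j)) (sc_cod b) (fun j => sc_cod (pr j)) ->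
  sc_dom b ∘ m' = sc_dom c -> sc_cod b ∘ m = sc_cod c ->
  (forall j, sc_dom (pr j) ∘ m' = sc_dom (u j)) ->
  (forall j, sc_cod (pr j) ∘ m = sc_cod (u j)) ->
  m_arr R ◁ m' ≡ m ▷ m_arr P.
Proof.
  move=> hw eb' eb e' e.
  have H (Y : SqCat P R) (f : Hom N Y) (g : Hom X Y) :
      sc_dom f ∘ m' = sc_dom g -> sc_cod f ∘ m = sc_cod g ->
      vc (pk (sc_cod f ▷ m_arr P)) (pk (m_arr R ◁ m')) =
      vc (pk (sc_cod f ▷ m_arr P)) (pk (m ▷ m_arr P)).
    move=> h' h; rewrite -[in LHS](sc_comm f) -!pk_comp.
    rewrite -(fmap_comp (post (m_arr R)) (sc_dom f) m' : _ = _ ∘ _).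
    by rewrite -(fmap_comp (pre (m_arr P)) (sc_cod f) m : _ = _ ∘ _) /= h' h sc_comm.
  apply: (limit_joint_pk (proj2 hw _ (m_arr P))) => [|||| j] /=; try exact: sq_comm.
    by [].
    exact: (H _ b c).
  exact: (H _ (pr j) (u j)).
Qed.

Lemma square_limit :
  is_limit (fun j => sc_dom (q j)) (sc_dom b) (fun j => sc_dom (pr j)) ->
  pointwise_limit (fun j => sc_cod (q j)) (sc_cod b) (fun j => sc_cod (pr j)) ->
  is_limit q b pr.
Proof.
  move=> h' h; split.
    by move=> j; apply: SqCell_eq; [exact: (proj1 h' j)|exact: (proj1 (proj1 h) j)].
  move=> X c u hu.
  have hu' j : sc_dom (q j) ∘ sc_dom (u j) = sc_dom c by rewrite -(hu j).
  have hu1 j : sc_cod (q j) ∘ sc_cod (u j) = sc_cod c by rewrite -(hu j).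
  have [m' [[m1' m2'] mu']] := proj2 h' _ _ _ hu'.
  have [m [[m1 m2] mu]] := proj2 (proj1 h) _ _ _ hu1.
  have hm := square_comm h m1' m1 m2' m2.
  exists (@Build_SqCell _ _ _ X N m' m hm); split; first split.
  - exact: SqCell_eq.
  - by move=> j; apply: SqCell_eq; [exact: m2'|exact: m2].
  - move=> n [n1 n2]; apply: SqCell_eq => /=.
      apply: mu'; split; first by rewrite -n1.
      by move=> j; rewrite -n2.
    apply: mu; split; first by rewrite -n1.
    by move=> j; rewrite -n2.
Qed.
End SquareLimits.

Definition fib_domF (P R : Fibration) : Functor (@hom Fib P R) (@hom Cat (f_tot P) (f_tot R)).
Proof.
  by unshelve refine {| fob := fun F : @hom Fib P R => sq_dom (proj1_sig F);
                        fmap := fun F G (a : Hom F G) => sc_dom a |}.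
Defined.

Definition fib_codF (P R : Fibration) : Functor (@hom Fib P R) (@hom Cat (f_base P) (f_base R)).
Proof.
  by unshelve refine {| fob := fun F : @hom Fib P R => sq_cod (proj1_sig F);
                        fmap := fun F G (a : Hom F G) => sc_cod a |}.
Defined.

Definition chaotic_fibration (T : Type) : Fibration.
Proof.
  unshelve refine {| f_tot := Chaotic T; f_base := Chaotic unit;
    f_fun := const_functor (D := Chaotic unit) (Chaotic T) tt |}.
  unshelve refine (@Build_Cleavage (Chaotic T) (Chaotic unit) _ (fun A E' _ => E')
    (fun A E' _ => tt) _ _).
  - by move=> [] E' [].
  - move=> [] E' [] E [] [] _; exists tt; split=> //.
    by move=> [].
Defined.

Definition chaotic_mor (T : Type) (P : Fibration) (F' : Functor (Chaotic T) (f_tot P))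
  (A : f_base P)
  (comm : functor_comp (f_fun P) F' =
    functor_comp (const_functor (Chaotic unit) A) (f_fun (chaotic_fibration T))) :
  @hom Fib (chaotic_fibration T) P.
Proof.
  exists (@Build_Sq Cat (f_mor1 (chaotic_fibration T)) (f_mor1 P) F'
    (const_functor (Chaotic unit) A) comm).
  apply/(preserves_cleavage_iff _ _ comm) => A0 E' f; apply: iso_cartesian.
  by rewrite /= chaotic_fmap; apply: (idto_iso eq_refl).
Defined.

Definition point_mor (P : Fibration) (x : f_tot P) : @hom Fib (chaotic_fibration unit) P.
Proof.
  apply: (@chaotic_mor unit P (const_functor _ x) (f_fun P x)).
  by apply: functor_eq => //= y z f; rewrite fmap_id.
Defined.

Definition empty_functor (D : Category) : Functor (Chaotic Empty_set) D.
Proof.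
  by unshelve refine {| fob := fun x : Chaotic Empty_set => match x with end;
    fmap := fun x => match x with end |}; case.
Defined.

(* Out of the fibration 0 -> 1, every object of the base is hit without choosing an
   object over it. *)
Definition base_mor (P : Fibration) (A : f_base P) : @hom Fib (chaotic_fibration Empty_set) P.
Proof.
  by apply: (@chaotic_mor Empty_set P (empty_functor _) A); apply: functor_eq; case.
Defined.

Definition dom_at (P : Fibration) : Functor (@hom Fib (chaotic_fibration unit) P) (f_tot P) :=
  functor_comp (evaluation (C := Chaotic unit) (f_tot P) tt)
    (fib_domF (chaotic_fibration unit) P).
Definition cod_at (P : Fibration) :
  Functor (@hom Fib (chaotic_fibration Empty_set) P) (f_base P) :=
  functor_comp (evaluation (C := Chaotic unit) (f_base P) tt)
    (fib_codF (chaotic_fibration Empty_set) P).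

(** A 2-cell out of the point at Z amounts to its total component u : Z → G: the base component has
    to be the image of u under the projection, corrected by the identity [e] that expresses that G
    is a commuting square. *)
Lemma dom_at_right_adjoint (P : Fibration) : right_adjoint (dom_at P).
Proof.
  move=> Z; exists (point_mor Z), (idm Z) => -[G hG] u.
  have e : f_fun P (sq_dom G tt) = sq_cod G tt.
    exact: (f_equal (fun H : Functor (Chaotic unit) (f_base P) => fob H tt) (sq_comm G)).
  have comm : @hcomp Cat _ _ _ _ _ _ _ (idm (f_fun P : @hom Cat _ _)) (point_nt u) ≡
     @hcomp Cat _ _ _ _ _ _ _
      (@point_nt _ (f_fun P Z) (sq_cod G) (idto e ∘ fmap (f_fun P) u) : @Hom (@hom Cat _ _) _ _)
      (idm (f_fun (chaotic_fibration unit) : @hom Cat _ _)).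
    apply: nt_pk_eq.
        exact: (sq_comm (proj1_sig (point_mor Z))).
      exact: (sq_comm G).
      move=> [] /=; rewrite comp_idl comp_idr pk_comp pk_idto.
      by rewrite vc_idl.
  exists (@Build_SqCell Cat _ _ (proj1_sig (point_mor Z)) G (point_nt u) (point_nt (idto e ∘ fmap (f_fun P) u)) comm).
  split; first by rewrite /= comp_idr.
  move=> v ev; have {}ev : nt (sc_dom v) tt = u by rewrite -ev /= comp_idr.
  apply: SqCell_eq; apply: nt_eq => -[] /=; first by rewrite ev.
  apply: pk_inj; rewrite pk_comp pk_idto vc_idl // -ev.
  have := f_equal (fun a : Arrow (FunCat (Chaotic unit) (f_base P)) => pk (nt (arr a) tt)) (sc_comm v).
  by rewrite /= comp_idl comp_idr.
Qed.

(** Out of 0 → 1 the total component of a 2-cell is a transformation on the empty category, so the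
    base component is free. *)
Lemma cod_at_right_adjoint (P : Fibration) : right_adjoint (cod_at P).
Proof.
  move=> Z; exists (base_mor Z), (idm Z) => -[G hG] u.
  unshelve refine (let d : NatTrans (empty_functor (f_tot P)) (sq_dom G) := _ in _).
    by unshelve refine (@Build_NatTrans _ _ (empty_functor (f_tot P)) (sq_dom G)
      (fun x : Chaotic Empty_set => match x with end) _); case.
  have comm : @hcomp Cat _ _ _ _ _ _ _ (idm (f_fun P : @hom Cat _ _)) d ≡
     @hcomp Cat _ _ _ _ _ _ _
      (@point_nt _ Z (sq_cod G) u : @Hom (@hom Cat _ _) _ _)
      (idm (f_fun (chaotic_fibration Empty_set) : @hom Cat _ _)).
    apply: nt_pk_eq; last by case.
      exact: (sq_comm (proj1_sig (base_mor Z))).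
    exact: (sq_comm G).
  exists (@Build_SqCell Cat _ _ (proj1_sig (base_mor Z)) G d (point_nt u) comm).
  split; first by rewrite /= comp_idr.
  move=> v ev; have {}ev : nt (sc_cod v) tt = u by rewrite -ev /= comp_idr.
  by apply: SqCell_eq; apply: nt_eq => -[] /=; rewrite ev.
Qed.

Lemma fullsub_limit {C : Category} (S : C -> Prop) {J : Type} {E : J -> FullSub S}
  {B N : FullSub S} (q : forall j, Hom (E j) B) (b : Hom N B) (pr : forall j, Hom N (E j)) :
  @is_limit C J (fun j => proj1_sig (E j)) (proj1_sig B) (proj1_sig N) q b pr ->
  is_limit q b pr.
Proof. by move=> [h1 h2]; split=> // X; apply: (h2 (proj1_sig X)). Qed.

Lemma fib_limit {P R : Fibration} {J : Type} {E : J -> @hom Fib P R}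
  {B N : @hom Fib P R} (q : forall j, Hom (E j) B) (b : Hom N B)
  (pr : forall j, Hom N (E j)) :
  is_limit (fun j => fmap (fib_domF P R) (q j)) (fmap (fib_domF P R) b)
    (fun j => fmap (fib_domF P R) (pr j)) ->
  pointwise_limit (fun j => fmap (fib_codF P R) (q j)) (fmap (fib_codF P R) b)
    (fun j => fmap (fib_codF P R) (pr j)) ->
  is_limit q b pr.
Proof.
  move=> h1 h2; apply: fullsub_limit.
  exact: (@square_limit Cat (f_mor1 P) (f_mor1 R) J (fun j => proj1_sig (E j))
    (proj1_sig B) (proj1_sig N) _ _ _ h1 h2).
Qed.

(** For the converse both components are rechecked objectwise after whiskering with f. The base one
    is rebuilt as a pointwise limit, since [square_comm] whiskers it once more by a projection. *)
Lemma fib_pointwise_limit {P R : Fibration} {J : Type} {E : J -> @hom Fib P R}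
  {B N : @hom Fib P R} (q : forall j, Hom (E j) B) (b : Hom N B)
  (pr : forall j, Hom N (E j)) :
  pointwise_limit q b pr <->
  pointwise_limit (fun j => fmap (fib_domF P R) (q j)) (fmap (fib_domF P R) b)
    (fun j => fmap (fib_domF P R) (pr j)) /\
  pointwise_limit (fun j => fmap (fib_codF P R) (q j)) (fmap (fib_codF P R) b)
    (fun j => fmap (fib_codF P R) (pr j)).
Proof.
  split.
  - move=> [_ h]; split; apply/cat_pointwise_limit => x.
      have := right_adjoint_limit (@dom_at_right_adjoint R) (h _ (point_mor x)).
      by apply: limit_eq => [j||j] /=; rewrite fmap_id comp_idr.
    have := right_adjoint_limit (@cod_at_right_adjoint R) (h _ (base_mor x)).
    by apply: limit_eq => [j||j] /=; rewrite fmap_id comp_idr.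
  - move=> [h1 h2]; split=> [|X0 f]; first exact: fib_limit (proj1 h1) h2.
    apply: (@fib_limit X0 R J (fun j => E j ⊚ f) (B ⊚ f) (N ⊚ f)).
      apply: funcat_limit => x; have /cat_pointwise_limit h := h1.
      have := h ((sq_dom (proj1_sig f) : Functor _ _) x).
      by apply: limit_eq => [j||j] /=; rewrite fmap_id comp_idr.
    apply/cat_pointwise_limit => x; have /cat_pointwise_limit h := h2.
    have := h ((sq_cod (proj1_sig f) : Functor _ _) x).
    by apply: limit_eq => [j||j] /=; rewrite fmap_id comp_idr.
Qed.

Lemma is_sum_fmap {C D : Category} (F : Functor C D) (b : Bundle C) (X : C)
  (u v w : Hom X (b_E b)) :
  is_sum b u v w -> is_sum (map_bundle F b) (fmap F u : Hom _ (b_E (map_bundle F b))) (fmap F v) (fmap F w).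
Proof.
  by move=> [m [<- [<- <-]]]; exists (fmap F m) => /=; rewrite !fmap_comp.
Qed.

Lemma bundle_morphism_fmap {C D : Category} (F : Functor C D) (b b' : Bundle C)
  (f : Hom (b_B b) (b_B b')) (g : Hom (b_E b) (b_E b')) :
  is_bundle_morphism b b' f g ->
  is_bundle_morphism (map_bundle F b) (map_bundle F b') (fmap F f) (fmap F g).
Proof.
  move=> [hq hz hs]; split => /=; rewrite -?fmap_comp ?hq ?hz //.
  exact: is_sum_fmap.
Qed.

Lemma additive_bundle_fmap {C D : Category} (F : Functor C D) (b : Bundle C) :
  is_additive_bundle b -> nfold_pullbacks (map_bundle F b) ->
  is_additive_bundle (map_bundle F b).
Proof.
  move=> [_ hz hs hl hr hc [u [v [w [h1 [h2 [h3 h4]]]]]]] h; split=> //=.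
  - by rewrite -fmap_comp hz fmap_id.
  - by rewrite -fmap_comp hs.
  - by rewrite -fmap_comp -fmap_id; apply: is_sum_fmap.
  - by rewrite -fmap_comp -fmap_id; apply: is_sum_fmap.
  - exact: is_sum_fmap.
  - by exists (fmap F u), (fmap F v), (fmap F w); split; [|split; [|split]]; apply: is_sum_fmap.
Qed.

(** * The two projections from a sub-2-category of squares *)

Section Projections.
Context (K : TwoCat) (O : Type) (i : O -> ArrTwo K)
  (S : forall x y : O, hom (i x) (i y) -> Prop)
  (Sid : forall x, S x x (id1 (i x)))
  (Scomp : forall x y z (g : hom (i y) (i z)) (f : hom (i x) (i y)),
     S y z g -> S x y f -> S x z (g ⊚ f)).
Notation L := (SubTwo Sid Scomp).

Definition domF (x y : L) : Functor (hom x y) (hom (m_dom (i x)) (m_dom (i y))).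
Proof.
  unshelve refine {| fob := fun F : hom x y => sq_dom (proj1_sig F);
                     fmap := fun F G (a : Hom F G) => sc_dom a |}.
  - move=> f. reflexivity.
  - move=> f g h b a. reflexivity.
Defined.
Definition codF (x y : L) : Functor (hom x y) (hom (m_cod (i x)) (m_cod (i y))).
Proof.
  unshelve refine {| fob := fun F : hom x y => sq_cod (proj1_sig F);
                     fmap := fun F G (a : Hom F G) => sc_cod a |}.
  - move=> f. reflexivity.
  - move=> f g h b a. reflexivity.
Defined.
Notation dm := (fmap (domF _ _)).
Notation cd := (fmap (codF _ _)).

Definition dom2 : TwoFunctor L K.
Proof.
  by unshelve refine {| fn_ob := fun x : L => m_dom (i x); fn_hom := domF |}.
Defined.
Definition cod2 : TwoFunctor L K.
Proof.
  by unshelve refine {| fn_ob := fun x : L => m_cod (i x); fn_hom := codF |}.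
Defined.

Lemma dm_cd_eq (x y : L) (f g : hom x y) (a b : Hom f g) :
  dm a = dm b -> cd a = cd b -> a = b.
Proof. exact: SqCell_eq. Qed.

Lemma dm_cd_pk_eq (x y : L) (A B : Arrow (hom x y)) :
  dm (arr A) ≡ dm (arr B) -> cd (arr A) ≡ cd (arr B) -> A = B.
Proof.
  case: A B => f g a [f' g' b] e1 e2; apply: sub_pk_eq.
  exact: (@SqCell_pk_eq K (i x) (i y) (proj1_sig f) (proj1_sig g) (proj1_sig f') (proj1_sig g')
    a b e1 e2).
Qed.

(** The composite of [m_arr R ◁ d], [sc_cod a ▷ m_arr P] and [c ▷ m_arr P] is bracketed in two ways.
    By [sc_comm a] the middle cell is also [m_arr R ◁ sc_dom a], so it cancels against either
    neighbour. *)
Lemma square_iso_comm (P R : Mor1 K) (F G : SqCat P R) (a : SqCell F G) d c :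
  sc_dom a ∘ d = idm _ -> c ∘ sc_cod a = idm _ -> m_arr R ◁ d ≡ c ▷ m_arr P.
Proof.
  move=> d2 c1.
  have h1 : vc (pk (sc_cod a ▷ m_arr P)) (pk (m_arr R ◁ d)) = pid (m_arr R ⊚ sq_dom G).
    rewrite -(sc_comm a) -pk_comp; congr pk.
    by rewrite -(fmap_comp (post (m_arr R)) (sc_dom a) d : _ = _ ∘ _) d2; apply: hcomp_id.
  have h2 : vc (pk (c ▷ m_arr P)) (pk (sc_cod a ▷ m_arr P)) = pid (sq_cod F ⊚ m_arr P).
    rewrite -pk_comp; congr pk.
    by rewrite -(fmap_comp (pre (m_arr P)) c (sc_cod a) : _ = _ ∘ _) c1; apply: hcomp_id.
  have h3 : vc (vc (pk (c ▷ m_arr P)) (pk (sc_cod a ▷ m_arr P))) (pk (m_arr R ◁ d)) =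
            pk (c ▷ m_arr P).
    rewrite -vc_assoc //=; first exact: sq_comm.
    by rewrite h1 vc_idr //=; rewrite sq_comm.
  by rewrite -h3 h2 vc_idl //=; rewrite sq_comm.
Qed.

Lemma dm_cd_iso (x y : L) (f g : hom x y) (a : Hom f g) :
  is_iso (dm a) -> is_iso (cd a) -> is_iso a.
Proof.
  move=> [d [d1 d2]] [c [c1 c2]].
  have e := @square_iso_comm (i x) (i y) (proj1_sig f) (proj1_sig g) a d c d2 c1.
  pose b : Hom g f := @Build_SqCell K (i x) (i y) (proj1_sig g) (proj1_sig f) d c e.
  by exists b; split; apply: dm_cd_eq; rewrite fmap_comp fmap_id; [exact: d1|exact: c1|exact: d2|exact: c2].
Qed.

(** The sums in the two components are witnessed by unrelated pairings m' and m. They form a single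
    cell of squares by [square_comm], whence the limit condition on the base component, and
    composing that cell with the addition gives W. *)
Lemma is_sum_lift (x y : L) (b : Bundle (hom x y)) (X : hom x y) (u v : Hom X (b_E b)) w' w :
  nfold_pullbacks b -> pointwise_nfold (map_bundle (codF _ _) b) ->
  is_sum (map_bundle (domF _ _) b) (dm u) (dm v) w' ->
  is_sum (map_bundle (codF _ _) b) (cd u) (cd v) w ->
  exists W : Hom X (b_E b), dm W = w' /\ cd W = w /\ is_sum b u v W.
Proof.
  move=> hb /pointwise_nfold_limit hc [m' [m1' [m2' m3']]] [m [m1 [m2 m3]]].
  have hl := hc 2.
  (* The family u, v indexed by [Fin.t 2]; each member is determined by what its two components have
     to be. *)
  have k (j : Fin.t 2) : {k : Hom X (b_E b) |
      dm (b_pr b j) ∘ m' = dm k /\ cd (b_pr b j) ∘ m = cd k}.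
    apply: constructive_indefinite_description.
    by case: (fin2 j) => ->; [exists u|exists v].
  have k1 j : dm (b_pr b j) ∘ m' = dm (proj1_sig (k j)) by case: (proj2_sig (k j)).
  have k2 j : cd (b_pr b j) ∘ m = cd (proj1_sig (k j)) by case: (proj2_sig (k j)).
  have e := eq_sym (proj1 (hb 2) fst2).
  have [c hc2] : exists c : Hom X (b_B b), c = b_q b ∘ proj1_sig (k fst2) by eexists.
  have e1 : dm (b_b b 2) ∘ m' = dm c by rewrite hc2 e !fmap_comp -k1 comp_assoc.
  have e2 : cd (b_b b 2) ∘ m = cd c by rewrite hc2 e !fmap_comp -k2 comp_assoc.
  have hm := @square_comm K (i x) (i y) (Fin.t 2) (fun _ => proj1_sig (b_E b))
    (proj1_sig (b_B b)) (proj1_sig (b_n b 2)) (fun _ => b_q b) (b_b b 2) (@b_pr _ b 2)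
    (proj1_sig X) c (fun j => proj1_sig (k j)) m' m hl e1 e2 k1 k2.
  pose M : Hom X (b_n b 2) :=
    @Build_SqCell K (i x) (i y) (proj1_sig X) (proj1_sig (b_n b 2)) m' m hm.
  have M1 : dm M = m' by [].
  have M2 : cd M = m by [].
  exists (b_s b ∘ M); rewrite !fmap_comp M1 M2; split=> //; split=> //.
  exists M; split; [|split=> //]; apply: dm_cd_eq; rewrite fmap_comp ?M1 ?M2 //.
Qed.

End Projections.

(** * Images of tangent structures under 2-functors *)

Section PackedBundles.
Context {C : Category}.

(** The relation [is_sum] on packed arrows: the bundle can then be replaced by an equal one whose
    objects are not convertible to the given ones. *)
Definition sum_pk (b : Bundle C) (u v w : Arrow C) : Prop :=
  exists (X : C) (m : Hom X (b_n b 2)), vc (pk (b_pr b fst2)) (pk m) = u /\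
    vc (pk (b_pr b snd2)) (pk m) = v /\ vc (pk (b_s b)) (pk m) = w.

Lemma is_sum_pk (b : Bundle C) (X : C) (u v w : Hom X (b_E b)) :
  is_sum b u v w <-> sum_pk b (pk u) (pk v) (pk w).
Proof.
  split.
  - by move=> [m [<- [<- <-]]]; exists X, m; rewrite -!pk_comp.
  - move=> [X' [m]]; rewrite -!pk_comp => -[e1 [e2 e3]].
    have eX : X' = X := f_equal (@src _) e1; subst X'.
    by exists m; split; [|split]; apply: pk_inj.
Qed.

Definition bundle_morphism_pk (b b' : Bundle C) (f g : Arrow C) : Prop :=
  vc (pk (b_q b')) g = vc f (pk (b_q b)) /\ vc g (pk (b_z b)) = vc (pk (b_z b')) f /\
  sum_pk b' (vc g (pk (b_pr b fst2))) (vc g (pk (b_pr b snd2))) (vc g (pk (b_s b))).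

Lemma is_bundle_morphism_pk (b b' : Bundle C) (f : Hom (b_B b) (b_B b'))
  (g : Hom (b_E b) (b_E b')) :
  is_bundle_morphism b b' f g <-> bundle_morphism_pk b b' (pk f) (pk g).
Proof.
  rewrite /bundle_morphism_pk -!pk_comp; split.
  - by move=> [hq hz /is_sum_pk hs]; rewrite hq hz.
  - by move=> [/pk_inj hq [/pk_inj hz hs]]; split=> //; apply/is_sum_pk.
Qed.

Lemma bundle_morphism_of (b b' c c' : Bundle C) (f : Hom (b_B b) (b_B b'))
  (g : Hom (b_E b) (b_E b')) (f' : Hom (b_B c) (b_B c')) (g' : Hom (b_E c) (b_E c')) :
  c = b -> c' = b' -> f' ≡ f -> g' ≡ g -> is_bundle_morphism b b' f g ->
  is_bundle_morphism c c' f' g'.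
Proof.
  move=> e e' ef eg /is_bundle_morphism_pk h; apply/is_bundle_morphism_pk.
  by rewrite ef eg e e'.
Qed.

Lemma bundle_eq (b b' : Bundle C) : b_B b = b_B b' -> b_E b = b_E b' -> b_n b = b_n b' ->
  b_q b ≡ b_q b' -> (forall n, b_b b n ≡ b_b b' n) ->
  (forall n (j : Fin.t n), b_pr b j ≡ b_pr b' j) -> b_z b ≡ b_z b' -> b_s b ≡ b_s b' -> b = b'.
Proof.
  case: b b' => B E q n c pr z s [B' E' q' n' c' pr' z' s'] /= eB eE en; subst B' E' n'.
  move=> /pk_inj -> ec ep /pk_inj -> /pk_inj ->.
  have -> : c = c' by apply: functional_extensionality_dep => m; apply: pk_inj.
  have -> // : pr = pr'.
  by do 2 (apply: functional_extensionality_dep => ?); apply: pk_inj.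
Qed.

Lemma square_eq (S S' : Square C) : s_top S ≡ s_top S' -> s_left S ≡ s_left S' ->
  s_right S ≡ s_right S' -> s_bot S ≡ s_bot S' -> S = S'.
Proof.
  case: S S' => P A B D t l r b [P' A' B' D' t' l' r' b'] /= et el er eb.
  have eP : P = P' := f_equal (@src _) et; have eA : A = A' := f_equal (@tgt _) et.
  have eB : B = B' := f_equal (@tgt _) el; have eD : D = D' := f_equal (@tgt _) er.
  by subst P' A' B' D'; rewrite (pk_inj et) (pk_inj el) (pk_inj er) (pk_inj eb).
Qed.
End PackedBundles.

Lemma pk_comp3 {C : Category} (w x y z : C) (h : Hom y z) (g : Hom x y) (f : Hom w x) :
  pk (h ∘ g ∘ f) = vc (vc (pk h) (pk g)) (pk f).
Proof. by rewrite !pk_comp. Qed.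

Lemma pk_fmap_comp {C D : Category} (F : Functor C D) (x y z : C) (g : Hom y z) (f : Hom x y) :
  pk (fmap F (g ∘ f)) = vc (pk (fmap F g)) (pk (fmap F f)).
Proof. by rewrite fmap_comp pk_comp. Qed.

Lemma pk_fmap_comp3 {C D : Category} (F : Functor C D) (w x y z : C) (h : Hom y z)
  (g : Hom x y) (f : Hom w x) :
  pk (fmap F (h ∘ g ∘ f)) = vc (vc (pk (fmap F h)) (pk (fmap F g))) (pk (fmap F f)).
Proof. by rewrite !fmap_comp !pk_comp. Qed.

Lemma pk_fmap_idto {C D : Category} (F : Functor C D) (x y : C) (e : x = y) :
  pk (fmap F (idto e)) = pid (F x).
Proof. by destruct e; rewrite /= fmap_id. Qed.

Section Packed.
Context {K : TwoCat}.
Lemma pk_lT (t : TangentData K) : pk (t_lT t) = hc (pk (t_l t)) (pid (t_T t)).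
Proof. by rewrite /t_lT /asc'; packed; vid. Qed.
Lemma pk_cT (t : TangentData K) : pk (t_cT t) = hc (pk (t_c t)) (pid (t_T t)).
Proof. by rewrite /t_cT /asc /asc'; packed; vid. Qed.
Lemma pk_zT (t : TangentData K) : pk (t_zT t) = hc (pk (t_z t)) (pid (t_T t)).
Proof. by rewrite /t_zT; packed; vid. Qed.
Lemma pk_Tp (t : TangentData K) : pk (t_Tp t) = hc (pid (t_T t)) (pk (t_p t)).
Proof. by rewrite /t_Tp; packed; vid. Qed.

Lemma is_vlift_pk (t : TangentData K) (phi : Hom (t_n t 2) (t_T t ⊚ t_T t)) :
  is_vlift t phi <-> sum_pk (map_bundle (post (t_T t)) (t_bundle t))
    (vc (pk (t_l t)) (pk (t_pr t fst2))) (vc (pk (t_zT t)) (pk (t_pr t snd2))) (pk phi).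
Proof. by rewrite -(pk_comp (t_l t)) -(pk_comp (t_zT t)); apply: is_sum_pk. Qed.
End Packed.

Section Image.
Context {L K : TwoCat} (G : TwoFunctor L K).

(* The image of a tangent structure: G being strict, its components are those of
   t up to identities. *)
Record Image (t : TangentData L) := {
  im_b : forall n, Hom (fn_hom G (t_n t n)) (id1 (G (t_ob t)));
  im_p : Hom (fn_hom G (t_T t)) (id1 (G (t_ob t)));
  im_z : Hom (id1 (G (t_ob t))) (fn_hom G (t_T t));
  im_l : Hom (fn_hom G (t_T t)) (fn_hom G (t_T t) ⊚ fn_hom G (t_T t));
  im_c : Hom (fn_hom G (t_T t) ⊚ fn_hom G (t_T t)) (fn_hom G (t_T t) ⊚ fn_hom G (t_T t));
  im_b_pk : forall n, fmap (fn_hom G) (t_b t n) ≡ im_b n;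
  im_p_pk : fmap (fn_hom G) (t_p t) ≡ im_p;
  im_z_pk : fmap (fn_hom G) (t_z t) ≡ im_z;
  im_l_pk : fmap (fn_hom G) (t_l t) ≡ im_l;
  im_c_pk : fmap (fn_hom G) (t_c t) ≡ im_c }.

(** Only cells with an identity or a composite as source or target need a correction, so the
    projections and the addition are taken as they are. Leaving the corrected cells as a parameter
    lets a 2-functor that is strict by conversion, such as [Dom], use the components of t
    themselves. *)
Definition image (t : TangentData L) (I : Image t) : TangentData K :=
  {| t_ob := G (t_ob t); t_T := fn_hom G (t_T t); t_n := fun n => fn_hom G (t_n t n);
     t_b := im_b I; t_pr := fun n j => fmap (fn_hom G) (t_pr t j); t_p := im_p I; t_z := im_z I;
     t_s := fmap (fn_hom G) (t_s t); t_l := im_l I; t_c := im_c I |}.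

Lemma image_bundle (t : TangentData L) (I : Image t) :
  t_bundle (image I) = map_bundle (fn_hom G) (t_bundle t).
Proof.
  apply: bundle_eq => //=.
  - exact: eq_sym (fn_id1 G _).
  - exact: eq_sym (im_p_pk I).
  - by move=> n; exact: eq_sym (im_b_pk I n).
  - exact: eq_sym (im_z_pk I).
Qed.

Lemma map_post (x y z : L) (F : hom y z) (b : Bundle (hom x y)) :
  map_bundle (post (fn_hom G F)) (map_bundle (fn_hom G) b) =
  map_bundle (fn_hom G) (map_bundle (post F) b).
Proof.
  apply: bundle_eq => /=; rewrite ?fn_comp1 //; try (by rewrite fn_hcomp fmap_id).
  - by apply: functional_extensionality_dep => n; rewrite fn_comp1.
  - by move=> n; rewrite fn_hcomp fmap_id.
  - by move=> n j; rewrite fn_hcomp fmap_id.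
Qed.

Lemma map_pre (x y z : L) (F : hom x y) (b : Bundle (hom y z)) :
  map_bundle (pre (fn_hom G F)) (map_bundle (fn_hom G) b) =
  map_bundle (fn_hom G) (map_bundle (pre F) b).
Proof.
  apply: bundle_eq => /=; rewrite ?fn_comp1 //; try (by rewrite fn_hcomp fmap_id).
  - by apply: functional_extensionality_dep => n; rewrite fn_comp1.
  - by move=> n; rewrite fn_hcomp fmap_id.
  - by move=> n j; rewrite fn_hcomp fmap_id.
Qed.

Lemma image_post (x : L) (t : TangentData L) (I : Image t) (F : hom (t_ob t) x) :
  map_bundle (post (fn_hom G F)) (t_bundle (image I)) =
  map_bundle (fn_hom G) (map_bundle (post F) (t_bundle t)).
Proof. by rewrite image_bundle map_post. Qed.
Lemma image_pre (x : L) (t : TangentData L) (I : Image t) (F : hom x (t_ob t)) :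
  map_bundle (pre (fn_hom G F)) (t_bundle (image I)) =
  map_bundle (fn_hom G) (map_bundle (pre F) (t_bundle t)).
Proof. by rewrite image_bundle map_pre. Qed.

Lemma map_iter1 (x : L) (T : hom x x) m : fn_hom G (iter1 m T) = iter1 m (fn_hom G T).
Proof. by elim: m => [|m IH] /=; rewrite ?fn_id1 // fn_comp1 IH. Qed.

Definition preserves_limits : Prop :=
  forall (x y : L) (J : Type) (E : J -> hom x y) (B N : hom x y)
    (q : forall j, Hom (E j) B) (b : Hom N B) (pr : forall j, Hom N (E j)),
  pointwise_limit q b pr -> pointwise_limit (fun j => fmap (fn_hom G) (q j))
    (fmap (fn_hom G) b) (fun j => fmap (fn_hom G) (pr j)).

Section Preserved.
Context (HG : preserves_limits).

Lemma preserves_nfold (x y : L) (b : Bundle (hom x y)) :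
  pointwise_nfold b -> pointwise_nfold (map_bundle (fn_hom G) b).
Proof. by rewrite !pointwise_nfold_limit => h n; apply: HG (h n). Qed.

Lemma preserves_pullback (x y : L) (Q : Square (hom x y)) :
  pointwise_pullback Q -> pointwise_pullback (map_square (fn_hom G) Q).
Proof. by move=> /pointwise_pullback_limit h; apply/pointwise_map_pullback; apply: HG. Qed.
End Preserved.

Section OneTangent.
Context (t : TangentData L) (I : Image t).

Lemma pk_image_l : pk (fmap (fn_hom G) (t_l t)) = pk (t_l (image I)).
Proof. exact: im_l_pk. Qed.
Lemma pk_image_c : pk (fmap (fn_hom G) (t_c t)) = pk (t_c (image I)).
Proof. exact: im_c_pk. Qed.
Lemma pk_image_lT : pk (fmap (fn_hom G) (t_lT t)) = pk (t_lT (image I)).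
Proof.
  rewrite pk_lT /t_lT /asc' fmap_comp pk_comp fn_hcomp fmap_id pk_hcomp pk_fmap_idto pk_image_l.
  by rewrite vc_idl //= !fn_comp1.
Qed.
Lemma pk_image_cT : pk (fmap (fn_hom G) (t_cT t)) = pk (t_cT (image I)).
Proof.
  rewrite pk_cT /t_cT /asc /asc' !fmap_comp !pk_comp fn_hcomp fmap_id pk_hcomp !pk_fmap_idto.
  by rewrite pk_image_c vc_idl ?vc_idr //= !fn_comp1 ?comp1_assoc.
Qed.
Lemma pk_image_zT : pk (fmap (fn_hom G) (t_zT t)) = pk (t_zT (image I)).
Proof.
  rewrite pk_zT /t_zT fmap_comp pk_comp fn_hcomp fmap_id pk_hcomp pk_fmap_idto (im_z_pk I).
  by rewrite vc_idr //= comp1_idl.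
Qed.
Lemma pk_image_Tp : pk (fmap (fn_hom G) (t_Tp t)) = pk (t_Tp (image I)).
Proof.
  rewrite pk_Tp /t_Tp fmap_comp pk_comp fn_hcomp fmap_id pk_hcomp pk_fmap_idto (im_p_pk I).
  by rewrite vc_idl //= !comp1_idr.
Qed.
Lemma pk_image_post (x y z : L) (F : hom y z) (f g : hom x y) (a : Hom f g) :
  pk (fmap (fn_hom G) (F ◁ a)) = hc (pid (fn_hom G F)) (pk (fmap (fn_hom G) a)).
Proof. by rewrite fn_hcomp fmap_id. Qed.
Lemma pk_image_pre (x y z : L) (F : hom x y) (f g : hom y z) (a : Hom f g) :
  pk (fmap (fn_hom G) (a ▷ F)) = hc (pk (fmap (fn_hom G) a)) (pid (fn_hom G F)).
Proof. by rewrite fn_hcomp fmap_id. Qed.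

Lemma pk_image_ll : fmap (fn_hom G) (t_T t ◁ t_l t ∘ t_l t) ≡
  t_T (image I) ◁ t_l (image I) ∘ t_l (image I).
Proof. by rewrite pk_fmap_comp pk_image_post pk_image_l [RHS]pk_comp. Qed.
Lemma pk_image_ll' : fmap (fn_hom G) (t_lT t ∘ t_l t) ≡ t_lT (image I) ∘ t_l (image I).
Proof. by rewrite pk_fmap_comp pk_image_lT pk_image_l [RHS]pk_comp. Qed.
Lemma pk_image_cc : fmap (fn_hom G) (t_c t ∘ t_c t) ≡ t_c (image I) ∘ t_c (image I).
Proof. by rewrite pk_fmap_comp pk_image_c [RHS]pk_comp. Qed.
Lemma pk_image_cc' : fmap (fn_hom G) (idm (t_T t ⊚ t_T t)) ≡ idm (t_T (image I) ⊚ t_T (image I)).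
Proof. by rewrite fmap_id fn_comp1. Qed.
Lemma pk_image_ccc : fmap (fn_hom G) (t_T t ◁ t_c t ∘ t_cT t ∘ t_T t ◁ t_c t) ≡
  t_T (image I) ◁ t_c (image I) ∘ t_cT (image I) ∘ t_T (image I) ◁ t_c (image I).
Proof. by rewrite pk_fmap_comp3 pk_image_post pk_image_cT pk_image_c [RHS]pk_comp3. Qed.
Lemma pk_image_ccc' : fmap (fn_hom G) (t_cT t ∘ t_T t ◁ t_c t ∘ t_cT t) ≡
  t_cT (image I) ∘ t_T (image I) ◁ t_c (image I) ∘ t_cT (image I).
Proof. by rewrite pk_fmap_comp3 pk_image_post pk_image_cT pk_image_c [RHS]pk_comp3. Qed.
Lemma pk_image_cl : fmap (fn_hom G) (t_c t ∘ t_l t) ≡ t_c (image I) ∘ t_l (image I).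
Proof. by rewrite pk_fmap_comp pk_image_l pk_image_c [RHS]pk_comp. Qed.
Lemma pk_image_lc : fmap (fn_hom G) (t_T t ◁ t_l t ∘ t_c t) ≡
  t_T (image I) ◁ t_l (image I) ∘ t_c (image I).
Proof. by rewrite pk_fmap_comp pk_image_post pk_image_l pk_image_c [RHS]pk_comp. Qed.
Lemma pk_image_lc' : fmap (fn_hom G) (t_cT t ∘ t_T t ◁ t_c t ∘ t_lT t) ≡
  t_cT (image I) ∘ t_T (image I) ◁ t_c (image I) ∘ t_lT (image I).
Proof. by rewrite pk_fmap_comp3 pk_image_post pk_image_cT pk_image_c pk_image_lT [RHS]pk_comp3. Qed.

Lemma image_vlift (phi : Hom (t_n t 2) (t_T t ⊚ t_T t)) phi' :
  fmap (fn_hom G) phi ≡ phi' -> is_vlift t phi -> is_vlift (image I) phi'.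
Proof.
  move=> e /(is_sum_fmap (fn_hom G)) /is_sum_pk; rewrite e.
  rewrite (fmap_comp (fn_hom G) (t_l t)) (fmap_comp (fn_hom G) (t_zT t)).
  rewrite (pk_comp (fmap _ (t_l t))) (pk_comp (fmap _ (t_zT t))) pk_image_l pk_image_zT.
  by move=> h; apply/is_vlift_pk; rewrite image_post.
Qed.

Lemma image_vlift_square (phi : Hom (t_n t 2) (t_T t ⊚ t_T t)) phi' :
  fmap (fn_hom G) phi ≡ phi' ->
  vlift_square (image I) phi' = map_square (fn_hom G) (vlift_square t phi).
Proof.
  move=> e; apply: square_eq => /=.
  - by rewrite e.
  - by rewrite fmap_comp !pk_comp (im_p_pk I).
  - by rewrite pk_image_Tp.
  - by rewrite (im_z_pk I).
Qed.

Lemma image_post_vlift (x : L) (F : hom (t_ob t) x) (phi : Hom (t_n t 2) (t_T t ⊚ t_T t)) phi' :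
  fmap (fn_hom G) phi ≡ phi' ->
  map_square (post (fn_hom G F)) (vlift_square (image I) phi') =
  map_square (fn_hom G) (map_square (post F) (vlift_square t phi)).
Proof.
  move=> e; rewrite (image_vlift_square e).
  by apply: square_eq; rewrite [RHS]pk_image_post.
Qed.

Lemma image_zl :
  is_bundle_morphism (map_bundle (fn_hom G) (t_bundle t))
    (map_bundle (fn_hom G) (map_bundle (post (t_T t)) (t_bundle t)))
    (fmap (fn_hom G) (idto (eq_sym (comp1_idr (t_T t))) ∘ t_z t)) (fmap (fn_hom G) (t_l t)) <->
  is_bundle_morphism (t_bundle (image I))
    (map_bundle (post (t_T (image I))) (t_bundle (image I)))
    (idto (eq_sym (comp1_idr (t_T (image I)))) ∘ t_z (image I)) (t_l (image I)).
Proof.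
  have e : fmap (fn_hom G) (idto (eq_sym (comp1_idr (t_T t))) ∘ t_z t) ≡
           idto (eq_sym (comp1_idr (t_T (image I)))) ∘ t_z (image I).
    rewrite pk_fmap_comp [RHS]pk_comp pk_fmap_idto (im_z_pk I) pk_idto /=.
    by rewrite !vc_idl //= ?comp1_idr.
  split; apply: bundle_morphism_of.
  - exact: image_bundle.
  - exact: image_post.
  - exact: eq_sym e.
  - exact: eq_sym pk_image_l.
  - exact: eq_sym (image_bundle _).
  - exact: eq_sym (image_post _ _).
  - exact: e.
  - exact: pk_image_l.
Qed.

Lemma image_idc :
  is_bundle_morphism (map_bundle (fn_hom G) (map_bundle (post (t_T t)) (t_bundle t)))
    (map_bundle (fn_hom G) (map_bundle (pre (t_T t)) (t_bundle t)))
    (fmap (fn_hom G) (idto (comp1_idrl (t_T t)))) (fmap (fn_hom G) (t_c t)) <->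
  is_bundle_morphism (map_bundle (post (t_T (image I))) (t_bundle (image I)))
    (map_bundle (pre (t_T (image I))) (t_bundle (image I)))
    (idto (comp1_idrl (t_T (image I)))) (t_c (image I)).
Proof.
  have e : fmap (fn_hom G) (idto (comp1_idrl (t_T t))) ≡ idto (comp1_idrl (t_T (image I))).
    by rewrite pk_fmap_idto pk_idto fn_comp1 fn_id1.
  split; apply: bundle_morphism_of.
  - exact: image_post.
  - exact: image_pre.
  - exact: eq_sym e.
  - exact: eq_sym pk_image_c.
  - exact: eq_sym (image_post _ _).
  - exact: eq_sym (image_pre _ _).
  - exact: e.
  - exact: pk_image_c.
Qed.

Lemma is_tangent_image : preserves_limits -> is_tangent t -> is_tangent (image I).
Proof.
  move=> HG [h1 h2 h3 h4 h5 h6 h7 h8 h9 h10 [phi [hv hq]]].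
  have hp : pointwise_nfold (t_bundle (image I)) by rewrite image_bundle; apply: preserves_nfold.
  split=> //.
  - by move=> m; rewrite -map_iter1 image_post; apply: preserves_nfold.
  - rewrite image_bundle; apply: additive_bundle_fmap => //.
    by rewrite -image_bundle; apply: (proj1 hp).
  - exact/image_zl/(bundle_morphism_fmap (fn_hom G)).
  - exact/image_idc/(bundle_morphism_fmap (fn_hom G)).
  - by apply: pk_inj; rewrite -pk_image_ll -pk_image_ll' h6.
  - by apply: pk_inj; rewrite -pk_image_cc -pk_image_cc' h7.
  - by apply: pk_inj; rewrite -pk_image_ccc -pk_image_ccc' h8.
  - by apply: pk_inj; rewrite -pk_image_cl -pk_image_l h9.
  - by apply: pk_inj; rewrite -pk_image_lc -pk_image_lc' h10.
  - exists (idto (fn_comp1 G _ _) ∘ fmap (fn_hom G) phi).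
    have e : fmap (fn_hom G) phi ≡ idto (fn_comp1 G _ _) ∘ fmap (fn_hom G) phi.
      by rewrite pk_comp pk_idto vc_idl.
    split; first exact: image_vlift e hv.
    by rewrite (image_vlift_square e); apply: preserves_pullback.
Qed.
End OneTangent.
End Image.

Lemma pointwise_nfold_map_pre {K : TwoCat} {X Y Z : K} (f : hom X Y) (b : Bundle (hom Y Z)) :
  pointwise_nfold b -> pointwise_nfold (map_bundle (pre f) b).
Proof.
  move=> [_ h]; apply: pointwise_nfold_pre => X0 g n.
  have i (F : hom Y Z) : is_iso (asc F f g) by apply: idto_iso.
  have e (F F' : hom Y Z) (a : Hom F F') : (a ▷ f) ▷ g ∘ asc F f g = asc F' f g ∘ a ▷ (f ⊚ g).
    by apply: idto_nat; rewrite -hcomp_id hcomp_assoc.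
  exact: (wide_pullback_iso (i _) (i _) (i _) (e _ _ _) (e _ _ _) (fun j => e _ _ _) (h _ (f ⊚ g) n)).
Qed.

(** * Images of lax and colax morphisms *)

Section ImageLax.
Context {L K : TwoCat} (G : TwoFunctor L K) (t t' : TangentData L)
  (I : Image G t) (I' : Image G t').

Section Lax.
Context (A : Lax (t_endo t) (t_endo t'))
  (a' : Hom (fn_hom G (lx_F A) ⊚ fn_hom G (t_T t))
            (fn_hom G (t_T t') ⊚ fn_hom G (lx_F A)))
  (ea : fmap (fn_hom G) (lx_a A) ≡ a').
Notation A' := (@Build_Lax K (t_endo (image I)) (t_endo (image I')) (fn_hom G (lx_F A)) a').

Lemma pk_image_lax2 : fmap (fn_hom G) (lax2 A) ≡ lax2 A'.
Proof.
  rewrite lax2_pk /lax2 /asc /asc' !pk_fmap_comp !pk_fmap_idto pk_image_post pk_image_pre ea.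
  rewrite [vc (pid _) (hc _ _)]vc_idl; first by rewrite /= !fn_comp1 ?comp1_assoc.
  rewrite [vc (hc _ _) (pid _)]vc_idr; first by rewrite /= !fn_comp1 ?comp1_assoc.
  rewrite vc_idr //; rewrite src_vc /= ?fn_comp1 ?comp1_assoc //.
Qed.

Lemma image_lax_additive :
  is_bundle_morphism (map_bundle (fn_hom G) (map_bundle (post (lx_F A)) (t_bundle t)))
    (map_bundle (fn_hom G) (map_bundle (pre (lx_F A)) (t_bundle t')))
    (fmap (fn_hom G) (idto (comp1_idrl (lx_F A)))) (fmap (fn_hom G) (lx_a A)) <->
  is_bundle_morphism (map_bundle (post (lx_F A')) (t_bundle (image I)))
    (map_bundle (pre (lx_F A')) (t_bundle (image I')))
    (idto (comp1_idrl (lx_F A'))) (lx_a A').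
Proof.
  have e : fmap (fn_hom G) (idto (comp1_idrl (lx_F A))) ≡ idto (comp1_idrl (lx_F A')).
    by rewrite pk_fmap_idto pk_idto fn_comp1 fn_id1.
  have e1 := image_post I (lx_F A); have e2 := image_pre I' (lx_F A).
  split; apply: bundle_morphism_of => //; exact: eq_sym.
Qed.

Lemma pk_image_lax_l : fmap (fn_hom G) (lax2 A ∘ lx_F A ◁ t_l t) ≡ lax2 A' ∘ lx_F A' ◁ t_l (image I).
Proof. by rewrite pk_fmap_comp [RHS]pk_comp pk_image_post pk_image_lax2 (pk_image_l I). Qed.
Lemma pk_image_lax_l' : fmap (fn_hom G) (t_l t' ▷ lx_F A ∘ lx_a A) ≡
  t_l (image I') ▷ lx_F A' ∘ lx_a A'.
Proof. by rewrite pk_fmap_comp [RHS]pk_comp pk_image_pre ea (pk_image_l I'). Qed.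
Lemma pk_image_lax_c : fmap (fn_hom G) (t_c t' ▷ lx_F A ∘ lax2 A) ≡
  t_c (image I') ▷ lx_F A' ∘ lax2 A'.
Proof. by rewrite pk_fmap_comp [RHS]pk_comp pk_image_pre pk_image_lax2 (pk_image_c I'). Qed.
Lemma pk_image_lax_c' : fmap (fn_hom G) (lax2 A ∘ lx_F A ◁ t_c t) ≡ lax2 A' ∘ lx_F A' ◁ t_c (image I).
Proof. by rewrite pk_fmap_comp [RHS]pk_comp pk_image_post pk_image_lax2 (pk_image_c I). Qed.

Lemma is_lax_image : is_lax A -> is_lax A'.
Proof.
  move=> [h1 h2 h3]; split.
  - exact/image_lax_additive/(bundle_morphism_fmap (fn_hom G)).
  - by apply: pk_inj; rewrite -pk_image_lax_l -pk_image_lax_l' h2.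
  - by apply: pk_inj; rewrite -pk_image_lax_c -pk_image_lax_c' h3.
Qed.
End Lax.

Section Colax.
Context (A : Colax (t_endo t) (t_endo t'))
  (a' : Hom (fn_hom G (t_T t') ⊚ fn_hom G (cx_F A))
            (fn_hom G (cx_F A) ⊚ fn_hom G (t_T t)))
  (ea : fmap (fn_hom G) (cx_a A) ≡ a').
Notation A' := (@Build_Colax K (t_endo (image I)) (t_endo (image I')) (fn_hom G (cx_F A)) a').

Lemma pk_image_colax2 : fmap (fn_hom G) (colax2 A) ≡ colax2 A'.
Proof.
  rewrite colax2_pk /colax2 /asc /asc' !pk_fmap_comp !pk_fmap_idto pk_image_post pk_image_pre ea.
  rewrite [vc (pid _) (hc _ _)]vc_idl; first by rewrite /= !fn_comp1 ?comp1_assoc.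
  rewrite [vc (hc _ _) (pid _)]vc_idr; first by rewrite /= !fn_comp1 ?comp1_assoc.
  rewrite vc_idr //; rewrite src_vc /= ?fn_comp1 ?comp1_assoc //.
Qed.

Lemma image_colax_additive :
  is_bundle_morphism (map_bundle (fn_hom G) (map_bundle (pre (cx_F A)) (t_bundle t')))
    (map_bundle (fn_hom G) (map_bundle (post (cx_F A)) (t_bundle t)))
    (fmap (fn_hom G) (idto (eq_sym (comp1_idrl (cx_F A))))) (fmap (fn_hom G) (cx_a A)) <->
  is_bundle_morphism (map_bundle (pre (cx_F A')) (t_bundle (image I')))
    (map_bundle (post (cx_F A')) (t_bundle (image I)))
    (idto (eq_sym (comp1_idrl (cx_F A')))) (cx_a A').
Proof.
  have e : fmap (fn_hom G) (idto (eq_sym (comp1_idrl (cx_F A)))) ≡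
           idto (eq_sym (comp1_idrl (cx_F A'))).
    by rewrite pk_fmap_idto pk_idto fn_comp1 fn_id1.
  have e1 := image_post I (cx_F A); have e2 := image_pre I' (cx_F A).
  split; apply: bundle_morphism_of => //; exact: eq_sym.
Qed.

Lemma pk_image_colax_l : fmap (fn_hom G) (cx_F A ◁ t_l t ∘ cx_a A) ≡
  cx_F A' ◁ t_l (image I) ∘ cx_a A'.
Proof. by rewrite pk_fmap_comp [RHS]pk_comp pk_image_post ea (pk_image_l I). Qed.
Lemma pk_image_colax_l' : fmap (fn_hom G) (colax2 A ∘ t_l t' ▷ cx_F A) ≡
  colax2 A' ∘ t_l (image I') ▷ cx_F A'.
Proof. by rewrite pk_fmap_comp [RHS]pk_comp pk_image_pre pk_image_colax2 (pk_image_l I'). Qed.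
Lemma pk_image_colax_c : fmap (fn_hom G) (colax2 A ∘ t_c t' ▷ cx_F A) ≡
  colax2 A' ∘ t_c (image I') ▷ cx_F A'.
Proof. by rewrite pk_fmap_comp [RHS]pk_comp pk_image_pre pk_image_colax2 (pk_image_c I'). Qed.
Lemma pk_image_colax_c' : fmap (fn_hom G) (cx_F A ◁ t_c t ∘ colax2 A) ≡
  cx_F A' ◁ t_c (image I) ∘ colax2 A'.
Proof. by rewrite pk_fmap_comp [RHS]pk_comp pk_image_post pk_image_colax2 (pk_image_c I). Qed.

Lemma is_colax_image : preserves_limits G -> is_tangent t -> is_colax A -> is_colax A'.
Proof.
  move=> HG ht [h1 h2 h3 h4 h5]; split.
  - exact/image_colax_additive/(bundle_morphism_fmap (fn_hom G)).
  - by apply: pk_inj; rewrite -pk_image_colax_l -pk_image_colax_l' h2.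
  - by apply: pk_inj; rewrite -pk_image_colax_c -pk_image_colax_c' h3.
  - by rewrite [map_bundle _ _]image_post; apply: preserves_nfold.
  - move=> phi' hphi'; have [phi [hphi _]] := tg_vlift ht.
    have e : fmap (fn_hom G) phi ≡ idto (fn_comp1 G _ _) ∘ fmap (fn_hom G) phi.
      by rewrite pk_comp pk_idto vc_idl.
    (* An arbitrary [phi'] of the image is the image of a [phi] of t, by uniqueness, so that
       preservation can be quoted from A. *)
    rewrite (is_vlift_unique (is_tangent_image I HG ht) hphi' (image_vlift e hphi)).
    by rewrite [map_square _ _](image_post_vlift (cx_F A) e); apply: preserves_pullback => //; apply: h5.
Qed.
End Colax.
End ImageLax.

Lemma fmap_iso {C D : Category} (F : Functor C D) (x y : C) (f : Hom x y) :
  is_iso f -> is_iso (fmap F f).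
Proof. by move=> [g [g1 g2]]; exists (fmap F g); rewrite -!fmap_comp g1 g2 !fmap_id. Qed.

(** * Pairs of 2-functors that jointly reflect tangent structures *)

Section Pair.
Context {L K : TwoCat} (G1 G2 : TwoFunctor L K).

(** [jr_sum] is a creation statement: from sums in both images it produces a cell w upstairs, which
    [jr_eq] only shows to be unique. Its extra condition on [G2] is the one under which pairings
    glue, [G2] standing for the base. *)
Record jointly_reflect : Prop := {
  jr_eq : forall (x y : L) (A B : Arrow (hom x y)),
    fmap (fn_hom G1) (arr A) ≡ fmap (fn_hom G1) (arr B) ->
    fmap (fn_hom G2) (arr A) ≡ fmap (fn_hom G2) (arr B) -> A = B;
  jr_sum : forall (x y : L) (b : Bundle (hom x y)) (X : hom x y) (u v : Hom X (b_E b)) w1 w2,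
    nfold_pullbacks b -> pointwise_nfold (map_bundle (fn_hom G2) b) ->
    is_sum (map_bundle (fn_hom G1) b) (fmap (fn_hom G1) u) (fmap (fn_hom G1) v) w1 ->
    is_sum (map_bundle (fn_hom G2) b) (fmap (fn_hom G2) u) (fmap (fn_hom G2) v) w2 ->
    exists w, fmap (fn_hom G1) w = w1 /\ fmap (fn_hom G2) w = w2 /\ is_sum b u v w;
  jr_limit : forall (x y : L) (J : Type) (E : J -> hom x y) (B N : hom x y)
    (q : forall j, Hom (E j) B) (b : Hom N B) (pr : forall j, Hom N (E j)),
    pointwise_limit q b pr <->
    pointwise_limit (fun j => fmap (fn_hom G1) (q j)) (fmap (fn_hom G1) b)
      (fun j => fmap (fn_hom G1) (pr j)) /\
    pointwise_limit (fun j => fmap (fn_hom G2) (q j)) (fmap (fn_hom G2) b)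
      (fun j => fmap (fn_hom G2) (pr j));
  jr_iso : forall (x y : L) (f g : hom x y) (a : Hom f g),
    is_iso (fmap (fn_hom G1) a) -> is_iso (fmap (fn_hom G2) a) -> is_iso a }.

Context (HJ : jointly_reflect).

Lemma preserves_limits1 : preserves_limits G1.
Proof. by move=> x y J E B N q b pr /(jr_limit HJ) []. Qed.
Lemma preserves_limits2 : preserves_limits G2.
Proof. by move=> x y J E B N q b pr /(jr_limit HJ) []. Qed.

Lemma jr_hom (x y : L) (f g : hom x y) (a b : Hom f g) :
  fmap (fn_hom G1) a ≡ fmap (fn_hom G1) b -> fmap (fn_hom G2) a ≡ fmap (fn_hom G2) b -> a = b.
Proof. by move=> e1 e2; apply: pk_inj; apply: (jr_eq HJ). Qed.

Lemma jr_nfold (x y : L) (b : Bundle (hom x y)) :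
  pointwise_nfold (map_bundle (fn_hom G1) b) -> pointwise_nfold (map_bundle (fn_hom G2) b) ->
  pointwise_nfold b.
Proof.
  rewrite !pointwise_nfold_limit => h1 h2 n; apply/(jr_limit HJ).
  by split; [apply: h1|apply: h2].
Qed.

Lemma jr_pullback (x y : L) (Q : Square (hom x y)) :
  pointwise_pullback (map_square (fn_hom G1) Q) ->
  pointwise_pullback (map_square (fn_hom G2) Q) -> pointwise_pullback Q.
Proof.
  move=> /pointwise_map_pullback h1 /pointwise_map_pullback h2.
  by apply/pointwise_pullback_limit/(jr_limit HJ).
Qed.

Lemma jr_is_sum (x y : L) (b : Bundle (hom x y)) (X : hom x y) (u v w : Hom X (b_E b)) :
  pointwise_nfold b ->
  is_sum (map_bundle (fn_hom G1) b) (fmap (fn_hom G1) u) (fmap (fn_hom G1) v)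
    (fmap (fn_hom G1) w) ->
  is_sum (map_bundle (fn_hom G2) b) (fmap (fn_hom G2) u) (fmap (fn_hom G2) v)
    (fmap (fn_hom G2) w) -> is_sum b u v w.
Proof.
  move=> hb h1 h2; have hb2 := preserves_nfold preserves_limits2 hb.
  have [w' [e1 [e2 h]]] := jr_sum HJ (proj1 hb) hb2 h1 h2.
  by rewrite -(jr_hom (eq_pk e1) (eq_pk e2)).
Qed.

Lemma jr_bundle_morphism (x y : L) (b b' : Bundle (hom x y)) (f : Hom (b_B b) (b_B b'))
  (g : Hom (b_E b) (b_E b')) : pointwise_nfold b' ->
  is_bundle_morphism (map_bundle (fn_hom G1) b) (map_bundle (fn_hom G1) b')
    (fmap (fn_hom G1) f) (fmap (fn_hom G1) g) ->
  is_bundle_morphism (map_bundle (fn_hom G2) b) (map_bundle (fn_hom G2) b')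
    (fmap (fn_hom G2) f) (fmap (fn_hom G2) g) -> is_bundle_morphism b b' f g.
Proof.
  move=> hb [hq hz hs] [hq' hz' hs']; split.
  - by apply: jr_hom; rewrite !fmap_comp; apply: eq_pk.
  - by apply: jr_hom; rewrite !fmap_comp; apply: eq_pk.
  - by apply: (jr_is_sum hb); rewrite !fmap_comp.
Qed.

Lemma jr_additive_bundle (x y : L) (b : Bundle (hom x y)) : pointwise_nfold b ->
  is_additive_bundle (map_bundle (fn_hom G1) b) ->
  is_additive_bundle (map_bundle (fn_hom G2) b) -> is_additive_bundle b.
Proof.
  move=> hb [_ hz hs hl hr hcm [u [v [w [h1 [h2 [h3 h4]]]]]]].
  move=> [_ hz' hs' hl' hr' hcm' [u' [v' [w' [h1' [h2' [h3' h4']]]]]]].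
  have hb2 := preserves_nfold preserves_limits2 hb.
  split; first exact: proj1 hb.
  - by apply: jr_hom; rewrite fmap_comp fmap_id; apply: eq_pk.
  - by apply: jr_hom; rewrite fmap_comp; apply: eq_pk.
  - by apply: (jr_is_sum hb); rewrite fmap_comp fmap_id.
  - by apply: (jr_is_sum hb); rewrite fmap_comp fmap_id.
  - exact: (jr_is_sum hb).
  (* The partial sums of the two images are unrelated until glued. Once U and V exist, the total sum
     formed from U glues to W, and the remaining sum with V is reflected. *)
  - have [U [U1 [U2 HU]]] := jr_sum HJ (proj1 hb) hb2 h1 h1'.
    have [V [V1 [V2 HV]]] := jr_sum HJ (proj1 hb) hb2 h3 h3'.
    subst u v u' v'.
    have [W [W1 [W2 HW]]] := jr_sum HJ (proj1 hb) hb2 h2 h2'.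
    exists U, V, W; split=> //; split=> //; split=> //.
    by apply: (jr_is_sum hb); rewrite ?W1 ?W2.
Qed.

Section Tangents.
Context (t : TangentData L) (I1 : Image G1 t) (I2 : Image G2 t).

Lemma image_vlift_sum (G : TwoFunctor L K) (I : Image G t) phi' :
  is_vlift (image I) phi' ->
  is_sum (map_bundle (fn_hom G) (map_bundle (post (t_T t)) (t_bundle t)))
    (fmap (fn_hom G) (t_l t ∘ t_pr t fst2)) (fmap (fn_hom G) (t_zT t ∘ t_pr t snd2))
    (idto (eq_sym (fn_comp1 G _ _)) ∘ phi').
Proof.
  have e : idto (eq_sym (fn_comp1 G (t_T t) (t_T t))) ∘ phi' ≡ phi'.
    by rewrite pk_comp pk_idto vc_idl.
  move=> /is_vlift_pk; rewrite image_post => h; apply/is_sum_pk; rewrite e.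
  rewrite (pk_fmap_comp (fn_hom G) (t_l t)) (pk_fmap_comp (fn_hom G) (t_zT t)).
  by rewrite (pk_image_l I) (pk_image_zT I).
Qed.

Lemma is_tangent_reflect :
  is_tangent (image I1) -> is_tangent (image I2) -> is_tangent t.
Proof.
  move=> h1 h2.
  have hp : pointwise_nfold (t_bundle t).
    apply: jr_nfold.
      by rewrite -(image_bundle I1); exact: tg_pullbacks h1.
    by rewrite -(image_bundle I2); exact: tg_pullbacks h2.
  have hm m : pointwise_nfold (map_bundle (post (iter1 m (t_T t))) (t_bundle t)).
    apply: jr_nfold.
      by rewrite -(image_post I1) map_iter1; apply: (tg_preserved h1).
    by rewrite -(image_post I2) map_iter1; apply: (tg_preserved h2).
  have hT : pointwise_nfold (map_bundle (post (t_T t)) (t_bundle t)).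
    have E : iter1 1 (t_T t) = t_T t by apply: comp1_idr.
    by have := hm 1; rewrite E.
  have hT' : pointwise_nfold (map_bundle (pre (t_T t)) (t_bundle t)).
    exact: pointwise_nfold_map_pre.
  split=> //.
  - apply: jr_additive_bundle => //.
      by rewrite -(image_bundle I1); exact: tg_additive h1.
    by rewrite -(image_bundle I2); exact: tg_additive h2.
  - apply: jr_bundle_morphism => //.
      by apply/(image_zl I1); exact: tg_zl h1.
    by apply/(image_zl I2); exact: tg_zl h2.
  - apply: jr_bundle_morphism => //.
      by apply/(image_idc I1); exact: tg_idc h1.
    by apply/(image_idc I2); exact: tg_idc h2.
  - apply: jr_hom.
      by rewrite (pk_image_ll I1) (pk_image_ll' I1) (tg_ll h1).
    by rewrite (pk_image_ll I2) (pk_image_ll' I2) (tg_ll h2).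
  - apply: jr_hom.
      by rewrite (pk_image_cc I1) (pk_image_cc' I1) (tg_cc h1).
    by rewrite (pk_image_cc I2) (pk_image_cc' I2) (tg_cc h2).
  - apply: jr_hom.
      by rewrite (pk_image_ccc I1) (pk_image_ccc' I1) (tg_ccc h1).
    by rewrite (pk_image_ccc I2) (pk_image_ccc' I2) (tg_ccc h2).
  - apply: jr_hom.
      by rewrite (pk_image_cl I1) (pk_image_l I1) (tg_cl h1).
    by rewrite (pk_image_cl I2) (pk_image_l I2) (tg_cl h2).
  - apply: jr_hom.
      by rewrite (pk_image_lc I1) (pk_image_lc' I1) (tg_lc h1).
    by rewrite (pk_image_lc I2) (pk_image_lc' I2) (tg_lc h2).
  - have [phi1 [v1 q1]] := tg_vlift h1; have [phi2 [v2 q2]] := tg_vlift h2.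
    (* The comparisons of the two images are sums in the bundle T applied to p, so they glue because
       T preserves T₂. *)
    have [phi [e1 [e2 hv]]] := jr_sum HJ (proj1 hT) (preserves_nfold preserves_limits2 hT)
      (image_vlift_sum v1) (image_vlift_sum v2).
    have e1' : fmap (fn_hom G1) phi ≡ phi1 by rewrite e1 pk_comp pk_idto vc_idl.
    have e2' : fmap (fn_hom G2) phi ≡ phi2 by rewrite e2 pk_comp pk_idto vc_idl.
    exists phi; split=> //; apply: jr_pullback.
      by rewrite -(image_vlift_square (I := I1) e1').
    by rewrite -(image_vlift_square (I := I2) e2').
Qed.
End Tangents.

Section Morphisms.
Context (t t' : TangentData L) (I1 : Image G1 t) (I2 : Image G2 t)
  (I1' : Image G1 t') (I2' : Image G2 t').

Lemma is_lax_reflect (A : Lax (t_endo t) (t_endo t'))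
  (A1 := @Build_Lax K (t_endo (image I1)) (t_endo (image I1')) (fn_hom G1 (lx_F A)))
  (A2 := @Build_Lax K (t_endo (image I2)) (t_endo (image I2')) (fn_hom G2 (lx_F A))) a1 a2 :
  fmap (fn_hom G1) (lx_a A) ≡ a1 -> fmap (fn_hom G2) (lx_a A) ≡ a2 ->
  is_tangent t' -> is_lax (A1 a1) -> is_lax (A2 a2) -> is_lax A.
Proof.
  move=> e1 e2 ht [h1 h2 h3] [h1' h2' h3']; split.
  - apply: jr_bundle_morphism.
    + exact: pointwise_nfold_map_pre (tg_pullbacks ht).
    + exact/(image_lax_additive I1 I1' e1).
    + exact/(image_lax_additive I2 I2' e2).
  - apply: jr_hom.
      by rewrite (pk_image_lax_l I1 I1' e1) (pk_image_lax_l' I1 I1' e1) h2.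
    by rewrite (pk_image_lax_l I2 I2' e2) (pk_image_lax_l' I2 I2' e2) h2'.
  - apply: jr_hom.
      by rewrite (pk_image_lax_c I1 I1' e1) (pk_image_lax_c' I1 I1' e1) h3.
    by rewrite (pk_image_lax_c I2 I2' e2) (pk_image_lax_c' I2 I2' e2) h3'.
Qed.

Lemma is_colax_reflect (A : Colax (t_endo t) (t_endo t'))
  (A1 := @Build_Colax K (t_endo (image I1)) (t_endo (image I1')) (fn_hom G1 (cx_F A)))
  (A2 := @Build_Colax K (t_endo (image I2)) (t_endo (image I2')) (fn_hom G2 (cx_F A))) a1 a2 :
  fmap (fn_hom G1) (cx_a A) ≡ a1 -> fmap (fn_hom G2) (cx_a A) ≡ a2 ->
  is_colax (A1 a1) -> is_colax (A2 a2) -> is_colax A.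
Proof.
  move=> e1 e2 [h1 h2 h3 h4 h5] [h1' h2' h3' h4' h5'].
  have hn : pointwise_nfold (map_bundle (post (cx_F A)) (t_bundle t)).
    apply: jr_nfold.
      by rewrite -(image_post I1); exact: h4.
    by rewrite -(image_post I2); exact: h4'.
  split=> //.
  - apply: jr_bundle_morphism => //.
    + exact/(image_colax_additive I1 I1' e1).
    + exact/(image_colax_additive I2 I2' e2).
  - apply: jr_hom.
      by rewrite (pk_image_colax_l I1 I1' e1) (pk_image_colax_l' I1 I1' e1) h2.
    by rewrite (pk_image_colax_l I2 I2' e2) (pk_image_colax_l' I2 I2' e2) h2'.
  - apply: jr_hom.
      by rewrite (pk_image_colax_c I1 I1' e1) (pk_image_colax_c' I1 I1' e1) h3.
    by rewrite (pk_image_colax_c I2 I2' e2) (pk_image_colax_c' I2 I2' e2) h3'.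
  - move=> phi hphi.
    have e (G : TwoFunctor L K) :
        fmap (fn_hom G) phi ≡ idto (fn_comp1 G _ _) ∘ fmap (fn_hom G) phi.
      by rewrite pk_comp pk_idto vc_idl.
    apply: jr_pullback.
      rewrite -(image_post_vlift (I := I1) (cx_F A) (e G1)).
      by apply: h5; apply: image_vlift (e G1) hphi.
    rewrite -(image_post_vlift (I := I2) (cx_F A) (e G2)).
    by apply: h5'; apply: image_vlift (e G2) hphi.
Qed.

Lemma is_lax_iff (A : Lax (t_endo t) (t_endo t'))
  (A1 := @Build_Lax K (t_endo (image I1)) (t_endo (image I1')) (fn_hom G1 (lx_F A)))
  (A2 := @Build_Lax K (t_endo (image I2)) (t_endo (image I2')) (fn_hom G2 (lx_F A))) a1 a2 :
  fmap (fn_hom G1) (lx_a A) ≡ a1 -> fmap (fn_hom G2) (lx_a A) ≡ a2 ->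
  is_tangent t' -> is_lax A <-> is_lax (A1 a1) /\ is_lax (A2 a2).
Proof.
  move=> e1 e2 ht; split=> [h|[h1 h2]]; last exact: is_lax_reflect h1 h2.
  by split; [exact: is_lax_image e1 h|exact: is_lax_image e2 h].
Qed.

Lemma is_colax_iff (A : Colax (t_endo t) (t_endo t'))
  (A1 := @Build_Colax K (t_endo (image I1)) (t_endo (image I1')) (fn_hom G1 (cx_F A)))
  (A2 := @Build_Colax K (t_endo (image I2)) (t_endo (image I2')) (fn_hom G2 (cx_F A))) a1 a2 :
  fmap (fn_hom G1) (cx_a A) ≡ a1 -> fmap (fn_hom G2) (cx_a A) ≡ a2 ->
  is_tangent t -> is_colax A <-> is_colax (A1 a1) /\ is_colax (A2 a2).
Proof.
  move=> e1 e2 ht; split=> [h|[h1 h2]]; last exact: is_colax_reflect h1 h2.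
  split; [apply: is_colax_image e1 _ ht h|apply: is_colax_image e2 _ ht h].
    exact: preserves_limits1.
  exact: preserves_limits2.
Qed.

Lemma is_strong_iff (A : Colax (t_endo t) (t_endo t'))
  (A1 := @Build_Colax K (t_endo (image I1)) (t_endo (image I1')) (fn_hom G1 (cx_F A)))
  (A2 := @Build_Colax K (t_endo (image I2)) (t_endo (image I2')) (fn_hom G2 (cx_F A))) a1 a2 :
  fmap (fn_hom G1) (cx_a A) ≡ a1 -> fmap (fn_hom G2) (cx_a A) ≡ a2 ->
  is_tangent t -> is_strong A <-> is_strong (A1 a1) /\ is_strong (A2 a2).
Proof.
  move=> e1 e2 ht; rewrite /is_strong (is_colax_iff e1 e2 ht); split.
  - move=> [[h1 h2] h]; split; split=> //=.
      exact: iso_pk e1 (fmap_iso _ h).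
    exact: iso_pk e2 (fmap_iso _ h).
  - move=> [[h1 i1] [h2 i2]]; split=> //; apply: (jr_iso HJ).
      exact: iso_pk (eq_sym e1) i1.
    exact: iso_pk (eq_sym e2) i2.
Qed.

Lemma is_strict_iff (A : Colax (t_endo t) (t_endo t'))
  (A1 := @Build_Colax K (t_endo (image I1)) (t_endo (image I1')) (fn_hom G1 (cx_F A)))
  (A2 := @Build_Colax K (t_endo (image I2)) (t_endo (image I2')) (fn_hom G2 (cx_F A))) a1 a2 :
  fmap (fn_hom G1) (cx_a A) ≡ a1 -> fmap (fn_hom G2) (cx_a A) ≡ a2 ->
  is_tangent t -> is_strict A <-> is_strict (A1 a1) /\ is_strict (A2 a2).
Proof.
  move=> e1 e2 ht; rewrite /is_strict (is_colax_iff e1 e2 ht) /=.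
  have e (G : TwoFunctor L K) : fmap (fn_hom G) (idm (t_T t' ⊚ cx_F A)) ≡
      idm (fn_hom G (t_T t') ⊚ fn_hom G (cx_F A)) by rewrite fmap_id fn_comp1.
  split.
  - move=> [[h1 h2] h]; split; split=> //.
      by rewrite -e1 -e; apply: fmap_pk h.
    by rewrite -e2 -e; apply: fmap_pk h.
  - move=> [[h1 i1] [h2 i2]]; split=> //; apply: (jr_eq HJ) => /=.
      by rewrite e1 i1 e.
    by rewrite e2 i2 e.
Qed.
End Morphisms.
End Pair.

Definition Dom : TwoFunctor Fib Cat := dom2 _ _.
Definition Cod : TwoFunctor Fib Cat := cod2 _ _.

Lemma fib_jointly_reflect : jointly_reflect Dom Cod.
Proof.
  split.
  - exact: dm_cd_pk_eq.
  - exact: is_sum_lift.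
  - move=> x y J E B N q b pr. exact: fib_pointwise_limit.
  - exact: dm_cd_iso.
Qed.

Definition dom_image (t : TangentData Fib) : Image Dom t :=
  @Build_Image Fib Cat Dom t (fun n => sc_dom (t_b t n)) (sc_dom (t_p t)) (sc_dom (t_z t))
    (sc_dom (t_l t)) (sc_dom (t_c t)) (fun n => eq_refl) eq_refl eq_refl eq_refl eq_refl.
Definition cod_image (t : TangentData Fib) : Image Cod t :=
  @Build_Image Fib Cat Cod t (fun n => sc_cod (t_b t n)) (sc_cod (t_p t)) (sc_cod (t_z t))
    (sc_cod (t_l t)) (sc_cod (t_c t)) (fun n => eq_refl) eq_refl eq_refl eq_refl eq_refl.

(** * Changing the chosen pullbacks *)

Section Rebundle.
Context {C : Category}.

Definition rebundle (b : Bundle C) (n : nat -> C) (k : forall m, Hom (n m) (b_n b m)) :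
  Bundle C :=
  {| b_q := b_q b; b_n := n; b_b := fun m => b_b b m ∘ k m;
     b_pr := fun m j => b_pr b j ∘ k m; b_z := b_z b; b_s := b_s b ∘ k 2 |}.

Context (b : Bundle C) (n : nat -> C) (k : forall m, Hom (n m) (b_n b m))
  (hk : forall m, is_iso (k m)).

Lemma is_sum_comp (X Y : C) (u v w : Hom X (b_E b)) (x : Hom Y X) :
  is_sum b u v w -> is_sum b (u ∘ x) (v ∘ x) (w ∘ x).
Proof. by move=> [m [<- [<- <-]]]; exists (m ∘ x); rewrite !comp_assoc. Qed.

Lemma is_sum_rebundle (X : C) (u v w : Hom X (b_E b)) :
  is_sum (rebundle k) u v w <-> is_sum b u v w.
Proof.
  split; move=> [m [/= m1 [m2 m3]]].
  - by exists (k 2 ∘ m); rewrite !comp_assoc.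
  - have [j [j1 j2]] := hk 2; exists (j ∘ m) => /=.
    by rewrite !comp_assoc -!(comp_assoc _ (k 2) j) j2 !comp_idr.
Qed.

Lemma sum_pk_rebundle u v w : sum_pk (rebundle k) u v w <-> sum_pk b u v w.
Proof.
  split; move=> [X [m [/= m1 [m2 m3]]]].
  - by exists X, (k 2 ∘ m); rewrite -m1 -m2 -m3 !pk_comp !vc_assoc.
  - have [j [j1 j2]] := hk 2; exists X, (j ∘ m) => /=.
    rewrite -m1 -m2 -m3 -!pk_comp.
    by rewrite !comp_assoc -!(comp_assoc _ (k 2) j) j2 !comp_idr.
Qed.

Lemma nfold_rebundle : nfold_pullbacks b -> nfold_pullbacks (rebundle k).
Proof.
  move=> h m; have [j [j1 j2]] := hk m.
  have i (x : C) : is_iso (idm x) by exact: (idto_iso eq_refl).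
  have ij : is_iso j by exists (k m).
  apply: (wide_pullback_iso (i _) (i _) ij _ _ _ (h m)) => /= [||l].
  - by rewrite comp_idl comp_idr.
  - by rewrite comp_idl -comp_assoc j2 comp_idr.
  - by rewrite comp_idl -comp_assoc j2 comp_idr.
Qed.

Lemma additive_rebundle : is_additive_bundle b -> is_additive_bundle (rebundle k).
Proof.
  move=> [h hz hs hl hr hc [u [v [w [h1 [h2 [h3 h4]]]]]]]; split=> //.
  - exact: nfold_rebundle.
  - by rewrite /= comp_assoc hs.
  - exact/is_sum_rebundle.
  - exact/is_sum_rebundle.
  - exact/is_sum_rebundle/is_sum_comp.
  - exists (u ∘ k 3), (v ∘ k 3), (w ∘ k 3).
    by split; [|split; [|split]]; apply/is_sum_rebundle; apply: is_sum_comp.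
Qed.

End Rebundle.

Lemma bundle_morphism_rebundle {C : Category} (b b' : Bundle C) n (k : forall m, Hom (n m) (b_n b m))
  n' (k' : forall m, Hom (n' m) (b_n b' m)) (f : Hom (b_B b) (b_B b')) (g : Hom (b_E b) (b_E b')) :
  (forall m, is_iso (k' m)) -> is_bundle_morphism b b' f g ->
  is_bundle_morphism (rebundle k) (rebundle k') f g.
Proof.
  move=> hk' [hq hz hs]; split=> //=.
  by apply/is_sum_rebundle => //; rewrite !comp_assoc; apply: is_sum_comp.
Qed.

Lemma map_rebundle {C D : Category} (F : Functor C D) (b : Bundle C) n
  (k : forall m, Hom (n m) (b_n b m)) :
  map_bundle F (rebundle k) =
  rebundle (b := map_bundle F b) (n := fun m => F (n m)) (fun m => fmap F (k m)).
Proof. by apply: bundle_eq => //= *; rewrite fmap_comp. Qed.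

Section Retan.
Context {K : TwoCat} (t : TangentData K) (n : nat -> hom (t_ob t) (t_ob t))
  (k : forall m, Hom (n m) (t_n t m)) (hk : forall m, is_iso (k m)).

Definition retan : TangentData K :=
  {| t_ob := t_ob t; t_T := t_T t; t_n := n; t_b := fun m => t_b t m ∘ k m;
     t_pr := fun m j => t_pr t j ∘ k m; t_p := t_p t; t_z := t_z t; t_s := t_s t ∘ k 2;
     t_l := t_l t; t_c := t_c t |}.

Lemma retan_map {D : Category} (F : Functor (hom (t_ob t) (t_ob t)) D) :
  map_bundle F (t_bundle retan) =
  rebundle (b := map_bundle F (t_bundle t)) (n := fun m => F (n m)) (fun m => fmap F (k m)).
Proof. exact: (@map_rebundle _ _ F (t_bundle t) n k). Qed.

Lemma pointwise_nfold_rebundle {X Y : K} (b : Bundle (hom X Y)) n0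
  (k0 : forall m, Hom (n0 m) (b_n b m)) : (forall m, is_iso (k0 m)) ->
  pointwise_nfold b -> pointwise_nfold (rebundle k0).
Proof.
  move=> h0 [h1 h2]; split; first exact: nfold_rebundle.
  move=> X0 f; rewrite map_rebundle; apply: nfold_rebundle => //.
  by move=> m; apply: fmap_iso.
Qed.

Lemma is_tangent_retan : is_tangent t -> is_tangent retan.
Proof.
  move=> [h1 h2 h3 h4 h5 h6 h7 h8 h9 h10 [phi [hv hq]]].
  have hF (Y Z : K) (F : Functor (hom (t_ob t) (t_ob t)) (hom Y Z)) m : is_iso (fmap F (k m)).
    exact: fmap_iso.
  split=> //.
  - exact: (pointwise_nfold_rebundle (b := t_bundle t)).
  - move=> m; rewrite retan_map; apply: pointwise_nfold_rebundle => // m'; exact: hF.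
  - exact: (additive_rebundle (b := t_bundle t)).
  - have h := @bundle_morphism_rebundle _ (t_bundle t)
      (map_bundle (post (t_T t)) (t_bundle t)) n k _ (fun m => fmap (post (t_T t)) (k m)) _ _
      (hF _ _ (post (t_T t))) h4.
    by apply: (@bundle_morphism_of _ _ _ (t_bundle retan)
      (map_bundle (post (t_T t)) (t_bundle retan)) _ _ _ _ _ _ _ _ h) => //; apply: retan_map.
  - have h := @bundle_morphism_rebundle _ (map_bundle (post (t_T t)) (t_bundle t))
      (map_bundle (pre (t_T t)) (t_bundle t)) _ (fun m => fmap (post (t_T t)) (k m)) _
      (fun m => fmap (pre (t_T t)) (k m)) _ _ (hF _ _ (pre (t_T t))) h5.
    by apply: (@bundle_morphism_of _ _ _ (map_bundle (post (t_T t)) (t_bundle retan))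
      (map_bundle (pre (t_T t)) (t_bundle retan)) _ _ _ _ _ _ _ _ h) => //; apply: retan_map.
  - have [j [j1 j2]] := hk 2; have ij : is_iso j by exists (k 2).
    have i (x : hom (t_ob t) (t_ob t)) : is_iso (idm x) by exact: (idto_iso eq_refl).
    have i' X (x : hom X (t_ob t)) : is_iso (idm x) by exact: (idto_iso eq_refl).
    exists (phi ∘ k 2); split.
      apply/is_vlift_pk; rewrite retan_map; apply/sum_pk_rebundle; first by move=> m; apply: hF.
      rewrite -!pk_comp !comp_assoc; apply/is_sum_pk.
      exact: is_sum_comp hv.
    split=> [|X0 f].
    + apply: (@pullback_iso _ (vlift_square t phi) (vlift_square retan (phi ∘ k 2)) j (idm _) (idm _) (idm _)) => //=.
      * by rewrite -comp_assoc j2 comp_idl comp_idr.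
      * by rewrite -!comp_assoc j2 comp_idl comp_idr.
      * by rewrite comp_idl comp_idr.
      * by rewrite comp_idl comp_idr.
      * exact: proj1 hq.
    + apply: (@pullback_iso _ (map_square (pre f) (vlift_square t phi))
       (map_square (pre f) (vlift_square retan (phi ∘ k 2))) (j ▷ f) (idm _) (idm _) (idm _)) => //=.
      * exact: iso_pre.
      * by rewrite -(fmap_comp (pre f)) -comp_assoc j2 comp_idl comp_idr.
      * by rewrite -(fmap_comp (pre f)) -!comp_assoc j2 comp_idl comp_idr.
      * by rewrite comp_idl comp_idr.
      * by rewrite comp_idl comp_idr.
      * exact: (proj2 hq _ f).
Qed.

(** A pairing into the new T₂ is a pairing into the old one composed with an isomorphism, so the sum
    relations agree. The extensionality axioms turn this into an equality, so that structures
    differing only by T_n get literally the same [Core]. *)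
Lemma core_retan : core retan = core t.
Proof.
  rewrite /core.
  have -> : (fun S (u v w : Hom S (e_T (t_endo retan))) => is_sum (t_bundle retan) u v w) =
            (fun S u v w => is_sum (t_bundle t) u v w).
    do 4 (apply: functional_extensionality_dep => ?); apply: propositional_extensionality.
    exact: (is_sum_rebundle (b := t_bundle t)).
  have -> // : (fun Y (F : hom Y (e_ob (t_endo retan))) S (u v w : Hom S (e_T (t_endo retan) ⊚ F)) =>
               is_sum (map_bundle (pre F) (t_bundle retan)) u v w) =
            (fun Y F S u v w => is_sum (map_bundle (pre F) (t_bundle t)) u v w).
  apply: functional_extensionality_dep => Y; apply: functional_extensionality_dep => F.
  do 4 (apply: functional_extensionality_dep => ?); apply: propositional_extensionality.
  have e := @sum_pk_rebundle _ (map_bundle (pre F) (t_bundle t)) _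
    (fun m => fmap (pre F) (k m)) (fun m => fmap_iso (pre F) (hk m)).
  by rewrite !is_sum_pk /=; rewrite -retan_map in e; apply: e.
Qed.
End Retan.

(** * From tangent fibrations to tangent objects of Fib and back *)

Lemma idto_nat_pk {C : Category} (x y x' y' : C) (ex : x = x') (ey : y = y')
  (f : Hom x y) (g : Hom x' y') : g ∘ idto ex = idto ey ∘ f -> f ≡ g.
Proof. by destruct ex, ey; rewrite /= comp_idl comp_idr => ->. Qed.

Section Strict.
Context {K : TwoCat} (t t' : TangentData K) (P : hom (t_ob t) (t_ob t'))
  (comm : t_T t' ⊚ P = P ⊚ t_T t).
Notation A := (@Build_Colax K (t_endo t) (t_endo t') P (idto comm)).

Lemma colax2_idto (e : (t_T t' ⊚ t_T t') ⊚ P = P ⊚ (t_T t ⊚ t_T t)) : colax2 A = idto e.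
Proof.
  apply: pk_inj; rewrite colax2_pk !pk_idto !hc_id /= vc_idl //= ?comp1_assoc //.
  by rewrite -!comp1_assoc comm.
Qed.

Lemma comm2 : (t_T t' ⊚ t_T t') ⊚ P = P ⊚ (t_T t ⊚ t_T t).
Proof. by rewrite -comp1_assoc comm comp1_assoc comm comp1_assoc. Qed.

Section Components.
Context (hA : is_colax A).

Lemma strict_p : t_p t' ▷ P ≡ P ◁ t_p t.
Proof. exact: idto_nat_pk (bm_q (colax_additive hA)). Qed.
Lemma strict_z : t_z t' ▷ P ≡ P ◁ t_z t.
Proof. exact: idto_nat_pk (eq_sym (bm_z (colax_additive hA))). Qed.
Lemma strict_l : t_l t' ▷ P ≡ P ◁ t_l t.
Proof. by have := colax_l hA; rewrite (colax2_idto comm2) /= => /idto_nat_pk. Qed.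
Lemma strict_c : t_c t' ▷ P ≡ P ◁ t_c t.
Proof. have := colax_c hA; rewrite (colax2_idto comm2) /= => e; exact: idto_nat_pk (eq_sym e). Qed.

(** T'_n P is a limit because the limits of the base are pointwise, and P T_n is one because P
    preserves them. Strictness identifies the two diagrams, so their vertices are canonically
    isomorphic. *)
Lemma strict_cells : is_tangent t' -> forall n,
  exists k : Hom (t_n t' n ⊚ P) (P ⊚ t_n t n), is_iso k /\
    vc (pk (P ◁ t_b t n)) (pk k) = pk (t_b t' n ▷ P) /\
    forall j : Fin.t n, vc (pk (P ◁ t_pr t j)) (pk k) = pk (t_pr t' j ▷ P).
Proof.
  move=> ht' n.
  have hi : is_iso (cx_a A) by apply: idto_iso.
  have [k [k1 [k2 k3]]] := nfold_cells_of hi (bm_q (colax_additive hA)) ht'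
    (proj1 (colax_nfold hA)) n.
  exists k; split=> //; split=> [|j].
  - by have := eq_pk k2; rewrite /= !pk_comp !pk_idto => ->; rewrite vc_idl.
  - by have := eq_pk (k3 j); rewrite /= !pk_comp !pk_idto => ->; rewrite vc_idl.
Qed.

(** A comparison is determined by its legs, hence equals the pairing that additivity of P supplies,
    and that one is compatible with the additions. *)
Lemma strict_s (k : Hom (t_n t' 2 ⊚ P) (P ⊚ t_n t 2)) :
  (forall j : Fin.t 2, vc (pk (P ◁ t_pr t j)) (pk k) = pk (t_pr t' j ▷ P)) ->
  vc (pk (P ◁ t_s t)) (pk k) = pk (t_s t' ▷ P).
Proof.
  move=> hk; have [m [/= m1 [m2 m3]]] := bm_s (colax_additive hA).
  have e (x : Hom (t_n t' 2) (t_T t')) : idto comm ∘ x ▷ P ≡ x ▷ P.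
    by rewrite pk_comp pk_idto vc_idl.
  have -> : k = m.
    apply: (wide_pullback_joint fst2 (proj1 (colax_nfold hA) 2)) => j /=.
    apply: pk_inj; rewrite pk_comp hk -e.
    by case: (fin2 j) => ->; rewrite ?m1 ?m2.
  by rewrite -pk_comp m3 e.
Qed.
End Components.

(** When the squares of the T_n commute on the nose, identities serve as the comparison cells of
    [is_strong_of], from which preservation of the limits follows. *)
Lemma is_strict_of (en : forall n, t_n t' n ⊚ P = P ⊚ t_n t n) : is_tangent t' ->
  t_p t' ▷ P ≡ P ◁ t_p t -> t_z t' ▷ P ≡ P ◁ t_z t -> t_s t' ▷ P ≡ P ◁ t_s t ->
  t_l t' ▷ P ≡ P ◁ t_l t -> t_c t' ▷ P ≡ P ◁ t_c t ->
  (forall n, t_b t' n ▷ P ≡ P ◁ t_b t n) ->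
  (forall n (j : Fin.t n), t_pr t' j ▷ P ≡ P ◁ t_pr t j) -> is_strict A.
Proof.
  move=> ht' hp hz hs hl hc hb hpr.
  suff [h _] : is_strong A by split=> //=; rewrite pk_idto.
  apply: is_strong_of => //=.
    - exact: idto_iso.
    - split => /=; [exact: idto_nat|exact: eq_sym (idto_nat _ _ _)|].
      by exists (idto (en 2)) => /=; split; [|split]; apply: idto_nat.
    - by rewrite (colax2_idto comm2); apply: idto_nat.
    - by rewrite (colax2_idto comm2); apply: eq_sym; apply: idto_nat.
    - move=> n; exists (idto (en n)); split; first exact: idto_iso.
      by split=> [|j]; apply: idto_nat.
Qed.
End Strict.

Section Strictify.
Context {X' X : Category} (P : Functor X' X) (c : Cleavage P) (N : Functor X' X')
  (H : Functor X' X) (k : NatTrans H (functor_comp P N)) (hk : forall x, is_iso (k x)).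

(* Cartesian lifts of isomorphisms are isomorphisms, so N can be transported to
   a functor lying strictly over H. *)
Definition str_map (x : X') : Hom (cl_ob c (k x)) (N x) := cl_map c (k x : Hom (H x) (P (N x))).

Lemma str_map_iso (x : X') : is_iso (str_map x).
Proof.
  apply: (cartesian_over_iso (P := P)); first exact: cl_cart.
  exact: iso_pk (eq_sym (cl_over c _)) (hk x).
Qed.

Definition str_inv (x : X') : {g : Hom (N x) (cl_ob c (k x)) |
    g ∘ str_map x = idm _ /\ str_map x ∘ g = idm _} :=
  constructive_indefinite_description _ (str_map_iso x).

Definition str_functor : Functor X' X'.
Proof.
  unshelve refine {| fob := fun x => cl_ob c (k x);
    fmap := fun x y f => proj1_sig (str_inv y) ∘ fmap N f ∘ str_map x |}.
  - by move=> x; rewrite fmap_id comp_idr; case: (proj2_sig (str_inv x)).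
  - move=> x y z g f; rewrite fmap_comp !comp_assoc.
    have [_ e] := proj2_sig (str_inv y).
    by rewrite -(comp_assoc _ (str_map y)) e comp_idr.
Defined.

Definition str_nt : NatTrans str_functor N.
Proof.
  unshelve refine {| nt := str_map : forall x, Hom (str_functor x) (N x) |}.
  move=> x y f /=; rewrite !comp_assoc.
  by have [_ ->] := proj2_sig (str_inv y); rewrite comp_idl.
Defined.

Lemma str_over (x : X') : fmap P (str_map x) ≡ k x.
Proof. exact: cl_over. Qed.

(** A cartesian lift of k x has its source over H x on the nose, which settles objects. On morphisms
    the two functors agree after composition with the isomorphism k y, by naturality of k and of
    [str_nt]. *)
Lemma str_comm : functor_comp P str_functor = H.
Proof.
  apply: functor_eq => [x|x y f]; first exact: (f_equal (@src _) (str_over x)).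
  have e : vc (pk (k y)) (pk (fmap P (fmap str_functor f))) = vc (pk (k y)) (pk (fmap H f)).
    rewrite -[RHS]pk_comp (nt_nat k f) pk_comp -(str_over x) -(str_over y) -!pk_comp.
    by rewrite -!fmap_comp; congr (pk (fmap P _)); apply: (nt_nat str_nt).
  have [j [j1 j2]] := hk y.
  have := f_equal (vc (pk j)) e; rewrite !vc_assoc //=.
    exact: (f_equal (@src _) (str_over y)).
  rewrite -!pk_comp j1 !vc_idl //= ?comp_idl //.
  exact: (f_equal (@src _) (str_over y)).
Qed.
End Strictify.

(** To factor psi through N phi, its legs are factored through phi and T phi, and the factors are
    assembled by the limit at E0. They are compatible because phi is cartesian, and the result lies
    over m because P preserves the limit. The leg to the base of the bundle is factored separately,
    which covers an empty J. *)
Lemma nfold_cartesian {X' X : Category} (P : Functor X' X) (T N : Functor X' X')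
  (p : forall x, Hom (T x) x) (b : forall x, Hom (N x) x) (J : Type)
  (pr : J -> forall x, Hom (N x) (T x)) :
  (forall x y (f : Hom x y), p y ∘ fmap T f = f ∘ p x) ->
  (forall x y (f : Hom x y), b y ∘ fmap N f = f ∘ b x) ->
  (forall j x y (f : Hom x y), pr j y ∘ fmap N f = fmap T f ∘ pr j x) ->
  (forall x, is_limit (fun _ : J => p x) (b x) (fun j => pr j x)) ->
  (forall x, is_limit (fun _ : J => fmap P (p x)) (fmap P (b x)) (fun j => fmap P (pr j x))) ->
  forall (E0 E1 : X') (phi : Hom E0 E1), is_cartesian P phi ->
  is_cartesian P (fmap T phi) -> is_cartesian P (fmap N phi).
Proof.
  move=> np nb npr hl hP E0 E1 phi h hT E psi m em.
  have pb x j : p x ∘ pr j x = b x by exact: (proj1 (hl x) j).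
  case: (h _ (b E1 ∘ psi) (fmap P (b E0) ∘ m)) => [|x0 [[x1 x2] _]].
    by rewrite fmap_comp comp_assoc -fmap_comp -nb fmap_comp -comp_assoc em.
  have hj j : exists xi, fmap P xi = fmap P (pr j E0) ∘ m /\ fmap T phi ∘ xi = pr j E1 ∘ psi.
    case: (hT _ (pr j E1 ∘ psi) (fmap P (pr j E0) ∘ m)) => [|xi [hx _]]; last by exists xi.
    by rewrite fmap_comp comp_assoc -fmap_comp -npr fmap_comp -comp_assoc em.
  pose xi j := proj1_sig (constructive_indefinite_description _ (hj j)).
  have xi1 j : fmap P (xi j) = fmap P (pr j E0) ∘ m.
    by case: (proj2_sig (constructive_indefinite_description _ (hj j))).
  have xi2 j : fmap T phi ∘ xi j = pr j E1 ∘ psi.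
    by case: (proj2_sig (constructive_indefinite_description _ (hj j))).
  have xi0 j : p E0 ∘ xi j = x0.
    apply: (cartesian_joint h).
      by rewrite x1 fmap_comp xi1 comp_assoc -fmap_comp pb.
    by rewrite x2 comp_assoc -np -comp_assoc xi2 comp_assoc pb.
  have [n [[n1 n2] nu]] := proj2 (hl E0) _ _ _ xi0.
  exists n; split; first split.
  - apply: (limit_joint (hP E0)) => [|j]; rewrite -fmap_comp.
      by rewrite n1 x1.
    by rewrite n2 xi1.
  - apply: (limit_joint (hl E1)) => [|j]; rewrite comp_assoc.
      by rewrite nb -comp_assoc n1 x2.
    by rewrite npr -comp_assoc n2 xi2.
  - move=> n' [e1 e2]; apply: nu; split.
      apply: (cartesian_joint h); first by rewrite fmap_comp e1 x1.
      by rewrite x2 comp_assoc -nb -comp_assoc e2.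
    move=> j; apply: (cartesian_joint hT); first by rewrite fmap_comp e1 xi1.
    by rewrite xi2 comp_assoc -npr -comp_assoc e2.
Qed.

Lemma tangent_eta {K : TwoCat} (t : TangentData K) :
  {| t_ob := t_ob t; t_T := t_T t; t_n := t_n t; t_b := t_b t; t_pr := @t_pr K t;
     t_p := t_p t; t_z := t_z t; t_s := t_s t; t_l := t_l t; t_c := t_c t |} = t.
Proof. by case: t. Qed.

Section FromTangentFibration.
Context (Q : TangentFibration).
Notation tot := (t_data (tf_tot Q)).
Notation base := (t_data (tf_base Q)).
Notation P := (tf_fun Q).

Lemma tf_is_colax : is_colax (@Build_Colax Cat (t_endo tot) (t_endo base) P (idto (tf_comm Q))).
Proof. exact: proj1 (tf_strict Q). Qed.

Definition tf_cell n := constructive_indefinite_description _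
  (strict_cells tf_is_colax (t_tangent (tf_base Q)) n).
Definition tf_k n : NatTrans (functor_comp (t_n base n) P) (functor_comp P (t_n tot n)) :=
  proj1_sig (tf_cell n).

Lemma tf_k_iso n x : is_iso (tf_k n x).
Proof.
  have [[j [j1 j2]] _] := proj2_sig (tf_cell n); exists (nt j x); split.
  - exact: (f_equal (fun a : NatTrans _ _ => nt a x) j1).
  - exact: (f_equal (fun a : NatTrans _ _ => nt a x) j2).
Qed.

Definition tf_n n : Functor (t_ob tot) (t_ob tot) := str_functor (tf_cl Q) (tf_k_iso n).
Definition tf_str n : NatTrans (tf_n n) (t_n tot n) := str_nt (tf_cl Q) (tf_k_iso n).

Definition tf_fibration : Fibration :=
  {| f_tot := t_ob tot; f_base := t_ob base; f_fun := P; f_cl := tf_cl Q |}.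

Lemma tf_n_comm n : functor_comp P (tf_n n) = functor_comp (t_n base n) P.
Proof. exact: str_comm. Qed.

(** On a lift, [tf_n n] is T_n conjugated by isomorphisms, which are cartesian. T_n itself keeps the
    lift cartesian by [nfold_cartesian], because T does and because P preserves the n-fold
    pullbacks. *)
Lemma tf_n_cleavage n : preserves_cleavage (tf_cl Q) (tf_cl Q) (t_n base n) (tf_n n).
Proof.
  apply/(preserves_cleavage_iff _ _ (tf_n_comm n)) => A E' f.
  have hc : functor_comp P (t_T tot) = functor_comp (t_T base) P := eq_sym (tf_comm Q).
  have hT := proj1 (preserves_cleavage_iff _ _ hc) (@tf_T Q) A E' f.
  have iso_inv x : is_iso (proj1_sig (str_inv (tf_cl Q) (tf_k_iso n) x)).
    have [e1 e2] := proj2_sig (str_inv (tf_cl Q) (tf_k_iso n) x).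
    by exists (str_map (tf_cl Q) (tf_k n) x).
  apply: cartesian_comp; last by apply/iso_cartesian/str_map_iso/tf_k_iso.
  apply: cartesian_comp; first by apply: iso_cartesian.
  apply: (nfold_cartesian (p := nt (t_p tot)) (b := nt (t_b tot n))
    (pr := fun j => nt (t_pr tot j)) _ _ _ _ _ _ hT).
  - exact: (nt_nat (t_p tot)).
  - exact: (nt_nat (t_b tot n)).
  - by move=> j; exact: (nt_nat (t_pr tot j)).
  - have /pointwise_nfold_limit h := tg_pullbacks (t_tangent (tf_tot Q)).
    by have /cat_pointwise_limit := h n.
  - have /pointwise_nfold_limit h := colax_nfold tf_is_colax.
    have /cat_pointwise_limit h' := h n.
    move=> x; apply: limit_eq (h' x) => [j||j] /=; exact: comp_idl.
  - exact: cl_cart.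
Qed.

Lemma tf_str_pk n : @hcomp Cat _ _ _ _ _ _ _ (idm P) (tf_str n) ≡ (tf_k n : @Hom (@hom Cat _ _) _ _).
Proof.
  apply: nt_pk_eq; [exact: tf_n_comm|by []|].
  by move=> x /=; rewrite comp_idl; apply: cl_over.
Qed.

(** A cell out of T_n that lies over x only through the comparison [tf_k n] lies over x strictly
    once composed with [tf_str n], since the latter is a lift of this comparison. All components of
    [tf_data] out of T_n arise in this way. *)
Lemma tf_lift n (S' : @hom Cat (t_ob tot) (t_ob tot)) (S : @hom Cat (t_ob base) (t_ob base))
  (x' : Hom (t_n tot n) S') (x : Hom (t_n base n) S) :
  vc (pk (P ◁ x')) (pk (tf_k n : @Hom (@hom Cat _ _) _ _)) = pk (x ▷ P) ->
  P ◁ (x' ∘ (tf_str n : @Hom (@hom Cat _ _) _ _)) ≡ x ▷ P.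
Proof. by move=> <-; rewrite -tf_str_pk -pk_comp; congr pk; apply: (fmap_comp (post P)). Qed.

Definition tf_T1 : @hom Fib tf_fibration tf_fibration :=
  exist _ (@Build_Sq Cat (f_mor1 tf_fibration) (f_mor1 tf_fibration) (t_T tot) (t_T base)
    (eq_sym (tf_comm Q))) (@tf_T Q).

Definition tf_n1 n : @hom Fib tf_fibration tf_fibration :=
  exist _ (@Build_Sq Cat (f_mor1 tf_fibration) (f_mor1 tf_fibration) (tf_n n) (t_n base n)
    (tf_n_comm n)) (@tf_n_cleavage n).

Definition tf_b1 n : Hom (tf_n1 n) (@id1 Fib tf_fibration) :=
  @Build_SqCell Cat (f_mor1 tf_fibration) (f_mor1 tf_fibration) (proj1_sig (tf_n1 n))
    (sq_id (f_mor1 tf_fibration)) (t_b tot n ∘ (tf_str n : @Hom (@hom Cat _ _) _ _)) (t_b base n)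
    (tf_lift (proj1 (proj2 (proj2_sig (tf_cell n))))).

Definition tf_pr1 n (j : Fin.t n) : Hom (tf_n1 n) tf_T1 :=
  @Build_SqCell Cat (f_mor1 tf_fibration) (f_mor1 tf_fibration) (proj1_sig (tf_n1 n))
    (proj1_sig tf_T1) (t_pr tot j ∘ (tf_str n : @Hom (@hom Cat _ _) _ _)) (t_pr base j)
    (tf_lift (proj2 (proj2 (proj2_sig (tf_cell n))) j)).

Definition tf_s1 : Hom (tf_n1 2) tf_T1 :=
  @Build_SqCell Cat (f_mor1 tf_fibration) (f_mor1 tf_fibration) (proj1_sig (tf_n1 2))
    (proj1_sig tf_T1) (t_s tot ∘ (tf_str 2 : @Hom (@hom Cat _ _) _ _)) (t_s base)
    (tf_lift (strict_s tf_is_colax (proj2 (proj2 (proj2_sig (tf_cell 2)))))).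

Definition tf_p1 : Hom tf_T1 (@id1 Fib tf_fibration) :=
  @Build_SqCell Cat (f_mor1 tf_fibration) (f_mor1 tf_fibration) (proj1_sig tf_T1)
    (sq_id (f_mor1 tf_fibration)) (t_p tot) (t_p base) (eq_sym (strict_p tf_is_colax)).

Definition tf_z1 : Hom (@id1 Fib tf_fibration) tf_T1 :=
  @Build_SqCell Cat (f_mor1 tf_fibration) (f_mor1 tf_fibration) (sq_id (f_mor1 tf_fibration))
    (proj1_sig tf_T1) (t_z tot) (t_z base) (eq_sym (strict_z tf_is_colax)).

Definition tf_l1 : Hom tf_T1 (tf_T1 ⊚ tf_T1) :=
  @Build_SqCell Cat (f_mor1 tf_fibration) (f_mor1 tf_fibration) (proj1_sig tf_T1)
    (sq_comp (proj1_sig tf_T1) (proj1_sig tf_T1)) (t_l tot) (t_l base)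
    (eq_sym (strict_l tf_is_colax)).

Definition tf_c1 : Hom (tf_T1 ⊚ tf_T1) (tf_T1 ⊚ tf_T1) :=
  @Build_SqCell Cat (f_mor1 tf_fibration) (f_mor1 tf_fibration)
    (sq_comp (proj1_sig tf_T1) (proj1_sig tf_T1)) (sq_comp (proj1_sig tf_T1) (proj1_sig tf_T1))
    (t_c tot) (t_c base) (eq_sym (strict_c tf_is_colax)).

Definition tf_data : TangentData Fib :=
  {| t_ob := tf_fibration : Fib; t_T := tf_T1; t_n := tf_n1; t_b := tf_b1; t_pr := tf_pr1;
     t_p := tf_p1; t_z := tf_z1; t_s := tf_s1; t_l := tf_l1; t_c := tf_c1 |}.

Definition tf_retan : TangentData Cat :=
  retan (t := tot) (n := tf_n) (fun n => tf_str n : @Hom (@hom Cat _ _) _ _).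

Lemma tf_str_iso n : is_iso (tf_str n : @Hom (@hom Cat _ _) _ _).
Proof.
  pose g x := proj1_sig (str_inv (tf_cl Q) (tf_k_iso n) x).
  have hg x y (f : Hom x y) : g y ∘ fmap (t_n tot n) f = fmap (tf_n n) f ∘ g x.
    have [e1 e2] := proj2_sig (str_inv (tf_cl Q) (tf_k_iso n) x).
    by rewrite /= -!comp_assoc e2 comp_idr.
  exists (@Build_NatTrans _ _ (t_n tot n) (tf_n n) g hg); split; apply: nt_eq => x /=.
    by have [] := proj2_sig (str_inv (tf_cl Q) (tf_k_iso n) x).
  by have [] := proj2_sig (str_inv (tf_cl Q) (tf_k_iso n) x).
Qed.

Lemma tf_retan_tangent : is_tangent tf_retan.
Proof. exact: is_tangent_retan tf_str_iso (t_tangent tot). Qed.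

(** The strictification changes the T_n of the total category only, and does so exactly by [retan];
    both sides are therefore convertible. *)
Lemma tf_dom_image : image (dom_image tf_data) = tf_retan.
Proof. reflexivity. Qed.

Lemma tf_cod_image : image (cod_image tf_data) = tf_base Q.
Proof. exact: (tangent_eta base). Qed.

Definition tf_tangent : TangentObject Fib.
Proof.
  exists tf_data; apply: (is_tangent_reflect fib_jointly_reflect (I1 := dom_image tf_data)
    (I2 := cod_image tf_data)).
    by rewrite tf_dom_image; apply: tf_retan_tangent.
  by rewrite tf_cod_image; apply: t_tangent.
Defined.
End FromTangentFibration.

(** * The tangent fibration of a tangent object of Fib *)

Section ToTangentFibration.
Context (t : TangentObject Fib).

Definition dom_tangent : TangentObject Cat :=
  {| t_data := image (dom_image t);
     t_tangent := is_tangent_image (dom_image t) (preserves_limits1 fib_jointly_reflect)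
       (t_tangent t) |}.
Definition cod_tangent : TangentObject Cat :=
  {| t_data := image (cod_image t);
     t_tangent := is_tangent_image (cod_image t) (preserves_limits2 fib_jointly_reflect)
       (t_tangent t) |}.

Definition fib_comm : t_T cod_tangent ⊚ (f_fun (t_ob t) : @hom Cat (t_ob dom_tangent) (t_ob cod_tangent)) =
  (f_fun (t_ob t) : @hom Cat (t_ob dom_tangent) (t_ob cod_tangent)) ⊚ t_T dom_tangent :=
  eq_sym (sq_comm (proj1_sig (t_T t))).

Definition to_tf : TangentFibration.
Proof.
  unshelve refine {| tf_tot := dom_tangent; tf_base := cod_tangent; tf_fun := f_fun (t_ob t);
    tf_cl := f_cl (t_ob t); tf_comm := fib_comm |}.
  - apply: is_strict_of.
    + by move=> n; exact: eq_sym (sq_comm (proj1_sig (t_n t n))).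
    + exact: (t_tangent cod_tangent).
    + exact: eq_sym (sc_comm (t_p t)).
    + exact: eq_sym (sc_comm (t_z t)).
    + exact: eq_sym (sc_comm (t_s t)).
    + exact: eq_sym (sc_comm (t_l t)).
    + exact: eq_sym (sc_comm (t_c t)).
    + by move=> n; exact: eq_sym (sc_comm (t_b t n)).
    + by move=> n j; exact: eq_sym (sc_comm (t_pr t j)).
  - exact: proj2_sig (t_T t).
Defined.
End ToTangentFibration.

(** * Lax morphisms as squares *)

Section Squares.
Context {K : TwoCat} {A B A' B' : Endo K}
  (P : hom (e_ob A) (e_ob A')) (Q : hom (e_ob B) (e_ob B'))
  (c : e_T A' ⊚ P = P ⊚ e_T A) (d : e_T B' ⊚ Q = Q ⊚ e_T B).

(** The constraints of P and Q are identities and drop out of the pasted 2-cells. What is left of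
    each composite is one whiskered constraint, so the equation is the one that makes a pair of
    constraints a cell of squares. *)
Lemma lax_square (F : Lax A B) (F' : Lax A' B') : Q ⊚ lx_F F = lx_F F' ⊚ P ->
  lax_comp (@Build_Lax K B B' Q (idto (eq_sym d))) F = lax_comp F' (@Build_Lax K A A' P (idto (eq_sym c))) <->
  Q ◁ lx_a F ≡ lx_a F' ▷ P.
Proof.
  move=> eF.
  have e1 : pk (lx_a (lax_comp (@Build_Lax K B B' Q (idto (eq_sym d))) F)) = pk (Q ◁ lx_a F).
    by rewrite lax_comp_pk /= pk_idto hc_id vc_idl //= comp1_assoc -d.
  have e2 : pk (lx_a (lax_comp F' (@Build_Lax K A A' P (idto (eq_sym c))))) = pk (lx_a F' ▷ P).
    by rewrite lax_comp_pk /= pk_idto hc_id vc_idr //= -comp1_assoc c.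
  split=> e; first by rewrite -e1 -e2 e.
  by apply: Lax_eq; rewrite // e1 e2.
Qed.

Lemma colax_square (F : Colax A B) (F' : Colax A' B') : Q ⊚ cx_F F = cx_F F' ⊚ P ->
  colax_comp (@Build_Colax K B B' Q (idto d)) F =
  colax_comp F' (@Build_Colax K A A' P (idto c)) <->
  Q ◁ cx_a F ≡ cx_a F' ▷ P.
Proof.
  move=> eF.
  have e1 : pk (cx_a (colax_comp (@Build_Colax K B B' Q (idto d)) F)) =
            pk (Q ◁ cx_a F).
    by rewrite colax_comp_pk /= pk_idto hc_id vc_idr //= comp1_assoc -d.
  have e2 : pk (cx_a (colax_comp F' (@Build_Colax K A A' P (idto c)))) =
            pk (cx_a F' ▷ P).
    by rewrite colax_comp_pk /= pk_idto hc_id vc_idl //= -comp1_assoc c.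
  split=> e; first by rewrite -e1 -e2 e.
  by apply: Colax_eq; rewrite // e1 e2.
Qed.
End Squares.

Lemma lax_eta {K : TwoCat} {A B : Endo K} (F : Lax A B) :
  {| lx_F := lx_F F; lx_a := lx_a F |} = F.
Proof. by case: F. Qed.
Lemma colax_eta {K : TwoCat} {A B : Endo K} (F : Colax A B) :
  {| cx_F := cx_F F; cx_a := cx_a F |} = F.
Proof. by case: F. Qed.

Lemma lax_paste_fmap {L K : TwoCat} (G : TwoFunctor L K) (A B C : Endo L) (g : Lax B C) (f : Lax A B) :
  pk (fmap (fn_hom G) (lx_a (lax_comp g f))) =
  vc (hc (pk (fmap (fn_hom G) (lx_a g))) (pid (fn_hom G (lx_F f))))
    (hc (pid (fn_hom G (lx_F g))) (pk (fmap (fn_hom G) (lx_a f)))).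
Proof.
  rewrite [lx_a _]/= /lax_paste /asc /asc' !pk_fmap_comp !pk_fmap_idto pk_image_post pk_image_pre.
  rewrite [vc (pid _) (hc _ _)]vc_idl; first exact: (eq_sym (fn_comp1 G _ _)).
  rewrite [vc (hc _ _) (pid _)]vc_idr; first by rewrite /= -fn_comp1 comp1_assoc.
  rewrite vc_idr // src_vc /= -?fn_comp1 ?comp1_assoc //.
Qed.

Lemma lax_cell_pk {K : TwoCat} {A B : Endo K} {F G F' G' : LaxCat A B} {a : Hom F G}
  {a' : Hom F' G'} : a ≡ a' -> lxc a ≡ lxc a'.
Proof. exact: (f_equal (fun b : Arrow (LaxCat A B) => pk (lxc (arr b)))). Qed.

Section Representation.
Context (K : TwoCat) (O : Type) (i : O -> ArrTwo K)
  (S : forall x y : O, hom (i x) (i y) -> Prop)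
  (Sid : forall x, S x x (id1 (i x)))
  (Scomp : forall x y z (g : hom (i y) (i z)) (f : hom (i x) (i y)),
     S y z g -> S x y f -> S x z (g ⊚ f)).
Notation L := (SubTwo Sid Scomp).
Notation dm := (fmap (domF _ _)).
Notation cd := (fmap (codF _ _)).
Notation DD := (dom2 Sid Scomp).
Notation CC := (cod2 Sid Scomp).

Definition endo_dom (A : Endo L) : Endo K :=
  {| e_ob := m_dom (i (e_ob A)); e_T := domF _ _ (e_T A) |}.
Definition endo_cod (A : Endo L) : Endo K :=
  {| e_ob := m_cod (i (e_ob A)); e_T := codF _ _ (e_T A) |}.

Definition lax_dom {A B : Endo L} (F : Lax A B) : Lax (endo_dom A) (endo_dom B) :=
  @Build_Lax K (endo_dom A) (endo_dom B) (domF _ _ (lx_F F)) (dm (lx_a F)).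
Definition lax_cod {A B : Endo L} (F : Lax A B) : Lax (endo_cod A) (endo_cod B) :=
  @Build_Lax K (endo_cod A) (endo_cod B) (codF _ _ (lx_F F)) (cd (lx_a F)).

Definition endo_comm (A : Endo L) : Prop :=
  e_T (endo_cod A) ⊚ m_arr (i (e_ob A)) = m_arr (i (e_ob A)) ⊚ e_T (endo_dom A).

Definition lax_mor (A : Endo L) (c : endo_comm A) : Mor1 (@LaxTwo K) :=
  @Build_Mor1 (@LaxTwo K) (endo_dom A) (endo_cod A)
    (@Build_Lax K (endo_dom A) (endo_cod A) (m_arr (i (e_ob A))) (idto (eq_sym c))).

Section Homs.
Context (A B : Endo L) (c : endo_comm A) (d : endo_comm B).

Lemma lax_sq_comm (F : Lax A B) :
  lax_comp (@Build_Lax K (endo_dom B) (endo_cod B) (m_arr (i (e_ob B))) (idto (eq_sym d))) (lax_dom F) =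
  lax_comp (lax_cod F) (@Build_Lax K (endo_dom A) (endo_cod A) (m_arr (i (e_ob A))) (idto (eq_sym c))).
Proof. by apply/lax_square; [exact: sq_comm|exact: (sc_comm (lx_a F))]. Qed.

Definition lax_sq (F : Lax A B) : Sq (lax_mor c) (lax_mor d) :=
  @Build_Sq (@LaxTwo K) (lax_mor c) (lax_mor d) (lax_dom F) (lax_cod F) (lax_sq_comm F).

Lemma lax_dom_nat (F G : Lax A B) (t : LaxCell F G) :
  e_T (endo_dom B) ◁ dm (lxc t) ∘ lx_a (lax_dom F) = lx_a (lax_dom G) ∘ dm (lxc t) ▷ e_T (endo_dom A).
Proof.
  have := f_equal (fun a => dm a) (lxc_nat t); rewrite !fmap_comp => e.
  exact: e.
Qed.
Lemma lax_cod_nat (F G : Lax A B) (t : LaxCell F G) :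
  e_T (endo_cod B) ◁ cd (lxc t) ∘ lx_a (lax_cod F) = lx_a (lax_cod G) ∘ cd (lxc t) ▷ e_T (endo_cod A).
Proof.
  have := f_equal (fun a => cd a) (lxc_nat t); rewrite !fmap_comp => e.
  exact: e.
Qed.

Definition lax_dom_cell (F G : Lax A B) (t : LaxCell F G) : LaxCell (lax_dom F) (lax_dom G) :=
  @Build_LaxCell K _ _ (lax_dom F) (lax_dom G) (dm (lxc t)) (lax_dom_nat t).
Definition lax_cod_cell (F G : Lax A B) (t : LaxCell F G) : LaxCell (lax_cod F) (lax_cod G) :=
  @Build_LaxCell K _ _ (lax_cod F) (lax_cod G) (cd (lxc t)) (lax_cod_nat t).

Lemma lax_sq_cell_comm (F G : Lax A B) (t : LaxCell F G) :
  (m_arr (lax_mor d) ◁ (lax_dom_cell t : @Hom (@hom (@LaxTwo K) _ _) _ _)) ≡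
  ((lax_cod_cell t : @Hom (@hom (@LaxTwo K) _ _) _ _) ▷ m_arr (lax_mor c)).
Proof.
  apply: LaxCell_pk_eq; [exact: lax_sq_comm|exact: lax_sq_comm|].
  exact: (sc_comm (lxc t)).
Qed.

Definition lax_sq_cell (F G : Lax A B) (t : LaxCell F G) : SqCell (lax_sq F) (lax_sq G) :=
  @Build_SqCell (@LaxTwo K) (lax_mor c) (lax_mor d) (lax_sq F) (lax_sq G)
    (lax_dom_cell t) (lax_cod_cell t) (lax_sq_cell_comm t).

Definition lax_sqF : Functor (LaxCat A B) (SqCat (lax_mor c) (lax_mor d)).
Proof.
  unshelve refine {| fob := lax_sq : LaxCat A B -> SqCat (lax_mor c) (lax_mor d);
                     fmap := lax_sq_cell |}.
  - move=> F; apply: SqCell_eq; apply: LaxCell_eq.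
      exact: (fmap_id (domF _ _) (lx_F F)).
    exact: (fmap_id (codF _ _) (lx_F F)).
  - move=> F G H t s; apply: SqCell_eq; apply: LaxCell_eq.
      exact: (fmap_comp (domF _ _) (lxc t) (lxc s)).
    exact: (fmap_comp (codF _ _) (lxc t) (lxc s)).
Defined.

Lemma lax_sq_inj (F G : Lax A B) : lax_sq F = lax_sq G -> F = G.
Proof.
  move=> e.
  have ed := f_equal (fun f => sq_dom f) e; have ec := f_equal (fun f => sq_cod f) e.
  apply: Lax_eq.
    apply: sub_eq; apply: Sq_eq; [exact: (f_equal (@lx_F _ _ _) ed)|exact: (f_equal (@lx_F _ _ _) ec)].
  apply: dm_cd_pk_eq.
    exact: (f_equal (fun f : Lax _ _ => pk (lx_a f)) ed).
  exact: (f_equal (fun f : Lax _ _ => pk (lx_a f)) ec).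
Qed.

Lemma lax_sq_faithful (F G : Lax A B) (s t : LaxCell F G) : lax_sq_cell s = lax_sq_cell t -> s = t.
Proof.
  move=> e; apply: LaxCell_eq; apply: dm_cd_eq.
    exact: (f_equal (fun a : SqCell (lax_sq F) (lax_sq G) => lxc (sc_dom a : LaxCell _ _)) e).
  exact: (f_equal (fun a : SqCell (lax_sq F) (lax_sq G) => lxc (sc_cod a : LaxCell _ _)) e).
Qed.

Lemma lax_sq_full (F G : Lax A B) (b : SqCell (lax_sq F) (lax_sq G)) :
  exists t : LaxCell F G, lax_sq_cell t = b.
Proof.
  pose bd : LaxCell (lax_dom F) (lax_dom G) := sc_dom b.
  pose bc : LaxCell (lax_cod F) (lax_cod G) := sc_cod b.
  have hb : m_arr (i (e_ob B)) ◁ lxc bd ≡ lxc bc ▷ m_arr (i (e_ob A)).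
    exact: (lax_cell_pk (sc_comm b)).
  pose m : Hom (lx_F F) (lx_F G) := @Build_SqCell K (i (e_ob A)) (i (e_ob B))
    (proj1_sig (lx_F F)) (proj1_sig (lx_F G)) (lxc bd) (lxc bc) hb.
  have hm : e_T B ◁ m ∘ lx_a F = lx_a G ∘ m ▷ e_T A.
    apply: dm_cd_eq; rewrite !fmap_comp; [exact: (lxc_nat bd)|exact: (lxc_nat bc)].
  exists (Build_LaxCell hm); apply: SqCell_eq; exact: LaxCell_eq.
Qed.

(** Membership in [S] is required for every proof [e] of commutation, because that proof is only
    extracted from [H] afterwards. *)
Lemma lax_sq_surj (H : Sq (lax_mor c) (lax_mor d))
  (F := fun e => @Build_Sq K (i (e_ob A)) (i (e_ob B)) (lx_F (sq_dom H)) (lx_F (sq_cod H)) e) :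
  (forall e, S (F e)) -> exists G : Lax A B, lax_sq G = H.
Proof.
  move=> hF.
  have e : m_arr (i (e_ob B)) ⊚ lx_F (sq_dom H) = lx_F (sq_cod H) ⊚ m_arr (i (e_ob A)).
    exact: (f_equal (@lx_F _ _ _) (sq_comm H)).
  pose f : @hom L (e_ob A) (e_ob B) := exist _ (F e) (hF e).
  have he := proj1 (@lax_square K (endo_dom A) (endo_dom B) (endo_cod A) (endo_cod B) _ _ c d
    (sq_dom H) (sq_cod H) e) (sq_comm H).
  pose a : Hom (f ⊚ e_T A) (e_T B ⊚ f) := @Build_SqCell K (i (e_ob A)) (i (e_ob B))
    (proj1_sig (f ⊚ e_T A)) (proj1_sig (e_T B ⊚ f)) (lx_a (sq_dom H)) (lx_a (sq_cod H)) he.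
  exists (Build_Lax a).
  by apply: Sq_eq; [exact: (lax_eta (sq_dom H))|exact: (lax_eta (sq_cod H))].
Qed.
End Homs.

Lemma lax_dom_id (A : Endo L) : lax_dom (lax_id A) = lax_id (endo_dom A).
Proof.
  apply: Lax_eq; first exact: (fn_id1 DD (e_ob A)).
  rewrite [RHS]lax_id_pk.
  have e := pk_fmap_idto (domF (e_ob A) (e_ob A)) (eq_sym (comp1_idrl (e_T A))).
  exact: eq_trans e (f_equal pid (comp1_idl (domF _ _ (e_T A)))).
Qed.

Lemma lax_dom_comp (A B C : Endo L) (g : Lax B C) (f : Lax A B) :
  lax_dom (lax_comp g f) = lax_comp (lax_dom g) (lax_dom f).
Proof.
  apply: Lax_eq; first exact: (fn_comp1 DD (lx_F g) (lx_F f)).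
  exact: eq_trans (lax_paste_fmap DD g f) (eq_sym (lax_comp_pk (lax_dom g) (lax_dom f))).
Qed.

Lemma lax_cod_id (A : Endo L) : lax_cod (lax_id A) = lax_id (endo_cod A).
Proof.
  apply: Lax_eq; first exact: (fn_id1 CC (e_ob A)).
  rewrite [RHS]lax_id_pk.
  have e := pk_fmap_idto (codF (e_ob A) (e_ob A)) (eq_sym (comp1_idrl (e_T A))).
  exact: eq_trans e (f_equal pid (comp1_idl (codF _ _ (e_T A)))).
Qed.

Lemma lax_cod_comp (A B C : Endo L) (g : Lax B C) (f : Lax A B) :
  lax_cod (lax_comp g f) = lax_comp (lax_cod g) (lax_cod f).
Proof.
  apply: Lax_eq; first exact: (fn_comp1 CC (lx_F g) (lx_F f)).
  exact: eq_trans (lax_paste_fmap CC g f) (eq_sym (lax_comp_pk (lax_cod g) (lax_cod f))).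
Qed.

Lemma lax_sq_id (A : Endo L) (c : endo_comm A) :
  lax_sq c c (lax_id A) = sq_id (lax_mor c).
Proof. by apply: Sq_eq; [exact: lax_dom_id|exact: lax_cod_id]. Qed.

Lemma lax_sq_comp (A B C : Endo L) (c : endo_comm A) (d : endo_comm B) (e : endo_comm C)
  (g : Lax B C) (f : Lax A B) :
  lax_sq c e (lax_comp g f) = sq_comp (lax_sq d e g) (lax_sq c d f).
Proof. by apply: Sq_eq; [exact: lax_dom_comp|exact: lax_cod_comp]. Qed.

Lemma lax_sq_hcomp (A B C : Endo L) (c : endo_comm A) (d : endo_comm B) (e : endo_comm C)
  (g g' : Lax B C) (f f' : Lax A B) (t : LaxCell g g') (s : LaxCell f f') :
  (lax_sq_cell c e (lax_hcomp t s) : @Hom (SqCat (lax_mor c) (lax_mor e)) _ _) ≡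
  (sq_hcomp (lax_sq_cell d e t) (lax_sq_cell c d s) : @Hom (SqCat (lax_mor c) (lax_mor e)) _ _).
Proof.
  apply: SqCell_pk_eq; apply: LaxCell_pk_eq.
  - exact: lax_dom_comp.
  - exact: lax_dom_comp.
  - exact: (fn_hcomp DD (lxc t) (lxc s)).
  - exact: lax_cod_comp.
  - exact: lax_cod_comp.
  - exact: (fn_hcomp CC (lxc t) (lxc s)).
Qed.
(** A lax morphism internal to squares and a square of lax morphisms consist of the same data in a
    different order. The exchange is bijective on 2-cells; on 1-cells its image is limited by [S],
    as [lax_sq_surj] records. *)
Definition lax_rep (T : Type) (e : T -> Endo L) (c : forall t, endo_comm (e t)) :
  @Rep (@LaxTwo L) T e (ArrTwo (@LaxTwo K)) T (fun t => lax_mor (c t)).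
Proof.
  unshelve refine (@Build_Rep (@LaxTwo L) T e (ArrTwo (@LaxTwo K)) T (fun t => lax_mor (c t))
    (fun t => t) (fun x y => lax_sqF (c x) (c y)) _ _ _ _ _ _).
  - by move=> x; apply: lax_sq_id.
  - by move=> x y z g f; apply: lax_sq_comp.
  - by move=> x y z g g' f f' b a; apply: lax_sq_hcomp.
  - by move=> x y f g; apply: lax_sq_inj.
  - by move=> x y f g a b; apply: lax_sq_faithful.
  - by move=> x y f g b; apply: lax_sq_full.
Defined.
End Representation.

(** * Colax morphisms as squares *)

Lemma colax_paste_fmap {L K : TwoCat} (G : TwoFunctor L K) (A B C : Endo L) (g : Colax B C) (f : Colax A B) :
  pk (fmap (fn_hom G) (cx_a (colax_comp g f))) =
  vc (hc (pid (fn_hom G (cx_F g))) (pk (fmap (fn_hom G) (cx_a f))))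
    (hc (pk (fmap (fn_hom G) (cx_a g))) (pid (fn_hom G (cx_F f)))).
Proof.
  rewrite [cx_a _]/= /colax_paste /asc /asc' !pk_fmap_comp !pk_fmap_idto pk_image_post pk_image_pre.
  rewrite [vc (pid _) (hc _ _)]vc_idl; first by rewrite /= -fn_comp1 comp1_assoc.
  rewrite [vc (hc _ _) (pid _)]vc_idr; first by rewrite /= -fn_comp1 comp1_assoc.
  rewrite vc_idr //; rewrite src_vc /= -!fn_comp1 ?comp1_assoc //.
Qed.

Lemma colax_cell_pk {K : TwoCat} {A B : Endo K} {F G F' G' : ColaxCat A B} {a : Hom F G}
  {a' : Hom F' G'} : a ≡ a' -> cxc a ≡ cxc a'.
Proof. exact: (f_equal (fun b : Arrow (ColaxCat A B) => pk (cxc (arr b)))). Qed.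

Section Representation.
Context (K : TwoCat) (O : Type) (i : O -> ArrTwo K)
  (S : forall x y : O, hom (i x) (i y) -> Prop)
  (Sid : forall x, S x x (id1 (i x)))
  (Scomp : forall x y z (g : hom (i y) (i z)) (f : hom (i x) (i y)),
     S y z g -> S x y f -> S x z (g ⊚ f)).
Notation L := (SubTwo Sid Scomp).
Notation dm := (fmap (domF _ _)).
Notation cd := (fmap (codF _ _)).
Notation DD := (dom2 Sid Scomp).
Notation CC := (cod2 Sid Scomp).

Definition colax_dom {A B : Endo L} (F : Colax A B) : Colax (endo_dom A) (endo_dom B) :=
  @Build_Colax K (endo_dom A) (endo_dom B) (domF _ _ (cx_F F)) (dm (cx_a F)).
Definition colax_cod {A B : Endo L} (F : Colax A B) : Colax (endo_cod A) (endo_cod B) :=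
  @Build_Colax K (endo_cod A) (endo_cod B) (codF _ _ (cx_F F)) (cd (cx_a F)).

Definition colax_mor (A : Endo L) (c : endo_comm A) : Mor1 (@ColaxTwo K) :=
  @Build_Mor1 (@ColaxTwo K) (endo_dom A) (endo_cod A)
    (@Build_Colax K (endo_dom A) (endo_cod A) (m_arr (i (e_ob A))) (idto c)).

Section Homs.
Context (A B : Endo L) (c : endo_comm A) (d : endo_comm B).

Lemma colax_sq_comm (F : Colax A B) :
  colax_comp (@Build_Colax K (endo_dom B) (endo_cod B) (m_arr (i (e_ob B))) (idto d)) (colax_dom F) =
  colax_comp (colax_cod F) (@Build_Colax K (endo_dom A) (endo_cod A) (m_arr (i (e_ob A))) (idto c)).
Proof. by apply/colax_square; [exact: sq_comm|exact: (sc_comm (cx_a F))]. Qed.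

Definition colax_sq (F : Colax A B) : Sq (colax_mor c) (colax_mor d) :=
  @Build_Sq (@ColaxTwo K) (colax_mor c) (colax_mor d) (colax_dom F) (colax_cod F) (colax_sq_comm F).

Lemma colax_dom_nat (F G : Colax A B) (t : ColaxCell F G) :
  cx_a (colax_dom G) ∘ e_T (endo_dom B) ◁ dm (cxc t) = dm (cxc t) ▷ e_T (endo_dom A) ∘ cx_a (colax_dom F).
Proof.
  have := f_equal (fun a => dm a) (cxc_nat t); rewrite !fmap_comp => e.
  exact: e.
Qed.
Lemma colax_cod_nat (F G : Colax A B) (t : ColaxCell F G) :
  cx_a (colax_cod G) ∘ e_T (endo_cod B) ◁ cd (cxc t) = cd (cxc t) ▷ e_T (endo_cod A) ∘ cx_a (colax_cod F).
Proof.
  have := f_equal (fun a => cd a) (cxc_nat t); rewrite !fmap_comp => e.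
  exact: e.
Qed.

Definition colax_dom_cell (F G : Colax A B) (t : ColaxCell F G) : ColaxCell (colax_dom F) (colax_dom G) :=
  @Build_ColaxCell K _ _ (colax_dom F) (colax_dom G) (dm (cxc t)) (colax_dom_nat t).
Definition colax_cod_cell (F G : Colax A B) (t : ColaxCell F G) : ColaxCell (colax_cod F) (colax_cod G) :=
  @Build_ColaxCell K _ _ (colax_cod F) (colax_cod G) (cd (cxc t)) (colax_cod_nat t).

Lemma colax_sq_cell_comm (F G : Colax A B) (t : ColaxCell F G) :
  (m_arr (colax_mor d) ◁ (colax_dom_cell t : @Hom (@hom (@ColaxTwo K) _ _) _ _)) ≡
  ((colax_cod_cell t : @Hom (@hom (@ColaxTwo K) _ _) _ _) ▷ m_arr (colax_mor c)).
Proof.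
  apply: ColaxCell_pk_eq; [exact: colax_sq_comm|exact: colax_sq_comm|].
  exact: (sc_comm (cxc t)).
Qed.

Definition colax_sq_cell (F G : Colax A B) (t : ColaxCell F G) : SqCell (colax_sq F) (colax_sq G) :=
  @Build_SqCell (@ColaxTwo K) (colax_mor c) (colax_mor d) (colax_sq F) (colax_sq G)
    (colax_dom_cell t) (colax_cod_cell t) (colax_sq_cell_comm t).

Definition colax_sqF : Functor (ColaxCat A B) (SqCat (colax_mor c) (colax_mor d)).
Proof.
  unshelve refine {| fob := colax_sq : ColaxCat A B -> SqCat (colax_mor c) (colax_mor d);
                     fmap := colax_sq_cell |}.
  - move=> F; apply: SqCell_eq; apply: ColaxCell_eq.
      exact: (fmap_id (domF _ _) (cx_F F)).
    exact: (fmap_id (codF _ _) (cx_F F)).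
  - move=> F G H t s; apply: SqCell_eq; apply: ColaxCell_eq.
      exact: (fmap_comp (domF _ _) (cxc t) (cxc s)).
    exact: (fmap_comp (codF _ _) (cxc t) (cxc s)).
Defined.

Lemma colax_sq_inj (F G : Colax A B) : colax_sq F = colax_sq G -> F = G.
Proof.
  move=> e.
  have ed := f_equal (fun f => sq_dom f) e; have ec := f_equal (fun f => sq_cod f) e.
  apply: Colax_eq.
    apply: sub_eq; apply: Sq_eq; [exact: (f_equal (@cx_F _ _ _) ed)|exact: (f_equal (@cx_F _ _ _) ec)].
  apply: dm_cd_pk_eq.
    exact: (f_equal (fun f : Colax _ _ => pk (cx_a f)) ed).
  exact: (f_equal (fun f : Colax _ _ => pk (cx_a f)) ec).
Qed.

Lemma colax_sq_faithful (F G : Colax A B) (s t : ColaxCell F G) : colax_sq_cell s = colax_sq_cell t -> s = t.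
Proof.
  move=> e; apply: ColaxCell_eq; apply: dm_cd_eq.
    exact: (f_equal (fun a : SqCell (colax_sq F) (colax_sq G) => cxc (sc_dom a : ColaxCell _ _)) e).
  exact: (f_equal (fun a : SqCell (colax_sq F) (colax_sq G) => cxc (sc_cod a : ColaxCell _ _)) e).
Qed.

Lemma colax_sq_full (F G : Colax A B) (b : SqCell (colax_sq F) (colax_sq G)) :
  exists t : ColaxCell F G, colax_sq_cell t = b.
Proof.
  pose bd : ColaxCell (colax_dom F) (colax_dom G) := sc_dom b.
  pose bc : ColaxCell (colax_cod F) (colax_cod G) := sc_cod b.
  have hb : m_arr (i (e_ob B)) ◁ cxc bd ≡ cxc bc ▷ m_arr (i (e_ob A)).
    exact: (colax_cell_pk (sc_comm b)).
  pose m : Hom (cx_F F) (cx_F G) := @Build_SqCell K (i (e_ob A)) (i (e_ob B))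
    (proj1_sig (cx_F F)) (proj1_sig (cx_F G)) (cxc bd) (cxc bc) hb.
  have hm : cx_a G ∘ e_T B ◁ m = m ▷ e_T A ∘ cx_a F.
    apply: dm_cd_eq; rewrite !fmap_comp; [exact: (cxc_nat bd)|exact: (cxc_nat bc)].
  exists (Build_ColaxCell hm); apply: SqCell_eq; exact: ColaxCell_eq.
Qed.

Lemma colax_sq_surj (H : Sq (colax_mor c) (colax_mor d))
  (F := fun e => @Build_Sq K (i (e_ob A)) (i (e_ob B)) (cx_F (sq_dom H)) (cx_F (sq_cod H)) e) :
  (forall e, S (F e)) -> exists G : Colax A B, colax_sq G = H.
Proof.
  move=> hF.
  have e : m_arr (i (e_ob B)) ⊚ cx_F (sq_dom H) = cx_F (sq_cod H) ⊚ m_arr (i (e_ob A)).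
    exact: (f_equal (@cx_F _ _ _) (sq_comm H)).
  pose f : @hom L (e_ob A) (e_ob B) := exist _ (F e) (hF e).
  have he := proj1 (@colax_square K (endo_dom A) (endo_dom B) (endo_cod A) (endo_cod B) _ _ c d
    (sq_dom H) (sq_cod H) e) (sq_comm H).
  pose a : Hom (e_T B ⊚ f) (f ⊚ e_T A) := @Build_SqCell K (i (e_ob A)) (i (e_ob B))
    (proj1_sig (e_T B ⊚ f)) (proj1_sig (f ⊚ e_T A)) (cx_a (sq_dom H)) (cx_a (sq_cod H)) he.
  exists (Build_Colax a).
  by apply: Sq_eq; [exact: (colax_eta (sq_dom H))|exact: (colax_eta (sq_cod H))].
Qed.
End Homs.

Lemma colax_dom_id (A : Endo L) : colax_dom (colax_id A) = colax_id (endo_dom A).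
Proof.
  apply: Colax_eq; first exact: (fn_id1 DD (e_ob A)).
  rewrite [RHS]colax_id_pk.
  have e := pk_fmap_idto (domF (e_ob A) (e_ob A)) (comp1_idrl (e_T A)).
  exact: eq_trans e (f_equal pid (comp1_idr (domF _ _ (e_T A)))).
Qed.

Lemma colax_dom_comp (A B C : Endo L) (g : Colax B C) (f : Colax A B) :
  colax_dom (colax_comp g f) = colax_comp (colax_dom g) (colax_dom f).
Proof.
  apply: Colax_eq; first exact: (fn_comp1 DD (cx_F g) (cx_F f)).
  exact: eq_trans (colax_paste_fmap DD g f) (eq_sym (colax_comp_pk (colax_dom g) (colax_dom f))).
Qed.

Lemma colax_cod_id (A : Endo L) : colax_cod (colax_id A) = colax_id (endo_cod A).
Proof.
  apply: Colax_eq; first exact: (fn_id1 CC (e_ob A)).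
  rewrite [RHS]colax_id_pk.
  have e := pk_fmap_idto (codF (e_ob A) (e_ob A)) (comp1_idrl (e_T A)).
  exact: eq_trans e (f_equal pid (comp1_idr (codF _ _ (e_T A)))).
Qed.

Lemma colax_cod_comp (A B C : Endo L) (g : Colax B C) (f : Colax A B) :
  colax_cod (colax_comp g f) = colax_comp (colax_cod g) (colax_cod f).
Proof.
  apply: Colax_eq; first exact: (fn_comp1 CC (cx_F g) (cx_F f)).
  exact: eq_trans (colax_paste_fmap CC g f) (eq_sym (colax_comp_pk (colax_cod g) (colax_cod f))).
Qed.

Lemma colax_sq_id (A : Endo L) (c : endo_comm A) :
  colax_sq c c (colax_id A) = sq_id (colax_mor c).
Proof. by apply: Sq_eq; [exact: colax_dom_id|exact: colax_cod_id]. Qed.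

Lemma colax_sq_comp (A B C : Endo L) (c : endo_comm A) (d : endo_comm B) (e : endo_comm C)
  (g : Colax B C) (f : Colax A B) :
  colax_sq c e (colax_comp g f) = sq_comp (colax_sq d e g) (colax_sq c d f).
Proof. by apply: Sq_eq; [exact: colax_dom_comp|exact: colax_cod_comp]. Qed.

Lemma colax_sq_hcomp (A B C : Endo L) (c : endo_comm A) (d : endo_comm B) (e : endo_comm C)
  (g g' : Colax B C) (f f' : Colax A B) (t : ColaxCell g g') (s : ColaxCell f f') :
  (colax_sq_cell c e (colax_hcomp t s) : @Hom (SqCat (colax_mor c) (colax_mor e)) _ _) ≡
  (sq_hcomp (colax_sq_cell d e t) (colax_sq_cell c d s) : @Hom (SqCat (colax_mor c) (colax_mor e)) _ _).
Proof.
  apply: SqCell_pk_eq; apply: ColaxCell_pk_eq.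
  - exact: colax_dom_comp.
  - exact: colax_dom_comp.
  - exact: (fn_hcomp DD (cxc t) (cxc s)).
  - exact: colax_cod_comp.
  - exact: colax_cod_comp.
  - exact: (fn_hcomp CC (cxc t) (cxc s)).
Qed.
Definition colax_rep (T : Type) (e : T -> Endo L) (c : forall t, endo_comm (e t)) :
  @Rep (@ColaxTwo L) T e (ArrTwo (@ColaxTwo K)) T (fun t => colax_mor (c t)).
Proof.
  unshelve refine (@Build_Rep (@ColaxTwo L) T e (ArrTwo (@ColaxTwo K)) T (fun t => colax_mor (c t))
    (fun t => t) (fun x y => colax_sqF (c x) (c y)) _ _ _ _ _ _).
  - by move=> x; apply: colax_sq_id.
  - by move=> x y z g f; apply: colax_sq_comp.
  - by move=> x y z g g' f f' b a; apply: colax_sq_hcomp.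
  - by move=> x y f g; apply: colax_sq_inj.
  - by move=> x y f g a b; apply: colax_sq_faithful.
  - by move=> x y f g b; apply: colax_sq_full.
Defined.
End Representation.

(** * The comparison *)

Definition rep_id (K : TwoCat) (O : Type) (i : O -> K) : Rep i i.
Proof.
  by unshelve refine (@Build_Rep K O i K O i (fun o => o) (fun x y => functor_id _) _ _ _ _ _ _);
     move=> * //; eexists.
Defined.

Definition rep_along (K : TwoCat) (O : Type) (i : O -> K) (U : TwoCat) (R T : Type) (v : R -> U)
  (f : T -> R) (r : Rep i (fun t => v (f t))) : Rep i v :=
  @Build_Rep K O i U R v (fun o => f (r o)) (fun x y => rp_hom r) (rp_id1 r) (rp_comp1 r)
    (rp_hcomp r) (@rp_inj _ _ _ _ _ _ r) (@rp_faithful _ _ _ _ _ _ r) (@rp_full _ _ _ _ _ _ r).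

(* A tangent fibration, or a tangent object of [Fib], without its choices of
   n-fold pullbacks. *)
Record Raw := {
  rw_tot : Endo Cat;
  rw_base : Endo Cat;
  rw_ctot : Core rw_tot;
  rw_cbase : Core rw_base;
  rw_fun : @hom Cat (e_ob rw_tot) (e_ob rw_base);
  rw_cl : Cleavage rw_fun;
  rw_comm : e_T rw_base ⊚ rw_fun = rw_fun ⊚ e_T rw_tot }.

Definition raw_lax (r : Raw) : Mor1 (@LaxTwo Cat) :=
  @Build_Mor1 (@LaxTwo Cat) (rw_tot r) (rw_base r)
    (@Build_Lax Cat (rw_tot r) (rw_base r) (rw_fun r) (idto (eq_sym (rw_comm r)))).
Definition raw_colax (r : Raw) : Mor1 (@ColaxTwo Cat) :=
  @Build_Mor1 (@ColaxTwo Cat) (rw_tot r) (rw_base r)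
    (@Build_Colax Cat (rw_tot r) (rw_base r) (rw_fun r) (idto (rw_comm r))).

Lemma raw_eq (Et Eb : Endo Cat) (ct ct' : Core Et) (cb cb' : Core Eb)
  (F : @hom Cat (e_ob Et) (e_ob Eb)) (cl : Cleavage F) h h' :
  ct = ct' -> cb = cb' ->
  @Build_Raw Et Eb ct cb F cl h = @Build_Raw Et Eb ct' cb' F cl h'.
Proof. by move=> -> ->; rewrite (proof_irrelevance _ h h'). Qed.

Definition raw_fib (t : TangentObject Fib) : Raw :=
  @Build_Raw (t_endo (dom_tangent t)) (t_endo (cod_tangent t))
    (core (dom_tangent t)) (core (cod_tangent t)) (f_fun (t_ob t)) (f_cl (t_ob t)) (fib_comm t).
Definition raw_tf (Q : TangentFibration) : Raw :=
  @Build_Raw (t_endo (tf_tot Q)) (t_endo (tf_base Q)) (core (tf_tot Q)) (core (tf_base Q))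
    (tf_fun Q) (tf_cl Q) (tf_comm Q).

(** The strictified T_n of the total category are invisible to [Core], by [core_retan]; the base
    keeps its own T_n. *)
Lemma raw_fib_tangent (Q : TangentFibration) : raw_fib (tf_tangent Q) = raw_tf Q.
Proof.
  apply: (@raw_eq (t_endo (tf_tot Q)) (t_endo (tf_base Q)) _ (core (tf_tot Q)) _ (core (tf_base Q))
    (tf_fun Q) (tf_cl Q)).
    exact (core_retan (@tf_str_iso Q)).
  reflexivity.
Qed.

(** Restricted to values that come from a tangent object of [Fib], so that every index is hit by
    both representations. [image_generated] relies on this when it lifts the intermediate objects of
    a composite. *)
Definition FibRaw : Type := {r : Raw | exists t, raw_fib t = r}.
Definition fib_raw (t : TangentObject Fib) : FibRaw :=
  exist _ (raw_fib t) (ex_intro _ t eq_refl).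
Definition tf_raw (Q : TangentFibration) : FibRaw :=
  exist _ (raw_tf Q) (ex_intro _ (tf_tangent Q) (raw_fib_tangent Q)).

Lemma fib_raw_tangent (Q : TangentFibration) : fib_raw (tf_tangent Q) = tf_raw Q.
Proof. by apply: sub_eq; apply: raw_fib_tangent. Qed.
Lemma tf_raw_to (t : TangentObject Fib) : tf_raw (to_tf t) = fib_raw t.
Proof. by apply: sub_eq. Qed.

Definition lax_val (r : FibRaw) : ArrTwo (@LaxTwo Cat) := raw_lax (proj1_sig r).
Definition colax_val (r : FibRaw) : ArrTwo (@ColaxTwo Cat) := raw_colax (proj1_sig r).

Definition lax_fib_rep :
  @Rep (@LaxTwo Fib) (TangentObject Fib) (fun t => t_endo t) _ FibRaw lax_val :=
  @rep_along (@LaxTwo Fib) (TangentObject Fib) (fun t => t_endo t) (ArrTwo (@LaxTwo Cat))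
    FibRaw (TangentObject Fib) lax_val fib_raw
    (@lax_rep Cat Fibration f_mor1 is_fibration_morphism (fun P => preserves_cleavage_id (f_cl P))
       is_fibration_morphism_comp (TangentObject Fib) (fun t => t_endo t) fib_comm).

Definition colax_fib_rep :
  @Rep (@ColaxTwo Fib) (TangentObject Fib) (fun t => t_endo t) _ FibRaw colax_val :=
  @rep_along (@ColaxTwo Fib) (TangentObject Fib) (fun t => t_endo t) (ArrTwo (@ColaxTwo Cat))
    FibRaw (TangentObject Fib) colax_val fib_raw
    (@colax_rep Cat Fibration f_mor1 is_fibration_morphism (fun P => preserves_cleavage_id (f_cl P))
       is_fibration_morphism_comp (TangentObject Fib) (fun t => t_endo t) fib_comm).

Definition lax_tf_rep : @Rep (ArrTwo (@LaxTwo Cat)) TangentFibration tf_lax _ FibRaw lax_val :=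
  @rep_along (ArrTwo (@LaxTwo Cat)) TangentFibration tf_lax (ArrTwo (@LaxTwo Cat))
    FibRaw TangentFibration lax_val tf_raw (@rep_id (ArrTwo (@LaxTwo Cat)) TangentFibration tf_lax).

Definition colax_tf_rep : @Rep (ArrTwo (@ColaxTwo Cat)) TangentFibration tf_colax _ FibRaw colax_val :=
  @rep_along (ArrTwo (@ColaxTwo Cat)) TangentFibration tf_colax (ArrTwo (@ColaxTwo Cat))
    FibRaw TangentFibration colax_val tf_raw
    (@rep_id (ArrTwo (@ColaxTwo Cat)) TangentFibration tf_colax).

Record raw_is_lax (r r' : Raw) (F : Sq (raw_lax r) (raw_lax r')) : Prop := {
  rl_base : core_lax (rw_cbase r) (rw_cbase r') (sq_cod F);
  rl_tot : core_lax (rw_ctot r) (rw_ctot r') (sq_dom F);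
  rl_fib : preserves_cleavage (rw_cl r) (rw_cl r') (lx_F (sq_cod F)) (lx_F (sq_dom F)) }.

Lemma lax_tf_image (P Q : TangentFibration) (F : Sq (tf_lax P) (tf_lax Q)) :
  is_lax_tf F <-> raw_is_lax (r := raw_tf P) (r' := raw_tf Q) F.
Proof. by split=> -[/is_lax_core hb /is_lax_core ht hf]; split. Qed.

Lemma lax_fib_image (t t' : TangentObject Fib) (A : Lax (t_endo t) (t_endo t')) :
  is_lax (t := t) (t' := t') A <->
  raw_is_lax (r := raw_fib t) (r' := raw_fib t') (rp_hom lax_fib_rep A).
Proof.
  have h := is_lax_iff fib_jointly_reflect (I1 := dom_image t) (I2 := cod_image t)
    (I1' := dom_image t') (I2' := cod_image t') (A := A) eq_refl eq_refl (t_tangent t').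
  split.
  - move=> /h [/is_lax_core h1 /is_lax_core h2]; split; [exact: h2|exact: h1|].
    exact: (proj2_sig (lx_F A)).
  - move=> [h2 h1 _]; apply/h; split; apply/is_lax_core; [exact: h1|exact: h2].
Qed.

Definition lax_val_kind (r r' : FibRaw) (F : hom (lax_val r) (lax_val r')) : Prop :=
  raw_is_lax (r := proj1_sig r) (r' := proj1_sig r') F.

Lemma lax_fib_exists (t t' : TangentObject Fib)
  (F : hom (lax_val (lax_fib_rep t)) (lax_val (lax_fib_rep t'))) :
  (exists A, is_lax (t := t) (t' := t') A /\ rp_hom lax_fib_rep A = F) <-> lax_val_kind F.
Proof.
  split.
  - by move=> [A [hA <-]]; exact: (proj1 (lax_fib_image A) hA).
  - move=> hF.
    have [A hA] := @lax_sq_surj Cat Fibration f_mor1 is_fibration_morphism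
      (fun P => preserves_cleavage_id (f_cl P)) is_fibration_morphism_comp
      (t_endo t) (t_endo t') (fib_comm t) (fib_comm t') F (fun _ => rl_fib hF).
    have hA' : is_lax (t := t) (t' := t') A by apply/lax_fib_image; rewrite /= hA.
    exact (ex_intro _ A (conj hA' hA)).
Qed.

Lemma lax_tf_exists (P Q : TangentFibration)
  (F : hom (lax_val (lax_tf_rep P)) (lax_val (lax_tf_rep Q))) :
  (exists A, is_lax_tf A /\ rp_hom lax_tf_rep A = F) <-> lax_val_kind F.
Proof.
  split; first by move=> [A [hA <-]]; exact: (proj1 (lax_tf_image A) hA).
  by move=> hF; exists F; split=> //; apply/lax_tf_image.
Qed.

Lemma lax_equivalence : equivalent2 (Tng Fib) TngFib.
Proof.
  have [||||Eq _] := @compare _ _ lax_val lax_val_kind _ _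
    (rep_sub lax_fib_rep (fun t => is_lax_id t) (fun _ _ _ B A => @is_lax_comp Fib _ _ _ B A))
    (rep_sub lax_tf_rep is_lax_tf_id is_lax_tf_comp).
  - exact: rep_sub_has_image lax_fib_exists.
  - exact: rep_sub_has_image lax_tf_exists.
  - by move=> t; exists (to_tf t); apply: tf_raw_to.
  - by move=> Q; exists (tf_tangent Q); apply: fib_raw_tangent.
  - by constructor.
Qed.

(** * Colax, strong and strict morphisms treated uniformly *)

Section ColaxKind.
Context (E : forall A B : Endo Cat, Colax A B -> Prop).

(** [E] is what a kind demands of the 2-cell beyond the colax conditions: nothing, invertibility, or
    being an identity. It is a condition on colax morphisms of bare endomorphisms, hence independent
    of the T_n. *)
Record raw_is_colax (r r' : Raw) (F : Sq (raw_colax r) (raw_colax r')) : Prop := {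
  rc_base : core_colax (rw_cbase r) (rw_cbase r') (sq_cod F) /\ E (sq_cod F);
  rc_tot : core_colax (rw_ctot r) (rw_ctot r') (sq_dom F) /\ E (sq_dom F);
  rc_fib : preserves_cleavage (rw_cl r) (rw_cl r') (cx_F (sq_cod F)) (cx_F (sq_dom F)) }.

Context (R : forall t t' : TangentData Cat, Colax (t_endo t) (t_endo t') -> Prop)
  (hR : forall (t t' : TangentObject Cat) (A : Colax (t_endo t) (t_endo t')),
     @R t t' A <-> is_colax (t := t) (t' := t') A /\ E A).
Context (S : forall t t' : TangentData Fib, Colax (t_endo t) (t_endo t') -> Prop)
  (hS : forall (t t' : TangentObject Fib) (A : Colax (t_endo t) (t_endo t')),
     @S t t' A <-> @R (dom_tangent t) (dom_tangent t') (colax_dom A) /\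
                   @R (cod_tangent t) (cod_tangent t') (colax_cod A)).

Lemma core_kind (t t' : TangentObject Cat) (A : Colax (t_endo t) (t_endo t')) :
  @R t t' A <-> core_colax (core t) (core t') A /\ E A.
Proof. by rewrite hR (is_colax_core A (t_tangent t)). Qed.

Lemma colax_tf_image (P Q : TangentFibration) (F : Sq (tf_colax P) (tf_colax Q)) :
  is_colax_tf R F <-> raw_is_colax (r := raw_tf P) (r' := raw_tf Q) F.
Proof. by split=> -[/core_kind hb /core_kind ht hf]; split. Qed.

Lemma colax_fib_image (t t' : TangentObject Fib) (A : Colax (t_endo t) (t_endo t')) :
  @S t t' A <-> raw_is_colax (r := raw_fib t) (r' := raw_fib t') (rp_hom colax_fib_rep A).
Proof.
  split.
  - move=> /hS [/core_kind h1 /core_kind h2]; split; [exact: h2|exact: h1|].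
    exact: (proj2_sig (cx_F A)).
  - move=> [h2 h1 _]; apply/hS; split; apply/core_kind; [exact: h1|exact: h2].
Qed.

Lemma fib_raw_surj (r : FibRaw) : exists t, fib_raw t = r.
Proof. by case: r => r [t e]; exists t; apply: sub_eq. Qed.
Lemma tf_raw_surj (r : FibRaw) : exists Q, tf_raw Q = r.
Proof. by have [t <-] := fib_raw_surj r; exists (to_tf t); apply: tf_raw_to. Qed.

Definition colax_val_kind (r r' : FibRaw) (F : hom (colax_val r) (colax_val r')) : Prop :=
  raw_is_colax (r := proj1_sig r) (r' := proj1_sig r') F.

Lemma colax_fib_exists (t t' : TangentObject Fib) (F : hom (colax_val (colax_fib_rep t)) (colax_val (colax_fib_rep t'))) :
  (exists A, @S t t' A /\ rp_hom colax_fib_rep A = F) <->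
  colax_val_kind F.
Proof.
  split.
  - by move=> [A [hA <-]]; exact: (proj1 (colax_fib_image A) hA).
  - move=> hF.
    have [A hA] := @colax_sq_surj Cat Fibration f_mor1 is_fibration_morphism
      (fun P => preserves_cleavage_id (f_cl P)) is_fibration_morphism_comp
      (t_endo t) (t_endo t') (fib_comm t) (fib_comm t') F (fun _ => rc_fib hF).
    by exists A; split=> //; apply/colax_fib_image; rewrite /= hA.
Qed.

Lemma colax_tf_exists (P Q : TangentFibration) (F : hom (colax_val (colax_tf_rep P)) (colax_val (colax_tf_rep Q))) :
  (exists A, is_colax_tf R A /\ rp_hom colax_tf_rep A = F) <->
  colax_val_kind F.
Proof.
  split; first by move=> [A [hA <-]]; exact: (proj1 (colax_tf_image A) hA).
  by move=> hF; exists F; split=> //; apply/colax_tf_image.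
Qed.

Lemma colax_equivalence Sid Scomp Rid Rcomp :
  equivalent2
    (@SubTwo (@ColaxTwo Fib) (TangentObject Fib) (fun t => t_endo t)
       (fun t t' A => @S t t' A) Sid Scomp)
    (@SubTwo (ArrTwo (@ColaxTwo Cat)) TangentFibration tf_colax (is_colax_tf R) Rid Rcomp).
Proof.
  have [||||Eq _] := @compare _ _ colax_val colax_val_kind
    _ _ (rep_sub colax_fib_rep Sid Scomp) (rep_sub colax_tf_rep Rid Rcomp).
  - exact: rep_sub_has_image colax_fib_exists.
  - exact: rep_sub_has_image colax_tf_exists.
  - by move=> t; exists (to_tf t); apply: tf_raw_to.
  - by move=> Q; exists (tf_tangent Q); apply: fib_raw_tangent.
  - by constructor.
Qed.

(** Here the image on both sides is [generated colax_val_kind]. Identities of the required kind put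
    the identities of the common 2-category into [colax_val_kind], as needed both by
    [image_generated] and for the unit and counit to be of that kind. *)
Lemma colax_generated_equivalence :
  (forall t : TangentObject Fib, @S t t (colax_id (t_endo t))) ->
  exists Eq : TwoEquivalence
    (@GenTwo (@ColaxTwo Fib) (TangentObject Fib) (fun t => t_endo t) (fun t t' A => @S t t' A))
    (@GenTwo (ArrTwo (@ColaxTwo Cat)) TangentFibration tf_colax (is_colax_tf R)),
  restricts Eq (fun t t' A => @S t t' (proj1_sig A))
    (fun P Q F => is_colax_tf R (P := P) (Q := Q) (proj1_sig F)).
Proof.
  move=> hid.
  have hid' r : colax_val_kind (id1 (colax_val r)).
    have [t <-] := fib_raw_surj r; apply/colax_fib_exists.
    by exists (colax_id (t_endo t)); split=> //; apply: (rp_id1 colax_fib_rep t).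
  have [||||Eq hE] := @compare _ _ colax_val (generated colax_val_kind) _ _
    (rep_sub colax_fib_rep
      (@gen_id (@ColaxTwo Fib) (TangentObject Fib) (fun t => t_endo t) (fun t t' A => @S t t' A))
      (@gen_comp (@ColaxTwo Fib) (TangentObject Fib) (fun t => t_endo t) (fun t t' A => @S t t' A)))
    (rep_sub colax_tf_rep
      (@gen_id (ArrTwo (@ColaxTwo Cat)) TangentFibration tf_colax (is_colax_tf R))
      (@gen_comp (ArrTwo (@ColaxTwo Cat)) TangentFibration tf_colax (is_colax_tf R))).
  - apply: rep_sub_has_image.
    exact: (@image_generated _ _ _ _ _ _ colax_fib_rep _ _ fib_raw_surj hid' colax_fib_exists).
  - apply: rep_sub_has_image.
    exact: (@image_generated _ _ _ _ _ _ colax_tf_rep _ _ tf_raw_surj hid' colax_tf_exists).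
  - by move=> t; exists (to_tf t); apply: tf_raw_to.
  - by move=> Q; exists (tf_tangent Q); apply: fib_raw_tangent.
  - exists Eq; apply: hE (colax_val_kind) _ _ hid'.
      by move=> t t' A; apply: colax_fib_image.
    by move=> P Q F; apply: colax_tf_image.
Qed.
End ColaxKind.

Section Kinds.
Context (t t' : TangentObject Fib) (A : Colax (t_endo t) (t_endo t')).

Lemma is_colax_fib : is_colax (t := t) (t' := t') A <->
  is_colax (t := dom_tangent t) (t' := dom_tangent t') (colax_dom A) /\
  is_colax (t := cod_tangent t) (t' := cod_tangent t') (colax_cod A).
Proof.
  exact: (is_colax_iff fib_jointly_reflect (I1 := dom_image t) (I2 := cod_image t)
    (I1' := dom_image t') (I2' := cod_image t') (A := A) eq_refl eq_refl (t_tangent t)).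
Qed.

Lemma is_strong_fib : is_strong (t := t) (t' := t') A <->
  is_strong (t := dom_tangent t) (t' := dom_tangent t') (colax_dom A) /\
  is_strong (t := cod_tangent t) (t' := cod_tangent t') (colax_cod A).
Proof.
  exact: (is_strong_iff fib_jointly_reflect (I1 := dom_image t) (I2 := cod_image t)
    (I1' := dom_image t') (I2' := cod_image t') (A := A) eq_refl eq_refl (t_tangent t)).
Qed.

Lemma is_strict_fib : is_strict (t := t) (t' := t') A <->
  is_strict (t := dom_tangent t) (t' := dom_tangent t') (colax_dom A) /\
  is_strict (t := cod_tangent t) (t' := cod_tangent t') (colax_cod A).
Proof.
  exact: (is_strict_iff fib_jointly_reflect (I1 := dom_image t) (I2 := cod_image t)
    (I1' := dom_image t') (I2' := cod_image t') (A := A) eq_refl eq_refl (t_tangent t)).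
Qed.
End Kinds.

Theorem proposition5p1 :
  equivalent2 (Tng Fib) TngFib /\
  (exists E : TwoEquivalence (Tng_co Fib) TngFib_co,
     restricts E (@Tng_co_colax Fib) (@TngFib_co_colax)) /\
  equivalent2 (Tng_strong Fib) TngFib_strong /\
  equivalent2 (Tng_strict Fib) TngFib_strict.
Proof.
  split; [|split; [|split]].
  - exact: lax_equivalence.
  - apply: (@colax_generated_equivalence (fun _ _ _ => True) (@is_colax Cat) _
      (@is_colax Fib) is_colax_fib).
    + by move=> t t' A; split=> [h|[]].
    + by move=> t; exact: (proj1 (is_strong_id (t_tangent t))).
  - by apply: (@colax_equivalence (fun _ _ F => is_iso (cx_a F)) (@is_strong Cat) _
      (@is_strong Fib) is_strong_fib).
  - by apply: (@colax_equivalence (fun A B F => cx_a F ≡ idm (e_T B ⊚ cx_F F)) (@is_strict Cat) _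
      (@is_strict Fib) is_strict_fib).
Qed.
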